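(* Let $\gamma\in(0,4\pi]$. For every $\alpha>0$ let $u_\alpha\in H^1_{0,\mathrm{rad}}(B)$, $u_\alpha=u_\alpha(|x|)$, be a nonnegative maximizer for $S^{\mathrm{rad}}(\alpha,\gamma)$, that is, $u_\alpha\ge 0$, $\|u_\alpha\|=1$ and $\int_B\left(e^{\gamma u_\alpha^2}-1\right)|x|^\alpha\,dx=S^{\mathrm{rad}}(\alpha,\gamma)$. Then $$\lim_{\alpha\to+\infty}\sqrt{\frac{\alpha+2}{2}}\;u_\alpha\!\left(|x|^{\frac{2}{\alpha+2}}\right)=\varphi_1\quad\text{strongly in } H_0^1(B),$$ i.e. the functions $x\mapsto \sqrt{\tfrac{\alpha+2}{2}}\,u_\alpha(|x|^{2/(\alpha+2)})$ converge to $\varphi_1$ in the norm of $H_0^1(B)$ as $\alpha\to+\infty$.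
   Context: $B=\{x\in\mathbb{R}^2:|x|<1\}$ is the open unit disk in the plane. $H_0^1(B)$ is the usual Sobolev space (of real-valued functions) with the Dirichlet norm $\|u\|=\left(\int_B|\nabla u|^2\,dx\right)^{1/2}$, and $H^1_{0,\mathrm{rad}}(B)$ is its subspace of radial functions; for a radial function $u$ we write $u(x)=u(|x|)$. For $\alpha>0$ and $0<\gamma\le 4\pi$, $$S^{\mathrm{rad}}(\alpha,\gamma)=\sup_{u\in H^1_{0,\mathrm{rad}}(B),\ \|u\|=1}\int_B\left(e^{\gamma u^2}-1\right)|x|^\alpha\,dx.$$ $\lambda_1$ denotes the first eigenvalue of $-\Delta$ on $H_0^1(B)$ and $\varphi_1$ the corresponding positive eigenfunction, normalized by $\|\varphi_1\|=1$. *)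

(* Defs.v *)
From HB Require Import structures.
From mathcomp Require Import all_boot all_order all_algebra.
From mathcomp Require Import all_classical all_reals all_analysis.
Set Implicit Arguments.
Unset Strict Implicit.
Unset Printing Implicit Defensive.
Import Order.TTheory GRing.Theory Num.Theory numFieldNormedType.Exports.
Local Open Scope classical_set_scope.
Local Open Scope ring_scope.

(* Elements of L^2(B), H^1(B), ... are represented by functions R * R -> R;
   only their restriction to the disk up to null sets matters.  Membership
   predicates and norms are invariant under a change of measurable
   representative. *)

(* The canonical norm `|x| of R * R is the max norm, hence a separate
   Euclidean norm (both induce the same topology). *)
Definition enorm (R : realType) (x : R * R) : R :=
  Num.sqrt (x.1 ^+ 2 + x.2 ^+ 2).

Definition disk (R : realType) : set (R * R) := [set x | enorm x < 1].
Arguments disk : clear implicits.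

Notation mu2 R := (@lebesgue_measure R \x @lebesgue_measure R)%E.

Definition e1 (R : realType) : R * R := (1, 0).
Definition e2 (R : realType) : R * R := (0, 1).
Arguments e1 : clear implicits.
Arguments e2 : clear implicits.

Fixpoint is_Ck (R : realType) (k : nat) (f : R * R -> R) : Prop :=
  continuous f /\
  if k is k'.+1 then
    [/\ forall x, derivable f x (e1 R), forall x, derivable f x (e2 R),
        is_Ck k' ('D_(e1 R) f) & is_Ck k' ('D_(e2 R) f)]
  else True.

(* C_c^oo(B), each function being extended by zero to the plane *)
Definition test_function (R : realType) (phi : R * R -> R) : Prop :=
  [/\ forall k, is_Ck k phi,
      compact (closure [set x | phi x != 0]) &
      closure [set x | phi x != 0] `<=` disk R].

Definition L2 (R : realType) (f : R * R -> R) : Prop :=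
  measurable_fun (disk R) f /\
  (mu2 R).-integrable (disk R) (EFin \o (fun x => f x ^+ 2)).

Definition is_weak_deriv (R : realType) (e : R * R) (u g : R * R -> R) : Prop :=
  L2 g /\
  forall phi, test_function phi ->
    \int[mu2 R]_(x in disk R) (u x * 'D_e phi x) =
    - \int[mu2 R]_(x in disk R) (g x * phi x).

(* A representative of the weak derivative in direction e (unique up to a null
   subset of the disk); junk value 0 if there is none. *)
Definition weak_deriv (R : realType) (e : R * R) (u : R * R -> R) : R * R -> R :=
  xget (fun=> 0) [set g | is_weak_deriv e u g].

Definition H1 (R : realType) (u : R * R -> R) : Prop :=
  [/\ L2 u, exists g, is_weak_deriv (e1 R) u g &
      exists g, is_weak_deriv (e2 R) u g].

Definition dirichlet_form (R : realType) (u v : R * R -> R) : R :=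
  \int[mu2 R]_(x in disk R)
    (weak_deriv (e1 R) u x * weak_deriv (e1 R) v x +
     weak_deriv (e2 R) u x * weak_deriv (e2 R) v x).

Definition dirichlet_norm (R : realType) (u : R * R -> R) : R :=
  Num.sqrt (dirichlet_form u u).

Definition H1_norm (R : realType) (u : R * R -> R) : R :=
  Num.sqrt (\int[mu2 R]_(x in disk R) (u x ^+ 2) + dirichlet_form u u).

(* closure of C_c^oo(B) in H^1(B) *)
Definition H10 (R : realType) (u : R * R -> R) : Prop :=
  H1 u /\
  forall eps : R, 0 < eps ->
    exists2 phi, test_function phi & H1_norm (fun x => u x - phi x) < eps.

(* "u(x) = f(|x|)" almost everywhere in the disk.  Measurability of f is only
   the choice of a representative, as for measurable u in the definition of L2:
   every radial class in L^2(B) has a Borel profile. *)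
Definition is_profile (R : realType) (u : R * R -> R) (f : R -> R) : Prop :=
  measurable_fun (`[0, 1[%classic : set R) f /\
  {ae mu2 R, forall x, disk R x -> u x = f (enorm x)}.

Definition H10rad (R : realType) (u : R * R -> R) : Prop :=
  H10 u /\ exists f, is_profile u f.

(* The functional may a priori be +oo, so it takes values in \bar R. *)
Definition henon_moser (R : realType) (alpha gamma : R) (u : R * R -> R)
    : \bar R :=
  (\int[mu2 R]_(x in disk R)
     ((expR (gamma * u x ^+ 2) - 1) * enorm x `^ alpha)%:E)%E.

Definition Srad (R : realType) (alpha gamma : R) : \bar R :=
  ereal_sup [set henon_moser alpha gamma u |
             u in [set u | H10rad u /\ dirichlet_norm u = 1]].

Definition is_nonneg_maximizer (R : realType) (alpha gamma : R)
    (u : R * R -> R) : Prop :=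
  [/\ H10rad u, {ae mu2 R, forall x, disk R x -> 0 <= u x},
      dirichlet_norm u = 1 & henon_moser alpha gamma u = Srad alpha gamma].

(* u is a (weak) eigenfunction of -Delta on H_0^1(B) with eigenvalue l *)
Definition is_eigenfunction (R : realType) (l : R) (u : R * R -> R) : Prop :=
  [/\ H10 u, ~ {ae mu2 R, forall x, disk R x -> u x = 0} &
      forall v, H10 v ->
        dirichlet_form u v = l * \int[mu2 R]_(x in disk R) (u x * v x)].

Definition is_first_eigenvalue (R : realType) (l : R) : Prop :=
  (exists u, is_eigenfunction l u) /\
  forall m u, is_eigenfunction m u -> l <= m.

Definition is_first_eigenfunction (R : realType) (l : R) (phi : R * R -> R)
    : Prop :=
  [/\ is_first_eigenvalue l, is_eigenfunction l phi,
      {ae mu2 R, forall x, disk R x -> 0 < phi x} & dirichlet_norm phi = 1].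

(* x |-> sqrt((alpha+2)/2) f(|x|^(2/(alpha+2))), f being the profile *)
Definition rescaled (R : realType) (alpha : R) (f : R -> R) (x : R * R) : R :=
  Num.sqrt ((alpha + 2) / 2) * f (enorm x `^ (2 / (alpha + 2))).

(* Main.v *)
(* A radial function of H^1_0(B) is u(x) = F(|x|^2) with F(s) = - int_s^1 f and
   int |grad u|^2 = 4 |B| int_0^1 s f(s)^2 ds, so that F(s)^2 <= ln(1/s) int_0^1 s f^2.
   With beta = 2/(alpha+2), the substitution s -> s^beta preserves the Dirichlet norm of
   w = beta^(-1/2) u(|x|^beta) and turns the functional into beta int_B (exp(gamma beta w^2) - 1).
   Expanding the exponential, a maximizer satisfies
   int_B w^2 >= 1/lambda_1 - C beta, by comparison with the rescaled ground state psi and because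
   exp(gamma beta w^2) <= |x|^(-1/2) for small beta.
   The ground state is explicit (a Bessel function); the identity of Picone and the Poincare
   inequality with weight psi^2 along coordinate paths give the spectral gap
   |w|^2 |psi|^2 - <w, psi>^2 <= C (|grad w|^2 - lambda_1 |w|^2) in H^1_0(B).
   Hence w is close to psi/|grad psi| in the Dirichlet norm; the same inequality applied to
   phi_1 itself gives phi_1 = psi/|grad psi|. *)

(* The limit is identified without compactness or regularity theory: each step is an explicit
   inequality, and for small beta they bound the squared Dirichlet distance to phi_1 by a constant
   times beta. The gap inequality comes from the equation of psi, its positivity and its radial
   monotonicity; it serves both as uniqueness of the ground state and as a stability estimate, so no
   spectral decomposition is involved. The variable s = |x|^2 is preferred to |x| because it is
   smooth at the origin and uniformly distributed on the disk, so that radial integrals follow from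
   the scaling of the plane measure. The main obstacle is that a radial element of H^1_0 is known
   only as a limit of test functions that may fail to be radial. Its profile is recovered in weak
   form: the image of (x . grad u) dx under |x|^2 has a Radon-Nikodym density, which determines f,
   and testing against radial vector fields shows that u is the corresponding primitive. *)
Require Import Defs.
From mathcomp Require Import all_boot all_order all_algebra.
From mathcomp Require Import ring lra.
From mathcomp Require Import all_classical all_reals all_analysis measurable_realfun.
Import Order.TTheory GRing.Theory Num.Theory numFieldNormedType.Exports.
Local Open Scope classical_set_scope.
Local Open Scope ring_scope.
Set Implicit Arguments.
Unset Strict Implicit.
Unset Printing Implicit Defensive.

Lemma squeeze0 (R : realType) (a b : R^nat) : (forall n, `|a n| <= b n) ->
  b n @[n --> \oo] --> (0 : R) -> a n @[n --> \oo] --> (0 : R).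
Proof.
move=> ab c; have cN : (- b n) @[n --> \oo] --> (- 0 : R) by exact: cvgN.
rewrite oppr0 in cN; apply: squeeze_cvgr cN c.
by apply: nearW => n; rewrite -ler_norml; exact: ab.
Qed.

(** * L2 inner products *)

Section sqint.
Context d (T : measurableType d) (R : realType).
Variables (mu : {measure set T -> \bar R}) (D : set T) (mD : measurable D).
Implicit Types f g h : T -> R.

(** Kept over an arbitrary measure because the same calculus serves the disk, where it is
    convertible to [L2], and the interval []0, 1[]. *)
Definition sqint f := measurable_fun D f /\
  mu.-integrable D (EFin \o (fun x => f x ^+ 2)).

Definition ip f g := \int[mu]_(x in D) (f x * g x).

Lemma ipC f g : ip f g = ip g f.
Proof. by rewrite /ip; under eq_Rintegral do rewrite mulrC. Qed.

Lemma le_integrableR f g : measurable_fun D f ->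
  mu.-integrable D (EFin \o g) -> (forall x, D x -> `|f x| <= g x) ->
  mu.-integrable D (EFin \o f).
Proof.
move=> mf ig fg; apply: (le_integrable mD _ _ ig).
  exact/measurable_EFinP.
by move=> x Dx; rewrite lee_fin (le_trans (fg _ Dx))// ler_norm.
Qed.

Lemma integrableDR f g : mu.-integrable D (EFin \o f) ->
  mu.-integrable D (EFin \o g) -> mu.-integrable D (EFin \o (fun x => f x + g x)).
Proof. by move=> i1 i2; exact: (integrableD mD i1 i2). Qed.

Lemma integrableBR f g : mu.-integrable D (EFin \o f) ->
  mu.-integrable D (EFin \o g) -> mu.-integrable D (EFin \o (fun x => f x - g x)).
Proof. by move=> i1 i2; exact: (integrableB mD i1 i2). Qed.

Lemma integrableZR (k : R) f : mu.-integrable D (EFin \o f) ->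
  mu.-integrable D (EFin \o (fun x => k * f x)).
Proof. by move=> i; exact: (integrableZl mD k i). Qed.

Lemma integrable_mfun f : mu.-integrable D (EFin \o f) -> measurable_fun D f.
Proof. by move=> i; apply/measurable_EFinP; exact: (measurable_int mu). Qed.

Lemma sqint_mul f g : sqint f -> sqint g ->
  mu.-integrable D (EFin \o (fun x => f x * g x)).
Proof.
move=> [mf f2] [mg g2]; apply: (le_integrableR _ (integrableDR f2 g2)).
  exact: measurable_funM.
move=> x _; rewrite normrM -(real_normK (num_real (f x))).
rewrite -(real_normK (num_real (g x))).
have := sqr_ge0 (`|f x| - `|g x|); have := normr_ge0 (f x).
have := normr_ge0 (g x); nra.
Qed.

Lemma sqintD f g : sqint f -> sqint g -> sqint (fun x => f x + g x).
Proof.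
move=> sf sg; split; first by apply: measurable_funD; [case: sf|case: sg].
have -> : (fun x => (f x + g x) ^+ 2) =
  (fun x => f x ^+ 2 + (2 * (f x * g x) + g x ^+ 2)).
  by apply/funext => x; ring.
apply: integrableDR; first by case: sf.
apply: integrableDR; last by case: sg.
exact/integrableZR/sqint_mul.
Qed.

Lemma sqintZ (k : R) f : sqint f -> sqint (fun x => k * f x).
Proof.
move=> sf; split; first by apply: measurable_funM => //; case: sf.
under [X in _ \o X]eq_fun do rewrite exprMn.
by apply: integrableZR; case: sf.
Qed.

Lemma sqintB f g : sqint f -> sqint g -> sqint (fun x => f x - g x).
Proof.
move=> sf sg; have := sqintD sf (sqintZ (-1) sg).
by under eq_fun do rewrite mulN1r.
Qed.

Lemma sqint_le f g : measurable_fun D f -> sqint g ->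
  (forall x, D x -> `|f x| <= `|g x|) -> sqint f.
Proof.
move=> mf [mg ig] fg; split => //.
apply: (le_integrableR _ ig); first exact: measurable_funX.
move=> x Dx; rewrite normrX -(real_normK (num_real (g x))).
by rewrite lerXn2r ?nnegrE// fg.
Qed.

Lemma ipDl f g h : sqint f -> sqint g -> sqint h ->
  ip (fun x => f x + g x) h = ip f h + ip g h.
Proof.
move=> sf sg sh; rewrite /ip -RintegralD//; [|exact: sqint_mul..].
by under eq_Rintegral do rewrite mulrDl.
Qed.

Lemma ipZl k f h : sqint f -> sqint h -> ip (fun x => k * f x) h = k * ip f h.
Proof.
move=> sf sh; rewrite /ip -RintegralZl//; last exact: sqint_mul.
by under eq_Rintegral do rewrite -mulrA.
Qed.

Lemma ipBl f g h : sqint f -> sqint g -> sqint h ->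
  ip (fun x => f x - g x) h = ip f h - ip g h.
Proof.
move=> sf sg sh; rewrite /ip -RintegralB//; [|exact: sqint_mul..].
by under eq_Rintegral do rewrite mulrBl.
Qed.

Lemma ipBr f g h : sqint f -> sqint g -> sqint h ->
  ip h (fun x => f x - g x) = ip h f - ip h g.
Proof. by move=> *; rewrite ipC ipBl// !(ipC h). Qed.

Lemma ipZr k f h : sqint f -> sqint h -> ip h (fun x => k * f x) = k * ip h f.
Proof. by move=> *; rewrite ipC ipZl// (ipC h). Qed.

Lemma ipDr f g h : sqint f -> sqint g -> sqint h ->
  ip h (fun x => f x + g x) = ip h f + ip h g.
Proof. by move=> *; rewrite ipC ipDl// !(ipC h). Qed.

Lemma ip_ge0 f : 0 <= ip f f.
Proof. by apply: Rintegral_ge0 => x _; rewrite -expr2 sqr_ge0. Qed.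

(** The quadratic polynomial t -> |f - t g|^2 is nonnegative; it is evaluated at its minimum <f, g>
    / <g, g>. *)
Lemma ip_CauchySchwarz f g : sqint f -> sqint g -> ip f g ^+ 2 <= ip f f * ip g g.
Proof.
move=> sf sg.
have H t : 0 <= ip f f - 2 * t * ip f g + t ^+ 2 * ip g g.
  have tg := sqintZ t sg.
  have <- : ip (fun x => f x - t * g x) (fun x => f x - t * g x) =
    ip f f - 2 * t * ip f g + t ^+ 2 * ip g g.
    rewrite ipBl//; [|exact: sqintB]; rewrite !ipBr// !ipZl// !ipZr//.
    by rewrite (ipC g f); ring.
  exact: ip_ge0.
have [gg0|gg0] := eqVneq (ip g g) 0.
  rewrite gg0 mulr0; have [->|fg0] := eqVneq (ip f g) 0; first by rewrite expr0n.
  (* When <g, g> = 0 the polynomial is affine in t; this t would give it the value -1. *)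
  have := H ((ip f f + 1) / (2 * ip f g)); rewrite gg0 mulr0 addr0.
  rewrite (_ : 2 * _ * _ = ip f f + 1); last by field.
  lra.
have gp : 0 < ip g g by rewrite lt_neqAle eq_sym gg0 ip_ge0.
have := H (ip f g / ip g g); rewrite -(pmulr_lge0 _ gp).
rewrite (_ : _ * ip g g = ip f f * ip g g - ip f g ^+ 2); last by field.
by rewrite subr_ge0.
Qed.

Lemma CauchySchwarz_abs f g : sqint f -> sqint g ->
  `|ip f g| <= Num.sqrt (ip f f) * Num.sqrt (ip g g).
Proof.
move=> sf sg; rewrite -sqrtrM ?ip_ge0// -sqrtr_sqr ler_sqrt.
  exact: ip_CauchySchwarz.
by rewrite mulr_ge0 ?ip_ge0.
Qed.

Lemma ip_sum2 f g : sqint f -> sqint g ->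
  ip (fun x => f x + g x) (fun x => f x + g x) <= 2 * ip f f + 2 * ip g g.
Proof.
move=> sf sg.
rewrite ipDl//; last exact: sqintD.
rewrite !ipDr//.
have := ip_ge0 (fun x => f x - g x); rewrite ipBl//; last exact: sqintB.
by rewrite !ipBr//; rewrite (ipC g f); lra.
Qed.

(** Write <F, G> = <f, g> - <f - F, g> - <f, g - G> + <f - F, g - G> and apply Cauchy-Schwarz to the
    last three terms. *)
Lemma ip_cvg (f g : T -> R) (F G : nat -> T -> R) :
  sqint f -> sqint g -> (forall n, sqint (F n)) -> (forall n, sqint (G n)) ->
  ip (fun x => f x - F n x) (fun x => f x - F n x) @[n --> \oo] --> (0 : R) ->
  ip (fun x => g x - G n x) (fun x => g x - G n x) @[n --> \oo] --> (0 : R) ->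
  ip (F n) (G n) @[n --> \oo] --> ip f g.
Proof.
move=> sf sg sF sG cF cG.
have sfF n : sqint (fun x => f x - F n x) by exact: sqintB.
have sgG n : sqint (fun x => g x - G n x) by exact: sqintB.
have cs (a : nat -> R) : a n @[n --> \oo] --> (0 : R) ->
    Num.sqrt (a n) @[n --> \oo] --> (0 : R).
  move=> ca; rewrite -(@sqrtr0 R).
  by apply: (cvg_comp _ _ ca); exact: sqrt_continuous.
have z (a b : nat -> T -> R) : (forall n, sqint (a n)) -> (forall n, sqint (b n)) ->
    Num.sqrt (ip (a n) (a n)) * Num.sqrt (ip (b n) (b n)) @[n --> \oo] --> (0 : R) ->
    ip (a n) (b n) @[n --> \oo] --> (0 : R).
  by move=> sa sb; apply: squeeze0 => n; exact: CauchySchwarz_abs.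
have -> : ip f g = ip f g - 0 - 0 + 0 by ring.
have -> : (fun n => ip (F n) (G n)) =
   (fun n => ip f g - ip (fun x => f x - F n x) g - ip f (fun x => g x - G n x)
     + ip (fun x => f x - F n x) (fun x => g x - G n x)).
  by apply/funext => n; rewrite !ipBl// !ipBr//; ring.
apply: cvgD; first apply: cvgB; first apply: cvgB.
- exact: cvg_cst.
- apply: (z _ (fun _ => g)) => //.
  rewrite -(mul0r (Num.sqrt (ip g g))); apply: cvgM; [exact: cs|exact: cvg_cst].
- apply: (z (fun _ => f)) => //.
  rewrite -(mulr0 (Num.sqrt (ip f f))); apply: cvgM; [exact: cvg_cst|exact: cs].
- by apply: z => //; rewrite -(mulr0 0); apply: cvgM; exact: cs.
Qed.

Lemma ip_eq0 f : sqint f -> ip f f = 0 -> {ae mu, forall x, D x -> f x = 0}.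
Proof.
move=> [mf f2] f0.
have : (\int[mu]_(x in D) `|(f x ^+ 2)%:E| = 0)%E.
  under eq_integral do rewrite gee0_abs ?lee_fin ?sqr_ge0//.
  have /fineK <- := integrable_fin_num mD f2.
  by congr EFin; rewrite -[RHS]f0; apply: eq_Rintegral => x _; rewrite expr2.
move/(ae_eq_integral_abs mu mD); case=> [|N [mN N0 H]].
  exact: (measurable_int mu).
exists N; split => // x /= nx; apply: H => /= h; apply: nx => Dx.
by have /eqP := h Dx; rewrite eqe sqrf_eq0 => /eqP.
Qed.

End sqint.

(** * Directional derivatives and C^k calculus in the plane *)

Section directional.
Variable R : realType.
Implicit Types (f g : R * R -> R) (F G : R -> R).

(** A directional derivative depends only on its difference quotient. The two spaces may differ, so
    partial derivatives can be exchanged for one-variable derivatives of slices. *)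
Lemma is_derive_eqg (U V : normedModType R) (f : U -> R) (g : V -> R) a v b w (d : R) :
  (forall h : R, f (h *: v + a) - f a = g (h *: w + b) - g b) ->
  is_derive a v f d -> is_derive b w g d.
Proof.
move=> fg [df dfE].
have E : (fun h => h^-1 *: ((f \o shift a) (h *: v) - f a)) =
         (fun h => h^-1 *: ((g \o shift b) (h *: w) - g b)).
  by apply/funext => h /=; rewrite fg.
by split; [rewrite /derivable -E|rewrite /derive -E].
Qed.

Lemma is_derive_line f (x v : R * R) d :
  is_derive x v f d <-> is_derive (0 : R) 1 (fun h => f (h *: v + x)) d.
Proof.
by split; apply: is_derive_eqg => h /=; rewrite addr0 scale0r add0r [_%:A]mulr1.
Qed.

Lemma is_derive_e1 f (x : R * R) d :
  is_derive x (e1 R) f d <-> is_derive x.1 1 (fun s => f (s, x.2)) d.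
Proof.
have E h : h *: e1 R + x = (h%:A + x.1, x.2).
  by apply: injective_projections => /=; rewrite ?[h *: 0]scaler0 ?add0r.
by split; apply: is_derive_eqg => h /=; rewrite E; case: x {E}.
Qed.

Lemma is_derive_e2 f (x : R * R) d :
  is_derive x (e2 R) f d <-> is_derive x.2 1 (fun s => f (x.1, s)) d.
Proof.
have E h : h *: e2 R + x = (x.1, h%:A + x.2).
  by apply: injective_projections => /=; rewrite ?[h *: 0]scaler0 ?add0r.
by split; apply: is_derive_eqg => h /=; rewrite E; case: x {E}.
Qed.

Lemma is_derive_compR F f (x v : R * R) dF df :
  is_derive (f x) 1 F dF -> is_derive x v f df ->
  is_derive x v (F \o f) (dF * df).
Proof.
move=> HF /is_derive_line Hf; apply/is_derive_line.
rewrite -[X in is_derive _ _ X]/(F \o (fun h => f (h *: v + x))).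
by apply: is_derive1_comp; rewrite ?scale0r ?add0r.
Qed.

Lemma is_derive_add (V : normedModType R) (f g : V -> R) (x v : V) (df dg : R) :
  is_derive x v f df -> is_derive x v g dg ->
  is_derive x v (fun y => f y + g y) (df + dg).
Proof. by move=> Hf Hg; exact: is_deriveD. Qed.

Lemma is_derive_mul (V : normedModType R) (f g : V -> R) (x v : V) (df dg : R) :
  is_derive x v f df -> is_derive x v g dg ->
  is_derive x v (fun y => f y * g y) (df * g x + f x * dg).
Proof.
move=> Hf Hg; have := @is_deriveM _ _ f g x v df dg Hf Hg.
by move/is_derive_eq; apply; rewrite addrC mulrC.
Qed.

Lemma is_derive_scal (V : normedModType R) (c : R) (f : V -> R) (x v : V) (df : R) :
  is_derive x v f df -> is_derive x v (fun y => c * f y) (c * df).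
Proof. by move=> Hf; exact: is_deriveZ. Qed.

Lemma is_derive_opp (V : normedModType R) (f : V -> R) (x v : V) (df : R) :
  is_derive x v f df -> is_derive x v (fun y => - f y) (- df).
Proof. by move=> Hf; exact: is_deriveN. Qed.

Lemma is_derive_const (V : normedModType R) (c : R) (x v : V) :
  is_derive x v (fun=> c) 0.
Proof. exact: is_derive_cst. Qed.

Lemma is_derive_fst1 (x : R * R) : is_derive x (e1 R) (@fst R R) 1.
Proof. by apply/is_derive_e1 => /=; exact: is_derive_id. Qed.
Lemma is_derive_fst2 (x : R * R) : is_derive x (e2 R) (@fst R R) 0.
Proof. by apply/is_derive_e2 => /=; exact: is_derive_cst. Qed.
Lemma is_derive_snd1 (x : R * R) : is_derive x (e1 R) (@snd R R) 0.
Proof. by apply/is_derive_e1 => /=; exact: is_derive_cst. Qed.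
Lemma is_derive_snd2 (x : R * R) : is_derive x (e2 R) (@snd R R) 1.
Proof. by apply/is_derive_e2 => /=; exact: is_derive_id. Qed.

Lemma is_derive_uniq (V : normedModType R) (f : V -> R) (x v : V) (d d' : R) :
  is_derive x v f d -> is_derive x v f d' -> d = d'.
Proof. by move=> [_ <-] [_ <-]. Qed.

Lemma is_derive_cont F (x d : R) : is_derive x 1 F d -> {for x, continuous F}.
Proof.
by case=> dF _; apply: differentiable_continuous; exact/derivable1_diffP.
Qed.

(** The one-variable counterpart of [is_Ck], with the derivative supplied as a witness, so that a
    closed formula can be given at each order. *)
Fixpoint Ck1 (k : nat) F : Prop :=
  if k is k'.+1 then exists2 G : R -> R, forall x : R, is_derive x 1 F (G x) & Ck1 k' G
  else continuous F.

Lemma Ck1_continuous k F : Ck1 k F -> continuous F.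
Proof. by case: k => //= k [G FG _] x; apply: is_derive_cont (FG x). Qed.

Lemma Ck1W k F : Ck1 k.+1 F -> Ck1 k F.
Proof.
elim: k F => [F H|k IH F [G FG GG]]; first exact: Ck1_continuous H.
by exists G => //; exact: IH.
Qed.

Lemma Ck1D k F G : Ck1 k F -> Ck1 k G -> Ck1 k (fun x => F x + G x).
Proof.
elim: k F G => [F G cF cG x|k IH F G [F' FF cF] [G' GG cG]].
  by apply: cvgD; [exact: cF|exact: cG].
exists (fun x => F' x + G' x); last exact: IH.
by move=> x; exact: is_derive_add.
Qed.

Lemma Ck1M k F G : Ck1 k F -> Ck1 k G -> Ck1 k (fun x => F x * G x).
Proof.
elim: k F G => [F G cF cG x|k IH F G HF HG].
  by apply: cvgM; [exact: cF|exact: cG].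
have [F' FF cF] := HF; have [G' GG cG] := HG.
exists (fun x => F' x * G x + F x * G' x); last first.
  by apply: Ck1D; apply: IH => //; exact: Ck1W.
by move=> x; exact: is_derive_mul.
Qed.

Lemma Ck1_cst k c : Ck1 k (fun=> c).
Proof.
elim: k c => [c x|k IH c]; first exact: cvg_cst.
by exists (fun=> 0) => // x; exact: is_derive_const.
Qed.

Lemma Ck1_affine k F (a b : R) : Ck1 k F -> Ck1 k (fun x => F (a * x + b)).
Proof.
have H (x : R) : is_derive x 1 (fun x => a * x + b) a.
  apply: (is_derive_eq (is_derive_add
    (is_derive_scal a (is_derive_id x 1)) (is_derive_const b x 1))).
  by rewrite mulr1 addr0.
elim: k F => [F cF x|k IH F [G FG GG]].
  rewrite -[X in continuous_at _ X]/(F \o (fun x => a * x + b)).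
  by apply: continuous_comp; [exact: is_derive_cont (H x)|exact: cF].
exists (fun x => G (a * x + b) * a).
  move=> x; rewrite -[X in is_derive _ _ X]/(F \o (fun x => a * x + b)).
  exact: is_derive1_comp.
by apply: Ck1M; [exact: IH|exact: Ck1_cst].
Qed.

Lemma is_Ck_cont k f : is_Ck k f -> continuous f.
Proof. by case: k => [|k] []. Qed.

Lemma is_Ck_intro k f g1 g2 : continuous f ->
  (forall x, is_derive x (e1 R) f (g1 x)) ->
  (forall x, is_derive x (e2 R) f (g2 x)) ->
  is_Ck k g1 -> is_Ck k g2 -> is_Ck k.+1 f.
Proof.
move=> cf h1 h2 c1 c2; split => //; split.
- by move=> x; case: (h1 x).
- by move=> x; case: (h2 x).
- by rewrite (_ : 'D_(e1 R) f = g1)//; apply/funext => x; case: (h1 x).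
- by rewrite (_ : 'D_(e2 R) f = g2)//; apply/funext => x; case: (h2 x).
Qed.

Lemma is_Ck_elim k f : is_Ck k.+1 f ->
  [/\ forall x, is_derive x (e1 R) f ('D_(e1 R) f x),
      forall x, is_derive x (e2 R) f ('D_(e2 R) f x),
      is_Ck k ('D_(e1 R) f) & is_Ck k ('D_(e2 R) f)].
Proof. by move=> [_ [h1 h2 c1 c2]]; split; [move=> x; exact/derivableP..| |]. Qed.

Lemma is_CkW k f : is_Ck k.+1 f -> is_Ck k f.
Proof.
elim: k f => [f H|k IH f H]; first by split; [exact: is_Ck_cont H|].
have [f1 f2 c1 c2] := is_Ck_elim H.
exact: (is_Ck_intro (is_Ck_cont H) f1 f2 (IH _ c1) (IH _ c2)).
Qed.

Lemma is_CkD k f g : is_Ck k f -> is_Ck k g -> is_Ck k (fun x => f x + g x).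
Proof.
elim: k f g => [f g [cf _] [cg _]|k IH f g cf cg].
  by split => // x; apply: cvgD; [exact: cf|exact: cg].
have [f1 f2 cf1 cf2] := is_Ck_elim cf; have [g1 g2 cg1 cg2] := is_Ck_elim cg.
refine (is_Ck_intro _ (fun x => is_derive_add (f1 x) (g1 x))
  (fun x => is_derive_add (f2 x) (g2 x)) (IH _ _ cf1 cg1) (IH _ _ cf2 cg2)).
by move=> x; apply: cvgD; [exact: (is_Ck_cont cf)|exact: (is_Ck_cont cg)].
Qed.

Lemma is_CkM k f g : is_Ck k f -> is_Ck k g -> is_Ck k (fun x => f x * g x).
Proof.
elim: k f g => [f g [cf _] [cg _]|k IH f g cf cg].
  by split => // x; apply: cvgM; [exact: cf|exact: cg].
have [f1 f2 cf1 cf2] := is_Ck_elim cf; have [g1 g2 cg1 cg2] := is_Ck_elim cg.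
refine (is_Ck_intro _ (fun x => is_derive_mul (f1 x) (g1 x))
  (fun x => is_derive_mul (f2 x) (g2 x)) _ _).
- by move=> x; apply: cvgM; [exact: (is_Ck_cont cf)|exact: (is_Ck_cont cg)].
- exact: is_CkD (IH _ _ cf1 (is_CkW cg)) (IH _ _ (is_CkW cf) cg1).
- exact: is_CkD (IH _ _ cf2 (is_CkW cg)) (IH _ _ (is_CkW cf) cg2).
Qed.

Lemma is_Ck_cst k (c : R) : is_Ck k (fun _ : R * R => c).
Proof.
elim: k c => [c|k IH c]; first by split => // x; exact: cvg_cst.
refine (is_Ck_intro _ (fun x => is_derive_const c x _)
  (fun x => is_derive_const c x _) (IH 0) (IH 0)).
by move=> x; exact: cvg_cst.
Qed.

Lemma is_Ck_fst k : is_Ck k (@fst R R).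
Proof.
case: k => [|k]; first by split => // x; exact: cvg_fst.
refine (is_Ck_intro _ is_derive_fst1 is_derive_fst2 (is_Ck_cst _ _) (is_Ck_cst _ _)).
by move=> x; exact: cvg_fst.
Qed.

Lemma is_Ck_snd k : is_Ck k (@snd R R).
Proof.
case: k => [|k]; first by split => // x; exact: cvg_snd.
refine (is_Ck_intro _ is_derive_snd1 is_derive_snd2 (is_Ck_cst _ _) (is_Ck_cst _ _)).
by move=> x; exact: cvg_snd.
Qed.

Lemma is_Ck_comp k F f : Ck1 k F -> is_Ck k f -> is_Ck k (F \o f).
Proof.
elim: k F f => [F f cF [cf _]|k IH F f CF cf].
  by split => // x; apply: continuous_comp; [exact: cf|exact: cF].
have [G FG CG] := CF.
have [f1 f2 cf1 cf2] := is_Ck_elim cf.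
refine (is_Ck_intro _ (fun x => is_derive_compR (FG (f x)) (f1 x))
  (fun x => is_derive_compR (FG (f x)) (f2 x)) _ _).
- move=> x; apply: continuous_comp; first exact: (is_Ck_cont cf).
  exact: (Ck1_continuous CF).
- exact: is_CkM (IH _ _ CG (is_CkW cf)) cf1.
- exact: is_CkM (IH _ _ CG (is_CkW cf)) cf2.
Qed.

Definition sq (x : R * R) : R := x.1 ^+ 2 + x.2 ^+ 2.

Lemma is_Ck_sq k : is_Ck k sq.
Proof.
exact: is_CkD (is_CkM (is_Ck_fst k) (is_Ck_fst k))
  (is_CkM (is_Ck_snd k) (is_Ck_snd k)).
Qed.

Lemma is_derive_sq1 (x : R * R) : is_derive x (e1 R) sq (2 * x.1).
Proof.
have -> : 2 * x.1 = (1 * x.1 + x.1 * 1) + (0 * x.2 + x.2 * 0) by ring.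
exact: is_derive_add (is_derive_mul (is_derive_fst1 x) (is_derive_fst1 x))
  (is_derive_mul (is_derive_snd1 x) (is_derive_snd1 x)).
Qed.

Lemma is_derive_sq2 (x : R * R) : is_derive x (e2 R) sq (2 * x.2).
Proof.
have -> : 2 * x.2 = (0 * x.1 + x.1 * 0) + (1 * x.2 + x.2 * 1) by ring.
exact: is_derive_add (is_derive_mul (is_derive_fst2 x) (is_derive_fst2 x))
  (is_derive_mul (is_derive_snd2 x) (is_derive_snd2 x)).
Qed.

Lemma continuous_sq : continuous sq.
Proof. exact: (is_Ck_cont (is_Ck_sq 0)). Qed.

End directional.

(** * Smooth bump functions *)

Section expinv.
Variable R : realType.

Lemma is_derive_near0 (F : R -> R) (C : R) : (forall h, `|F h| <= C * h ^+ 2) ->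
  is_derive (0 : R) 1 F 0.
Proof.
move=> FC; have F0 : F 0 = 0.
  by apply/normr0_eq0/le_anti; rewrite normr_ge0 andbT (le_trans (FC 0))// expr0n mulr0.
suff H : (fun h : R => h^-1 *: ((F \o shift 0) (h *: 1) - F 0)) @ 0^' --> (0 : R).
  split; first by apply/cvg_ex; exists 0.
  exact: cvg_lim H.
apply/cvgr0Pnorm_le => e e0.
near=> h.
have h0 : h != 0 by near: h; exact: nbhs_dnbhs_neq.
rewrite /= addr0 F0 subr0 [_%:A]mulr1 [_ *: _]/(_ * _) normrM normfV.
rewrite ler_pdivrMl ?normr_gt0// (le_trans (FC h))//.
rewrite -(real_normK (num_real h)) expr2 mulrA [leRHS]mulrC ler_wpM2r//.
have hC : `|h| < e / (`|C| + 1).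
  near: h; apply: dnbhs0_lt; by rewrite divr_gt0// ltr_wpDl.
rewrite (le_trans (ler_wpM2r _ (ler_norm C)))//.
rewrite (le_trans (ler_wpM2l _ (ltW hC)))// mulrCA ler_piMr// ?(ltW e0)//.
by rewrite ler_pdivrMr ?ltr_wpDl// mul1r lerDl.
Unshelve. all: by end_near. Qed.

(** Monomial by monomial, from y^n / n! <= exp y. *)
Lemma poly_expR_bound (p : {poly R}) :
  exists C : R, forall y : R, 0 <= y -> `|p.[y]| <= C * expR y.
Proof.
exists (\sum_(i < size p) `|p`_i| * i`!%:R) => y y0.
rewrite horner_coef (le_trans (ler_norm_sum _ _ _))// mulr_suml ler_sum// => i _.
rewrite normrM -mulrA ler_wpM2l// ger0_norm ?exprn_ge0//.
case: (i : nat) => [|n]; first by rewrite expr0 fact0 mul1r (le_trans _ (expR_ge1Dx y))// lerDl.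
have := expR_ge1Dxn n y0 => H.
have : y ^+ n.+1 / n.+1`!%:R <= expR y by rewrite (le_trans _ H)// lerDr.
by rewrite ler_pdivrMr ?ltr0n ?fact_gt0// mulrC.
Qed.

(** The functions p(1/t) exp(-1/t), extended by 0 to t <= 0. The family is closed under
    differentiation, p becoming X^2 (p - p'), so one bound near 0 gives smoothness of every
    order. *)
Definition expinv (p : {poly R}) (t : R) : R :=
  if 0 < t then p.[t^-1] * expR (- t^-1) else 0.

Lemma expinv_bound p : exists C : R, forall t, `|expinv p t| <= C * t ^+ 2.
Proof.
(* The factor X^2, evaluated at 1/t, becomes the t^2 of the bound once it is moved to the other
   side. *)
have [C CP] := poly_expR_bound (p * 'X ^+ 2).
have C0 : 0 <= C.
  by have := CP 0 (lexx 0); rewrite expR0 mulr1; exact: le_trans.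
exists C => t; rewrite /expinv; case: ifPn => t0; last first.
  by rewrite normr0 mulr_ge0// sqr_ge0.
have ti : 0 <= t^-1 by rewrite invr_ge0 ltW.
have := CP t^-1 ti; rewrite hornerM hornerXn normrM (ger0_norm (exprn_ge0 _ ti)) => H.
rewrite normrM (ger0_norm (expR_ge0 _)) expRN ler_pdivrMr ?expR_gt0//.
by rewrite mulrAC -ler_pdivrMr ?exprn_gt0// -exprVn.
Qed.

Lemma expinv_derive p (t : R) :
  is_derive t 1 (expinv p) (expinv ('X ^+ 2 * (p - p^`())) t).
Proof.
have [t0|t0|->] := ltgtP t 0.
- rewrite /(expinv _ t) ltNge (ltW t0)/=.
  apply: (near_eq_is_derive _ (is_derive_const 0 t 1)).
  near=> s; have s0 : s < 0 by near: s; exact: lt_nbhsl.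
  by rewrite /expinv ltNge (ltW s0).
- rewrite /(expinv _ t) t0.
  have H : is_derive t 1 (fun s : R => p.[s^-1] * expR (- s^-1))
      ((('X ^+ 2 * (p - p^`())).[t^-1] * expR (- t^-1))).
    have tn : t != 0 by rewrite gt_eqF.
    have Hi : is_derive t 1 (fun s : R => s^-1) (- t ^- 2).
      by have := is_deriveV tn (is_derive_id t 1); rewrite [_ *: _]mulr1.
    have Hp := is_derive1_comp (is_derive_poly p t^-1) Hi.
    have He := @is_derive1_comp _ expR (fun s : R => - s^-1) t _ _
      (is_derive_expR (- t^-1)) (is_derive_opp Hi).
    have := is_derive_mul Hp He; move/is_derive_eq; apply.
    rewrite !hornerE /=; field.
    by rewrite tn.
  apply: (near_eq_is_derive _ H).
  near=> s; have s0 : 0 < s by near: s; exact: lt_nbhsr.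
  by rewrite /expinv s0.
- rewrite /(expinv _ 0) ltxx; have [C CP] := expinv_bound p.
  exact: is_derive_near0 CP.
Unshelve. all: by end_near. Qed.

Lemma expinv_Ck1 k p : Ck1 k (expinv p).
Proof.
elim: k p => [p t|k IH p]; first exact: is_derive_cont (expinv_derive p t).
by exists (expinv ('X ^+ 2 * (p - p^`()))) => //; exact: expinv_derive.
Qed.

Definition bump0 (t : R) := expinv 1 t.

Lemma bump0_gt0 t : 0 < t -> bump0 t = expR (- t^-1).
Proof. by move=> t0; rewrite /bump0 /expinv t0 hornerC mul1r. Qed.

Lemma bump0_le0 t : t <= 0 -> bump0 t = 0.
Proof. by move=> t0; rewrite /bump0 /expinv ltNge t0. Qed.

Lemma bump0_ge0 t : 0 <= bump0 t.
Proof.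
by have [/bump0_le0->//|/bump0_gt0->] := leP t 0; exact: expR_ge0.
Qed.

Lemma bump0_le1 t : bump0 t <= 1.
Proof.
have [/bump0_le0->//|t0] := leP t 0; rewrite bump0_gt0// expR_le1.
by rewrite oppr_le0 invr_ge0 ltW.
Qed.

Lemma bump0_cvg t : 0 < t -> bump0 (n%:R * t) @[n --> \oo] --> (1 : R).
Proof.
move=> t0.
have H : (- (t^-1 * n.+1%:R^-1) : R) @[n --> \oo] --> (0 : R).
  rewrite -[X in _ --> X]oppr0 -[X in _ --> - X](mulr0 t^-1).
  by apply: cvgN; apply: cvgM; [exact: cvg_cst|exact: cvg_harmonic].
rewrite -(cvg_shiftS (fun n : nat => bump0 (n%:R * t))).
have := cvg_comp _ _ H (@continuous_expR R 0); rewrite expR0.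
apply: cvg_trans; apply: near_eq_cvg; apply: nearW => n /=.
by rewrite bump0_gt0 ?mulr_gt0// invfM mulrC.
Qed.

(** Smooth functions with values in [0, 1], zero outside []a, b[], converging pointwise to its
    indicator as n grows. With dominated convergence they do the work of mollifiers. *)
Definition bumpf (a b : R) (n : nat) (s : R) : R :=
  bump0 (n%:R * (s - a)) * bump0 (n%:R * (b - s)).

Lemma bump_Ck1 k a b n : Ck1 k (bumpf a b n).
Proof.
apply: Ck1M.
  have := Ck1_affine n%:R (- (n%:R * a)) (expinv_Ck1 k 1).
  by congr (Ck1 _ _); apply/funext => s; rewrite mulrBr.
have := Ck1_affine (- n%:R) (n%:R * b) (expinv_Ck1 k 1).
by congr (Ck1 _ _); apply/funext => s; rewrite mulrBr addrC mulNr.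
Qed.

Lemma bump_out a b n s : ~ (a < s < b) -> bumpf a b n s = 0.
Proof.
move=> /negP; rewrite negb_and -!leNgt => /orP[sa|sb]; rewrite /bumpf.
  by rewrite bump0_le0 ?mul0r// mulr_ge0_le0 ?subr_le0.
by rewrite [X in _ * X]bump0_le0 ?mulr0// mulr_ge0_le0 ?subr_le0.
Qed.

Lemma bump_ge0 a b n s : 0 <= bumpf a b n s.
Proof. by rewrite mulr_ge0 ?bump0_ge0. Qed.

Lemma bump_le1 a b n s : bumpf a b n s <= 1.
Proof. by rewrite mulr_ile1 ?bump0_ge0 ?bump0_le1. Qed.

Lemma bump_cvg a b s : bumpf a b n s @[n --> \oo] --> (\1_(`]a, b[%classic) s : R).
Proof.
have [sab|sab] := boolP (s \in `]a, b[).
  rewrite indicE mem_set//= -[X in _ --> X](mulr1 1).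
  move: sab; rewrite in_itv/= => /andP[sa sb].
  by apply: cvgM; apply: bump0_cvg; rewrite subr_gt0.
rewrite indicE memNset /=; last by move=> /= h; move/negP: sab.
rewrite (_ : (fun n => bumpf a b n s) = (fun=> 0)); first exact: cvg_cst.
apply/funext => n; apply: bump_out.
by move=> h; move/negP: sab; rewrite in_itv.
Qed.

End expinv.

(** * Test functions on the disk *)

Section plane.
Variable R : realType.
Implicit Types (f g : R * R -> R).
Notation B := (disk R).
Notation mu := (mu2 R).

Lemma sq_ge0 (x : R * R) : 0 <= sq x.
Proof. by rewrite addr_ge0 ?sqr_ge0. Qed.

Lemma enormE (x : R * R) : enorm x = Num.sqrt (sq x).
Proof. by []. Qed.

Lemma diskE (x : R * R) : B x <-> sq x < 1.
Proof.
by rewrite /disk/= enormE -[X in _ < X]sqrtr1 ltr_sqrt.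
Qed.

Lemma disk_itv (x : R * R) : sq x <= 1 -> `|x.1| <= 1 /\ `|x.2| <= 1.
Proof.
move=> h; have h1 : x.1 ^+ 2 <= 1.
  by rewrite (le_trans _ h)// lerDl sqr_ge0.
have h2 : x.2 ^+ 2 <= 1 by rewrite (le_trans _ h)// lerDr sqr_ge0.
split; [move: h1; rewrite -(real_normK (num_real x.1))|
  move: h2; rewrite -(real_normK (num_real x.2))];
  by rewrite expr_le1.
Qed.

(** The sigma-algebra of the plane is the product one, so the open set is written as a countable
    union of boxes with rational corners. *)
Lemma open_measurable2 (U : set (R * R)) : open U -> measurable U.
Proof.
move=> oU.
pose Q (q : (rat * rat) * (rat * rat)) : set (R * R) :=
  `]ratr q.1.1, ratr q.1.2[%classic `*` `]ratr q.2.1, ratr q.2.2[%classic.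
have -> : U = \bigcup_q (if `[< Q q `<=` U >] then Q q else set0).
  rewrite eqEsubset; split => [x Ux|x [q _]]; last first.
    by case: ifPn => [/asboolP|//] /[apply].
  have /nbhs_ballP[e /= e0 eU] := open_nbhs_nbhs (conj oU Ux).
  have [a] := @rat_in_itvoo R (x.1 - e) x.1 (ltac:(by rewrite ltrBlDr ltrDl)).
  have [b] := @rat_in_itvoo R x.1 (x.1 + e) (ltac:(by rewrite ltrDl)).
  have [c] := @rat_in_itvoo R (x.2 - e) x.2 (ltac:(by rewrite ltrBlDr ltrDl)).
  have [d] := @rat_in_itvoo R x.2 (x.2 + e) (ltac:(by rewrite ltrDl)).
  rewrite !in_itv/= => /andP[d1 d2] /andP[c1 c2] /andP[b1 b2] /andP[a1 a2].
  exists ((a, b), (c, d)) => //; case: ifPn => [_|/asboolP[]].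
    by split; rewrite /= in_itv/= ?a2 ?b1 ?c2 ?d1.
  move=> y [/=]; rewrite !in_itv/= => /andP[ay yb] /andP[cy yd]; apply: eU.
  by split; rewrite /ball/= ltr_norml; apply/andP; split; lra.
apply: countable_bigcupT_measurable => // q; case: ifPn => _ //.
by apply: measurableX; exact: measurable_itv.
Qed.

Lemma continuous_measurable2 f (D : set (R * R)) : measurable D ->
  continuous f -> measurable_fun D f.
Proof.
move=> mD cf; apply: (measurability _ (RGenOpens.measurableE R)).
move=> _ [_ [a [b ->] <-]]; apply: measurableI => //; apply: open_measurable2.
by move/continuousP: cf; apply; exact: interval_open.
Qed.

Lemma mdisk : measurable B.
Proof.
apply: open_measurable2.
have -> : B = (@sq R) @^-1` [set y : R | y < 1].
  by rewrite eqEsubset; split => x; rewrite diskE.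
move/continuousP: (@continuous_sq R); apply; exact: open_lt.
Qed.

Lemma compact_ball (r : R) : compact [set x : R * R | sq x <= r].
Proof.
have cK : closed [set x : R * R | sq x <= r].
  have -> : [set x : R * R | sq x <= r] = (@sq R) @^-1` [set y : R | y <= r] by [].
  by apply: closed_comp; [move=> ? _; exact: continuous_sq|exact: closed_le].
have K2 : compact (`[- (1 + r), 1 + r]%classic `*` `[- (1 + r), 1 + r]%classic
    : set (R * R)) by apply: compact_setX; exact: segment_compact.
apply: (subclosed_compact cK K2).
move=> x /= h; rewrite !in_itv/= -!ler_norml.
have r0 : 0 <= r by exact: le_trans (sq_ge0 x) h.
have H (a b : R) : a ^+ 2 + b ^+ 2 <= r -> `|a| <= 1 + r.
  rewrite -(real_normK (num_real a)) => h'.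
  have := sqr_ge0 b; have := sqr_ge0 (`|a| - 1); have := normr_ge0 a; nra.
split; first exact: H h.
by apply: (H x.2 x.1); rewrite addrC.
Qed.

Lemma mu_disk_lty : (mu B < +oo)%E.
Proof.
apply: (@le_lt_trans _ _ (mu (`[-1, 1]%classic `*` `[-1, 1]%classic))).
  apply: le_measure; rewrite ?inE; [exact: mdisk|exact: measurableX|].
  move=> x /diskE /ltW /disk_itv[h1 h2]; split => /=; by rewrite in_itv/= -ler_norml.
rewrite product_measure1E//= lebesgue_measure_itv/= lte_fin.
by rewrite (_ : (-1 < 1 :> R))// -EFinB -EFinM ltry.
Qed.

Lemma bounded_integrable2 f : measurable_fun B f ->
  (exists M, forall x, B x -> `|f x| <= M) -> mu.-integrable B (EFin \o f).
Proof.
move=> mf [M fM]; apply: measurable_bounded_integrable => //.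
- exact: mdisk.
- exact: mu_disk_lty.
- exists M; split; first exact: num_real.
  by move=> N MN x Bx /=; exact: le_trans (fM x Bx) (ltW MN).
Qed.

Lemma bounded_L2 f : measurable_fun B f ->
  (exists M, forall x, B x -> `|f x| <= M) -> L2 f.
Proof.
move=> mf [M fM]; split => //; apply: bounded_integrable2.
  exact: measurable_funX.
exists (M ^+ 2) => x Bx; rewrite normrX lerXn2r// ?nnegrE//.
  by rewrite (le_trans (normr_ge0 _) (fM x Bx)).
exact: fM.
Qed.

Lemma continuous_bounded_disk f : continuous f ->
  exists M, forall x, B x -> `|f x| <= M.
Proof.
move=> cf.
have [||c _ H] := @compact_EVT_max _ R (fun x => `|f x|) _ _ (@compact_ball 1).
- by exists (0, 0) => /=; rewrite /sq/= expr0n/= addr0.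
- by apply: continuous_subspaceT => x; apply: cvg_norm; exact: cf.
- by exists `|f c| => x /diskE /ltW h; apply: H; rewrite inE.
Qed.

Lemma continuous_L2 f : continuous f -> L2 f.
Proof.
move=> cf; apply: bounded_L2; last exact: continuous_bounded_disk.
by apply: continuous_measurable2 => //; exact: mdisk.
Qed.

(** For r < 1 this is compact support in the open disk. The set r < |x|^2 is open and contains the
    boundary circle, so derivatives vanish there too. *)
Definition vanish (r : R) f := forall x, r < sq x -> f x = 0.

Lemma vanish_derive r f v (x : R * R) d : vanish r f -> r < sq x ->
  is_derive x v f d -> d = 0.
Proof.
move=> vf rx fd; apply: (is_derive_uniq fd).
apply: (near_eq_is_derive _ (is_derive_const 0 x v)).
have o : open [set y : R * R | r < sq y].
  by move/continuousP: (@continuous_sq R) => /(_ _ (@open_gt _ r)).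
by apply: filterS (open_nbhs_nbhs (conj o rx)) => y /= ry; rewrite vf.
Qed.

Lemma test_intro f r : r < 1 -> (forall k, is_Ck k f) -> vanish r f ->
  test_function f.
Proof.
move=> r1 Cf vf.
have S : closure [set x | f x != 0] `<=` [set x | sq x <= r].
  have cK : closed [set x : R * R | sq x <= r].
    by apply: compact_closed; [exact: norm_hausdorff|exact: compact_ball].
  rewrite [X in _ `<=` X]((closure_id _).1 cK).
  apply: closure_subset => x /= fx; rewrite leNgt; apply/negP => /vf fx0.
  by rewrite fx0 eqxx in fx.
split => //.
  by apply: subclosed_compact S; [exact: closed_closure|exact: compact_ball].
by move=> x /S /= h; apply/diskE; exact: le_lt_trans r1.
Qed.

Lemma test_radial F r : r < 1 -> (forall k, Ck1 k F) ->
  (forall s, r < s -> F s = 0) -> test_function (F \o (@sq R)).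
Proof.
move=> r1 CF vF; apply: (test_intro r1) => [k|x /vF//].
exact: is_Ck_comp (CF k) (is_Ck_sq R k).
Qed.

(** The radius is the maximum of |x|^2 over the compact support; an empty support is treated apart
    since there is then no maximum. *)
Lemma test_vanish f : test_function f -> exists2 r, r < 1 & vanish r f.
Proof.
move=> [_ cK KB]; set K := closure _ in cK KB.
have [K0|/set0P K0] := eqVneq K set0.
  exists 0 => // x _; apply/eqP/negP => /negP fx.
  have : K x by exact: subset_closure.
  by rewrite K0.
have [|c cKc H] := @compact_EVT_max _ R (@sq R) _ K0 cK.
  by apply: continuous_subspaceT; exact: continuous_sq.
exists (sq c); first by apply/diskE/KB; rewrite inE in cKc.
move=> x cx; apply/eqP/negP => /negP fx.
have : sq x <= sq c by apply: H; rewrite inE; exact: subset_closure.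
by rewrite leNgt cx.
Qed.

Lemma test_continuous f : test_function f -> continuous f.
Proof. by move=> [Cf _ _]; exact: is_Ck_cont (Cf 0). Qed.

Lemma test_derive1 f (x : R * R) : test_function f ->
  is_derive x (e1 R) f ('D_(e1 R) f x).
Proof. by move=> [Cf _ _]; case: (is_Ck_elim (Cf 1)). Qed.

Lemma test_derive2 f (x : R * R) : test_function f ->
  is_derive x (e2 R) f ('D_(e2 R) f x).
Proof. by move=> [Cf _ _]; case: (is_Ck_elim (Cf 1)). Qed.

Lemma test_continuous1 f : test_function f -> continuous ('D_(e1 R) f).
Proof. by move=> [Cf _ _]; case: (is_Ck_elim (Cf 1)) => _ _ /is_Ck_cont. Qed.

Lemma test_continuous2 f : test_function f -> continuous ('D_(e2 R) f).
Proof. by move=> [Cf _ _]; case: (is_Ck_elim (Cf 1)) => _ _ _ /is_Ck_cont. Qed.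

End plane.

(** * Integration by parts on the disk *)

Section by_parts.
Variable R : realType.
Implicit Types (f g : R * R -> R) (F : R -> R).
Notation B := (disk R).
Notation mu := (mu2 R).
Notation leb := (@lebesgue_measure R).

Lemma derivable_LR F (f : R -> R) a b : (forall x : R, is_derive x 1 F (f x)) ->
  derivable_oo_LRcontinuous F a b.
Proof.
move=> Ff; split.
- by move=> x _; case: (Ff x).
- by apply: cvg_at_right_filter; exact: is_derive_cont (Ff a).
- by apply: cvg_at_left_filter; exact: is_derive_cont (Ff b).
Qed.

Lemma FTC2E F (f : R -> R) a b : a < b -> continuous f ->
  (forall x : R, is_derive x 1 F (f x)) ->
  (\int[leb]_(x in `[a, b]) (f x)%:E)%E = (F b - F a)%:E.
Proof.
move=> ab cf Ff; rewrite (@continuous_FTC2 _ f F) ?EFinB//.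
- exact: continuous_subspaceT.
- exact: derivable_LR Ff.
- by move=> x _; rewrite derive1E; case: (Ff x).
Qed.

Lemma FTC2R F (f : R -> R) a b : a <= b -> continuous f ->
  (forall x : R, is_derive x 1 F (f x)) ->
  \int[leb]_(x in `[a, b]) f x = F b - F a.
Proof.
rewrite le_eqVlt => /predU1P[<- _ _|ab cf Ff].
  by rewrite set_itv1 Rintegral_set1 subrr.
by rewrite /Rintegral (FTC2E ab cf Ff).
Qed.

Lemma int_line0 F (f : R -> R) : continuous f ->
  (forall x : R, is_derive x 1 F (f x)) ->
  (forall x, 1 < `|x| -> F x = 0) -> (forall x, 1 < `|x| -> f x = 0) ->
  (\int[leb]_x (f x)%:E)%E = 0%E.
Proof.
move=> cf Ff F0 f0.
(* The function is known to vanish only for |x| > 1, so the endpoints are taken beyond 1. *)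
have := @FTC2E F f (-2) 2 (ltac:(lra)) cf Ff.
rewrite !F0; last 2 first.
- by rewrite normrN ger0_norm; lra.
- by rewrite ger0_norm; lra.
rewrite subr0 => H; rewrite -[RHS]H [RHS]integral_mkcond; apply: eq_integral => x _.
rewrite patchE; case: ifPn => //; rewrite notin_setE /= in_itv/= => /negP xn.
rewrite f0// ltNge; apply: contra xn; rewrite ler_norml; lra.
Qed.

Lemma vanish_sq r f (x : R * R) : r < 1 -> vanish r f ->
  1 < `|x.1| \/ 1 < `|x.2| -> f x = 0.
Proof.
move=> r1 vf h; apply: vf; apply: lt_le_trans r1 _; rewrite leNgt.
by apply/negP => /ltW /disk_itv[]; rewrite !leNgt; case: h => ->.
Qed.

(** Moves the integral from the disk to the whole plane, where Fubini separates the coordinates. *)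
Lemma vanish_cont_integrable r f : r < 1 -> vanish r f -> continuous f ->
  mu.-integrable setT (EFin \o f) /\
  (\int[mu]_(x in B) (f x)%:E = \int[mu]_x (f x)%:E)%E.
Proof.
move=> r1 vf cf.
have E : (EFin \o f) \_ B = EFin \o f.
  apply/funext => x; rewrite patchE; case: ifPn => //; rewrite notin_setE => h.
  by rewrite /= vf// (lt_le_trans r1)// leNgt; apply/negP => /diskE.
split; last by rewrite [LHS]integral_mkcond E.
have [H _] := @integrable_mkcond _ _ _ mu _ (EFin \o f) (@mdisk R).
rewrite -E; apply: H.
apply: bounded_integrable2; last exact: continuous_bounded_disk.
by apply: continuous_measurable2 => //; exact: mdisk.
Qed.

Lemma continuous_slice1 f (y : R) : continuous f -> continuous (fun s => f (s, y)).
Proof.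
move=> cf s; apply: (@continuous_comp _ _ _ (fun s : R => (s, y)) f); last exact: cf.
exact: (cvg_pair (@cvg_id _ (nbhs s)) (@cvg_cst _ y _ (nbhs s) _)).
Qed.

Lemma continuous_slice2 f (x : R) : continuous f -> continuous (fun s => f (x, s)).
Proof.
move=> cf s; apply: (@continuous_comp _ _ _ (fun s : R => (x, s)) f); last exact: cf.
exact: (cvg_pair (@cvg_cst _ x _ (nbhs s) _) (@cvg_id _ (nbhs s))).
Qed.

(** By Fubini, since on every horizontal line the derivative of a compactly supported function
    integrates to 0. *)
Lemma int_deriv1 r f g : r < 1 -> vanish r f -> continuous g ->
  (forall x, is_derive x (e1 R) f (g x)) -> \int[mu]_(x in B) g x = 0.
Proof.
move=> r1 vf cg fg.
have vg : vanish r g by move=> x rx; apply: vanish_derive vf rx (fg x).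
have [ig E] := vanish_cont_integrable r1 vg cg.
rewrite /Rintegral E -(integral21_prod_meas1 ig) integral0_eq//= => y _.
rewrite /fubini_G; apply: (@int_line0 (fun s => f (s, y)) (fun s => g (s, y))).
- exact: continuous_slice1.
- by move=> s; exact: (is_derive_e1 _ (s, y) _).1 (fg (s, y)).
- by move=> s hs; apply: (vanish_sq r1 vf); left.
- by move=> s hs; apply: (vanish_sq r1 vg); left.
Qed.

Lemma int_deriv2 r f g : r < 1 -> vanish r f -> continuous g ->
  (forall x, is_derive x (e2 R) f (g x)) -> \int[mu]_(x in B) g x = 0.
Proof.
move=> r1 vf cg fg.
have vg : vanish r g by move=> x rx; apply: vanish_derive vf rx (fg x).
have [ig E] := vanish_cont_integrable r1 vg cg.
rewrite /Rintegral E -(integral12_prod_meas1 ig) integral0_eq//= => y _.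
rewrite /fubini_F; apply: (@int_line0 (fun s => f (y, s)) (fun s => g (y, s))).
- exact: continuous_slice2.
- by move=> s; exact: (is_derive_e2 _ (y, s) _).1 (fg (y, s)).
- by move=> s hs; apply: (vanish_sq r1 vf); right.
- by move=> s hs; apply: (vanish_sq r1 vg); right.
Qed.

End by_parts.

(** * The fundamental lemma of the calculus of variations *)

Section generic.
Context d (T : measurableType d) (R : realType).
Variables (mu : {measure set T -> \bar R}).

Lemma ae_imp (P Q : T -> Prop) : (forall x, P x -> Q x) ->
  {ae mu, forall x, P x} -> {ae mu, forall x, Q x}.
Proof. by move=> PQ; apply: filterS. Qed.

Lemma ae_imp2 (P P' Q : T -> Prop) : (forall x, P x -> P' x -> Q x) ->
  {ae mu, forall x, P x} -> {ae mu, forall x, P' x} -> {ae mu, forall x, Q x}.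
Proof. by move=> PQ; apply: filterS2. Qed.

Lemma dominatedR (D : set T) (f_ : nat -> T -> R) (f g : T -> R) : measurable D ->
  (forall n, measurable_fun D (f_ n)) ->
  (forall x, D x -> f_ n x @[n --> \oo] --> f x) ->
  mu.-integrable D (EFin \o g) -> (forall n x, D x -> `|f_ n x| <= g x) ->
  mu.-integrable D (EFin \o f) /\
  \int[mu]_(x in D) f_ n x @[n --> \oo] --> \int[mu]_(x in D) f x.
Proof.
move=> mD mf_ ff ig fg.
have mf : measurable_fun D f by exact: measurable_fun_cvg ff.
have [] := @dominated_convergence _ T R mu D mD (fun n => EFin \o f_ n) (EFin \o f)
  (EFin \o g) _ _ _ ig _.
- by move=> n; exact/measurable_EFinP.
- exact/measurable_EFinP.
- by apply: aeW => x Dx; apply: cvg_EFin; [exact: nearW|exact: ff].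
- by apply: aeW => x n Dx /=; rewrite lee_fin fg.
move=> if_ _ H; split => //; apply: fine_cvg.
by rewrite fineK; [exact: H|exact: integrable_fin_num].
Qed.

(** The sets A whose preimage carries integral 0 form a Dynkin system, so a generating pi-system
    decides. The map h allows one coordinate to be treated at a time. *)
Lemma dynkin_integral0 d' (T' : measurableType d') (h : T -> T') (G : set (set T'))
    (D : set T) (g : T -> \bar R) :
  measurable D -> mu.-integrable D g -> measurable_fun setT h ->
  @measurable _ T' = <<s G >> -> setI_closed G ->
  (\int[mu]_(x in D) g x = 0)%E ->
  (forall A, G A -> \int[mu]_(x in D `&` h @^-1` A) g x = 0)%E ->
  forall A, measurable A -> (\int[mu]_(x in D `&` h @^-1` A) g x = 0)%E.
Proof.
move=> mD ig mh GE GI D0 G0 A mA.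
have mDh S : measurable S -> measurable (D `&` h @^-1` S).
  by move=> mS; apply: measurableI => //; rewrite -[X in measurable X]setTI; exact: mh.
apply: (@dynkin_induction _ T' G
  (fun S => (\int[mu]_(x in D `&` h @^-1` S) g x = 0)%E)) => //.
- by rewrite preimage_setT setIT.
- move=> S mS S0.
  have := D0; rewrite -{1}(setIT D) -(setUCr (h @^-1` S)) setIUr integral_setU.
  + by rewrite S0 add0e preimage_setC.
  + exact: mDh.
  + by rewrite preimage_setC; apply: mDh; exact: measurableC.
  + rewrite -setIUr setUCr setIT; exact: (measurable_int mu).
  + by apply/disj_setPS => x [[_ ?] [_ ?]].
- move=> F mF tF F0.
  rewrite preimage_bigcup setI_bigcupr integral_bigcup.
  + by rewrite eseries0// => i _ _; exact: F0.
  + move=> i j _ _ [x [[_ xi] [_ xj]]]; apply: tF => //.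
    by exists (h x).
  + by move=> k; exact: mDh.
  + apply: integrableS ig => //; last by move=> x [k _ []].
    by apply: bigcupT_measurable => k; exact: mDh.
- by rewrite -GE.
Qed.

Lemma integral0_ae0 (D : set T) (g : T -> R) : measurable D ->
  mu.-integrable D (EFin \o g) ->
  (forall A, measurable A -> \int[mu]_(x in D `&` A) (g x)%:E = 0)%E ->
  {ae mu, forall x, D x -> g x = 0}.
Proof.
move=> mD ig H.
have := @integral_ae_eq _ _ _ mu D mD (cst 0%E) (EFin \o g) ig (measurable_cst _).
case=> [E ED mE|N [mN N0 S]].
  by rewrite integral0 -(H E mE) setIidr.
by exists N; split => // x /= nx; apply: S => /= h; apply: nx => /h [].
Qed.

Lemma RGenOO_setI : setI_closed (@RGenOpens.G R).
Proof.
move=> _ _ [a [b ->]] [c [e ->]].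
exists (Num.max a c), (Num.min b e); rewrite eqEsubset; split => x /=.
  by rewrite !in_itv/= => -[/andP[a1 a2] /andP[a3 a4]]; rewrite gt_max lt_min a1 a2 a3 a4.
by rewrite !in_itv/= gt_max lt_min => /andP[/andP[-> ->] /andP[-> ->]].
Qed.

Lemma dynkin_integral0R (h : T -> R) (D : set T) (g : T -> \bar R) :
  measurable D -> mu.-integrable D g -> measurable_fun setT h ->
  (exists M, forall x, D x -> `|h x| < M) ->
  (forall a b, \int[mu]_(x in D `&` h @^-1` `]a, b[%classic) g x = 0)%E ->
  forall A, measurable A -> (\int[mu]_(x in D `&` h @^-1` A) g x = 0)%E.
Proof.
move=> mD ig mh [M hM] H.
apply: (@dynkin_integral0 _ _ h (@RGenOpens.G R)) => //.
- exact: RGenOpens.measurableE.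
- exact: RGenOO_setI.
(* The whole line is not a bounded interval; the bound on h makes []-M, M[] play its role. *)
- rewrite -[RHS](H (- M) M) setIidl// => x /hM /=.
  by rewrite in_itv/= ltr_norml.
- by move=> _ [a [b ->]].
Qed.

End generic.

Section fundamental.
Variable R : realType.
Notation B := (disk R).
Notation mu := (mu2 R).

Lemma test_bump (a b c e r : R) n : r < 1 ->
  test_function (fun x : R * R => bumpf a b n x.1 * bumpf c e n x.2 * bumpf (-1) r n (sq x)).
Proof.
move=> r1; apply: (test_intro r1) => [k|x rx].
  apply: is_CkM; last exact: is_Ck_comp (bump_Ck1 k _ _ _) (is_Ck_sq R k).
  by apply: is_CkM; [exact: is_Ck_comp (bump_Ck1 k _ _ _) (is_Ck_fst R k)|
    exact: is_Ck_comp (bump_Ck1 k _ _ _) (is_Ck_snd R k)].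
rewrite [X in _ * X]bump_out ?mulr0// => /andP[_].
by rewrite ltNge (ltW rx).
Qed.

(** Products of bumps in x.1, x.2 and |x|^2 tend boundedly to indicators of boxes cut by a smaller
    disk. Hence g integrates to 0 over these; Dynkin systems extend this to product sets, one
    coordinate at a time, then to all measurable sets, and the smaller disks exhaust B. *)
Lemma fundamental_lemma (g : R * R -> R) : mu.-integrable B (EFin \o g) ->
  (forall phi, test_function phi -> \int[mu]_(x in B) (g x * phi x) = 0) ->
  {ae mu, forall x, B x -> g x = 0}.
Proof.
move=> ig H.
have mB := @mdisk R.
have mg := integrable_mfun ig.
(* The bound -1 always holds; it turns the smaller disk into the preimage of an open interval, as
   the bumps require. *)
pose S (r : R) := [set x : R * R | -1 < sq x < r].
have mS r : measurable (S r).
  have -> : S r = (@sq R) @^-1` `]-1, r[%classic.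
    by rewrite eqEsubset; split => x; rewrite /S/= in_itv.
  by apply: open_measurable2; move/continuousP: (@continuous_sq R); apply; exact: interval_open.
have SB r : r < 1 -> S r `<=` B.
  by move=> r1 x /= /andP[_ h]; apply/diskE; exact: lt_trans r1.
have step1 (r a b c e : R) : r < 1 ->
    (\int[mu]_(x in (S r `&` snd @^-1` `]c, e[%classic) `&` fst @^-1` `]a, b[%classic)
      (g x)%:E = 0)%E.
  move=> r1; set P := _ `&` _.
  have mP : measurable P.
    apply: measurableI; first apply: measurableI => //.
      by rewrite -[X in measurable X]setTI; exact: measurable_snd.
    by rewrite -[X in measurable X]setTI; exact: measurable_fst.
  have PB : P `<=` B by move=> x [[/(SB _ r1)]].
  pose phi n (x : R * R) := bumpf a b n x.1 * bumpf c e n x.2 * bumpf (-1) r n (sq x).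
  have tphi n : test_function (phi n) by exact: test_bump.
  have mphi n : measurable_fun B (phi n).
    by apply: continuous_measurable2 => //; exact: test_continuous.
  have [|x Bx||n x Bx|ind] := @dominatedR _ _ R mu B (fun n x => g x * phi n x)
      (fun x => g x * (\1_P x)) (fun x => `|g x|) mB.
  - by move=> n; apply: measurable_funM; [exact: mg|exact: mphi].
  - apply: cvgM; first exact: cvg_cst.
    have -> : \1_P x = \1_(`]a, b[%classic) x.1 * \1_(`]c, e[%classic) x.2
        * \1_(`]-1, r[%classic) (sq x) :> R.
      rewrite !indicE -!natrM !mulnb; congr (nat_of_bool _)%:R.
      have [/set_mem[[h1 h2] h3]|nP] := boolP (x \in P).
        by rewrite !mem_set//= in_itv.
      apply/esym/negbTE; apply: contra nP.
      move=> /andP[/andP[/set_mem h3 /set_mem h2] /set_mem h1].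
      by apply: mem_set; split => //; split => //; move: h1; rewrite /= in_itv.
    by apply: cvgM; [apply: cvgM|]; exact: bump_cvg.
  - exact: (integrable_norm ig).
  - have b0 := bump_ge0; have b1 := bump_le1.
    have p0 : 0 <= phi n x := mulr_ge0 (mulr_ge0 (b0 _ _ _ _ _) (b0 _ _ _ _ _)) (b0 _ _ _ _ _).
    have p1 : phi n x <= 1 := mulr_ile1 (mulr_ge0 (b0 _ _ _ _ _) (b0 _ _ _ _ _)) (b0 _ _ _ _ _)
      (mulr_ile1 (b0 _ _ _ _ _) (b0 _ _ _ _ _) (b1 _ _ _ _ _) (b1 _ _ _ _ _)) (b1 _ _ _ _ _).
    by rewrite normrM (ger0_norm p0) ler_piMr.
  under eq_fun do rewrite H//; move=> c0.
  have E0 : \int[mu]_(x in B) (g x * \1_P x) = 0.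
    by apply: (cvg_unique _ c0 (cvg_cst _)); exact: Rhausdorff.
  have -> : (\int[mu]_(x in P) (g x)%:E = \int[mu]_(x in B) (g x * \1_P x)%:E)%E.
    rewrite -[in LHS](setIidr PB) integral_mkcondr; apply: eq_integral => x _.
    by rewrite patchE indicE; case: (x \in P); rewrite ?mulr1 ?mulr0.
  by rewrite -[LHS]fineK; [rewrite -/(Rintegral _ _ _) E0|exact: integrable_fin_num].
have bnd (D : set (R * R)) (h : R * R -> R) : D `<=` B ->
    (forall x : R * R, sq x <= 1 -> `|h x| <= 1) ->
    exists M, forall x, D x -> `|h x| < M.
  by move=> DB hM; exists 2 => x /DB /diskE /ltW /hM h1; rewrite (le_lt_trans h1)// ltr1n.
have igS (D : set (R * R)) : measurable D -> D `<=` B -> mu.-integrable D (EFin \o g).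
  by move=> mD DB; exact: integrableS ig.
have step2 (r : R) (A A' : set R) : r < 1 -> measurable A -> measurable A' ->
    (\int[mu]_(x in (S r `&` fst @^-1` A) `&` snd @^-1` A') (g x)%:E = 0)%E.
  move=> r1 mA mA'.
  have m1 : measurable (S r `&` fst @^-1` A).
    by apply: measurableI => //; rewrite -[X in measurable X]setTI; exact: measurable_fst.
  have s1 : S r `&` fst @^-1` A `<=` B by move=> x [/(SB _ r1)].
  apply: (@dynkin_integral0R _ _ R mu snd) => //.
  - exact: igS.
  - by apply: bnd => // x /disk_itv[].
  move=> c e; rewrite setIAC.
  have m2 : measurable (S r `&` snd @^-1` `]c, e[%classic).
    by apply: measurableI => //; rewrite -[X in measurable X]setTI; exact: measurable_snd.
  have s2 : S r `&` snd @^-1` `]c, e[%classic `<=` B by move=> x [/(SB _ r1)].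
  apply: (@dynkin_integral0R _ _ R mu fst) => //.
  - exact: igS.
  - by apply: bnd => // x /disk_itv[].
  - by move=> a b; exact: step1.
have step3 (r : R) : r < 1 -> {ae mu, forall x, S r x -> g x = 0}.
  move=> r1; apply: (@integral0_ae0 _ _ R mu (S r) g) => [||A mA]; [exact: mS|exact: igS (mS r) (SB r r1)|].
  pose G := [set A `*` A' | A in @measurable _ (measurableTypeR R) &
     A' in @measurable _ (measurableTypeR R)].
  apply: (@dynkin_integral0 _ _ R mu _ _ id G) => //.
  - exact: mS.
  - exact: (igS _ (mS r) (SB r r1)).
  - exact: measurable_prod_measurableType.
  - move=> _ _ [A1 mA1 [A2 mA2 <-]] [A3 mA3 [A4 mA4 <-]].
    exists (A1 `&` A3); first exact: measurableI.
    by exists (A2 `&` A4); [exact: measurableI|rewrite setXI].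
  - have := @step2 r setT setT r1 measurableT measurableT.
    by rewrite !preimage_setT !setIT.
  - move=> _ [A1 mA1 [A2 mA2 <-]].
    by rewrite -[RHS](@step2 r A1 A2 r1 mA1 mA2) -setIA.
have : {ae mu, forall x, forall n : nat, S (1 - n.+1%:R^-1) x -> g x = 0}.
  by apply: ae_foralln => n; apply: step3; rewrite gtrDl oppr_lt0 invr_gt0 ltr0n.
apply: ae_imp => x Hx /diskE sx.
have [n nP] := ltr_add_invr sx.
apply: (Hx n); rewrite /S/= (lt_le_trans _ (sq_ge0 x)) ?ltrN10//=.
by rewrite ltrBrDr.
Qed.

End fundamental.

(** * Weak derivatives *)

Section generic2.
Context d (T : measurableType d) (R : realType).
Variables (mu : {measure set T -> \bar R}) (D : set T) (mD : measurable D).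

Lemma ip_cvgl (f h : T -> R) (F : nat -> T -> R) :
  sqint mu D f -> sqint mu D h -> (forall n, sqint mu D (F n)) ->
  ip mu D (fun x => f x - F n x) (fun x => f x - F n x) @[n --> \oo] --> (0 : R) ->
  ip mu D (F n) h @[n --> \oo] --> ip mu D f h.
Proof.
move=> sf sh sF cF; apply: (@ip_cvg _ _ R mu D mD f h F (fun=> h)) => //.
rewrite (_ : (fun n => _) = (fun=> 0)); first exact: cvg_cst.
apply/funext => n; rewrite /ip; under eq_Rintegral do rewrite subrr mulr0.
by rewrite Rintegral_cst// mul0r.
Qed.

Lemma ae_Rintegral (f g : T -> R) : measurable_fun D f -> measurable_fun D g ->
  {ae mu, forall x, D x -> f x = g x} ->
  \int[mu]_(x in D) f x = \int[mu]_(x in D) g x.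
Proof.
move=> mf mg fg; congr fine; apply: ae_eq_integral => //.
- exact/measurable_EFinP.
- exact/measurable_EFinP.
- by apply: ae_imp fg => x h Dx; rewrite h.
Qed.

Lemma ae_ip (f g f' g' : T -> R) : sqint mu D f -> sqint mu D g ->
  sqint mu D f' -> sqint mu D g' ->
  {ae mu, forall x, D x -> f x = f' x} -> {ae mu, forall x, D x -> g x = g' x} ->
  ip mu D f g = ip mu D f' g'.
Proof.
move=> [mf _] [mg _] [mf' _] [mg' _] ff' gg'; apply: ae_Rintegral.
- exact: measurable_funM.
- exact: measurable_funM.
- by apply: ae_imp2 ff' gg' => x h h' Dx; rewrite h// h'.
Qed.

Lemma ae_sqint (f g : T -> R) : sqint mu D f -> measurable_fun D g ->
  {ae mu, forall x, D x -> g x = f x} -> sqint mu D g.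
Proof.
move=> [mf /integrableP[_ f2]] mg gf; split => //; apply/integrableP; split.
  by apply/measurable_EFinP; exact: measurable_funX.
rewrite (@ae_eq_integral _ _ _ mu D (fun x => `|(f x ^+ 2)%:E|)%E)//.
- apply: measurableT_comp => //; apply/measurable_EFinP; exact: measurable_funX.
- apply: measurableT_comp => //; apply/measurable_EFinP; exact: measurable_funX.
- by apply: ae_imp gf => x h Dx /=; rewrite h.
Qed.

End generic2.

Section weak.
Variable R : realType.
#[local] Hint Extern 0 (measurable (disk _)) => exact: mdisk : core.
Implicit Types (u v g h phi : R * R -> R).
Notation B := (disk R).
Notation mu := (mu2 R).
Notation ipB := (ip mu B).

Lemma L2_mul f g : L2 f -> L2 g -> mu.-integrable B (EFin \o (fun x => f x * g x)).
Proof. exact: (@sqint_mul _ _ R mu B (@mdisk R)). Qed.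

Lemma L2_sub f g : L2 f -> L2 g -> L2 (fun x => f x - g x).
Proof. exact: (@sqintB _ _ R mu B (@mdisk R)). Qed.

Lemma L2_add f g : L2 f -> L2 g -> L2 (fun x => f x + g x).
Proof. exact: (@sqintD _ _ R mu B (@mdisk R)). Qed.

Lemma L2_scal (k : R) f : L2 f -> L2 (fun x => k * f x).
Proof. exact: (@sqintZ _ _ R mu B (@mdisk R)). Qed.

Lemma ipB_subl f g h : L2 f -> L2 g -> L2 h ->
  ipB (fun x => f x - g x) h = ipB f h - ipB g h.
Proof. exact: (@ipBl _ _ R mu B (@mdisk R)). Qed.

Lemma test_L2 phi : test_function phi -> L2 phi.
Proof. by move=> /test_continuous; exact: continuous_L2. Qed.

Lemma test_L21 phi : test_function phi -> L2 ('D_(e1 R) phi).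
Proof. by move=> /test_continuous1; exact: continuous_L2. Qed.

Lemma test_L22 phi : test_function phi -> L2 ('D_(e2 R) phi).
Proof. by move=> /test_continuous2; exact: continuous_L2. Qed.

Lemma int_by_parts1 phi u du : test_function phi -> continuous u -> continuous du ->
  (forall x, is_derive x (e1 R) u (du x)) ->
  ipB u ('D_(e1 R) phi) = - ipB du phi.
Proof.
move=> tp cu cdu Du; have [r r1 vp] := test_vanish tp.
have cp := test_continuous tp; have cp1 := test_continuous1 tp.
have sp := test_L2 tp; have sp1 := test_L21 tp.
have su := continuous_L2 cu; have sdu := continuous_L2 cdu.
apply/eqP; rewrite -addr_eq0; apply/eqP.
rewrite /ip addrC -RintegralD; [|exact: mdisk|exact: L2_mul|exact: L2_mul].
apply: (@int_deriv1 _ r (fun x => u x * phi x)) => //.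
- by move=> x rx; rewrite vp ?mulr0.
- by move=> x; apply: cvgD; apply: cvgM;
    (exact: cdu || exact: cp || exact: cu || exact: cp1).
- by move=> x; apply: is_derive_mul => //; exact: test_derive1.
Qed.

Lemma int_by_parts2 phi u du : test_function phi -> continuous u -> continuous du ->
  (forall x, is_derive x (e2 R) u (du x)) ->
  ipB u ('D_(e2 R) phi) = - ipB du phi.
Proof.
move=> tp cu cdu Du; have [r r1 vp] := test_vanish tp.
have cp := test_continuous tp; have cp1 := test_continuous2 tp.
have sp := test_L2 tp; have sp1 := test_L22 tp.
have su := continuous_L2 cu; have sdu := continuous_L2 cdu.
apply/eqP; rewrite -addr_eq0; apply/eqP.
rewrite /ip addrC -RintegralD; [|exact: mdisk|exact: L2_mul|exact: L2_mul].
apply: (@int_deriv2 _ r (fun x => u x * phi x)) => //.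
- by move=> x rx; rewrite vp ?mulr0.
- by move=> x; apply: cvgD; apply: cvgM;
    (exact: cdu || exact: cp || exact: cu || exact: cp1).
- by move=> x; apply: is_derive_mul => //; exact: test_derive2.
Qed.

Lemma test_wd1 phi : test_function phi -> is_weak_deriv (e1 R) phi ('D_(e1 R) phi).
Proof.
move=> tp; split; first exact: test_L21.
move=> eta te; apply: int_by_parts1 => //; first exact: test_continuous.
  exact: test_continuous1.
by move=> x; exact: test_derive1.
Qed.

Lemma test_wd2 phi : test_function phi -> is_weak_deriv (e2 R) phi ('D_(e2 R) phi).
Proof.
move=> tp; split; first exact: test_L22.
move=> eta te; apply: int_by_parts2 => //; first exact: test_continuous.
  exact: test_continuous2.
by move=> x; exact: test_derive2.
Qed.

Lemma wd_uniq e u g h : is_weak_deriv e u g -> is_weak_deriv e u h ->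
  {ae mu, forall x, B x -> g x = h x}.
Proof.
move=> [sg ug] [sh uh].
have s1 : L2 (fun _ : R * R => 1 : R) by apply: continuous_L2 => x; exact: cvg_cst.
have sgh : L2 (fun x => g x - h x) by exact: L2_sub.
have i : mu.-integrable B (EFin \o (fun x => g x - h x)).
  rewrite (_ : (fun x => g x - h x) = (fun x => (g x - h x) * 1)).
    exact: L2_mul sgh s1.
  by apply/funext => x; rewrite mulr1.
apply: ae_imp (fundamental_lemma i _) => [x H /H /subr0_eq//|phi tp].
have sp := test_L2 tp.
rewrite [LHS](ipB_subl sg sh sp).
have := ug phi tp; rewrite uh// => /oppr_inj; rewrite /ip => ->.
by rewrite subrr.
Qed.

Lemma weak_derivP e u g : is_weak_deriv e u g -> is_weak_deriv e u (weak_deriv e u).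
Proof. by move=> H; apply: xgetPex; exists g. Qed.

Lemma wdB e u v g h : L2 u -> L2 v -> (forall phi, test_function phi -> L2 ('D_e phi)) ->
  is_weak_deriv e u g -> is_weak_deriv e v h ->
  is_weak_deriv e (fun x => u x - v x) (fun x => g x - h x).
Proof.
move=> su sv De [sg ug] [sh vh].
split; first exact: L2_sub.
move=> phi tp; have sp := test_L2 tp; have sD := De _ tp.
rewrite [LHS](ipB_subl su sv sD) [X in _ = - X](ipB_subl sg sh sp).
by rewrite /ip ug// vh//; ring.
Qed.

(** By uniqueness almost everywhere, any weak derivatives may stand for the arbitrary
    representatives chosen by [weak_deriv]. *)
Lemma dirichlet_formE u v g1 g2 h1 h2 :
  is_weak_deriv (e1 R) u g1 -> is_weak_deriv (e2 R) u g2 ->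
  is_weak_deriv (e1 R) v h1 -> is_weak_deriv (e2 R) v h2 ->
  dirichlet_form u v = ipB g1 h1 + ipB g2 h2.
Proof.
move=> wg1 wg2 wh1 wh2.
have wu1 := weak_derivP wg1; have wu2 := weak_derivP wg2.
have wv1 := weak_derivP wh1; have wv2 := weak_derivP wh2.
have [su1 _] := wu1; have [su2 _] := wu2; have [sv1 _] := wv1; have [sv2 _] := wv2.
have [sg1 _] := wg1; have [sg2 _] := wg2; have [sh1 _] := wh1; have [sh2 _] := wh2.
rewrite /dirichlet_form RintegralD; [|exact: mdisk|exact: L2_mul|exact: L2_mul].
congr (_ + _).
  exact: (@ae_ip _ _ R mu B (@mdisk R) _ _ _ _ su1 sv1 sg1 sh1
    (wd_uniq wu1 wg1) (wd_uniq wv1 wh1)).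
exact: (@ae_ip _ _ R mu B (@mdisk R) _ _ _ _ su2 sv2 sg2 sh2
  (wd_uniq wu2 wg2) (wd_uniq wv2 wh2)).
Qed.

Definition dist2 f g := ipB (fun x => f x - g x) (fun x => f x - g x).

(* Carries the gradient along, since [weak_deriv] is only a choice of representative. *)
Record H10g u g1 g2 : Prop := {
  H10g_L2 : L2 u;
  H10g_L21 : L2 g1;
  H10g_L22 : L2 g2;
  H10g_approx : exists phi : nat -> R * R -> R,
    [/\ forall n, test_function (phi n),
        dist2 u (phi n) @[n --> \oo] --> (0 : R),
        dist2 g1 ('D_(e1 R) (phi n)) @[n --> \oo] --> (0 : R) &
        dist2 g2 ('D_(e2 R) (phi n)) @[n --> \oo] --> (0 : R)] }.

Lemma H10g_wd u g1 g2 : H10g u g1 g2 ->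
  is_weak_deriv (e1 R) u g1 /\ is_weak_deriv (e2 R) u g2.
Proof.
move=> [su s1 s2 [phi [tp cu c1 c2]]].
have main e g : (forall f, test_function f -> L2 ('D_e f)) ->
    (forall f, test_function f -> is_weak_deriv e f ('D_e f)) ->
    L2 g -> dist2 g ('D_e (phi n)) @[n --> \oo] --> (0 : R) -> is_weak_deriv e u g.
  move=> De We sg cg; split => // eta te.
  have se := test_L2 te; have sDe := De _ te.
  have sp n := test_L2 (tp n); have sDp n := De _ (tp n).
  have a := @ip_cvgl _ _ R mu B (@mdisk R) u ('D_e eta) phi su sDe sp cu.
  have b := @ip_cvgl _ _ R mu B (@mdisk R) g eta (fun n => 'D_e (phi n)) sg se sDp cg.
  have E n : ipB (phi n) ('D_e eta) = - ipB ('D_e (phi n)) eta.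
    by have [_] := We _ (tp n); apply.
  have b' := cvgN b; apply: (cvg_unique _ a) => /=; first exact: Rhausdorff.
  by under eq_fun do rewrite E; exact: b'.
by split; [exact: main test_L21 test_wd1 s1 c1|exact: main test_L22 test_wd2 s2 c2].
Qed.

Lemma H10g_form u g1 g2 v h1 h2 : H10g u g1 g2 -> H10g v h1 h2 ->
  dirichlet_form u v = ipB g1 h1 + ipB g2 h2.
Proof.
move=> /H10g_wd[a b] /H10g_wd[a' b']; exact: dirichlet_formE.
Qed.

Lemma wdB1 u v g h : L2 u -> L2 v ->
  is_weak_deriv (e1 R) u g -> is_weak_deriv (e1 R) v h ->
  is_weak_deriv (e1 R) (fun x => u x - v x) (fun x => g x - h x).
Proof. by move=> su sv; exact: wdB su sv test_L21. Qed.

Lemma wdB2 u v g h : L2 u -> L2 v ->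
  is_weak_deriv (e2 R) u g -> is_weak_deriv (e2 R) v h ->
  is_weak_deriv (e2 R) (fun x => u x - v x) (fun x => g x - h x).
Proof. by move=> su sv; exact: wdB su sv test_L22. Qed.

Lemma form_sub u v g1 g2 h1 h2 : L2 u -> L2 v ->
  is_weak_deriv (e1 R) u g1 -> is_weak_deriv (e2 R) u g2 ->
  is_weak_deriv (e1 R) v h1 -> is_weak_deriv (e2 R) v h2 ->
  dirichlet_form (fun x => u x - v x) (fun x => u x - v x) = dist2 g1 h1 + dist2 g2 h2.
Proof.
move=> su sv u1 u2 v1 v2.
exact: dirichlet_formE (wdB1 su sv u1 v1) (wdB2 su sv u2 v2)
  (wdB1 su sv u1 v1) (wdB2 su sv u2 v2).
Qed.

Lemma dist2_ge0 f g : 0 <= dist2 f g.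
Proof. exact: ip_ge0. Qed.

Lemma H10g_H10 u g1 g2 : H10g u g1 g2 -> H10 u.
Proof.
move=> Hu; have [w1 w2] := H10g_wd Hu; have [su s1 s2 [phi [tp cu c1 c2]]] := Hu.
split; first by split; [exact: su|exists g1|exists g2].
move=> eps eps0.
have e3 : 0 < eps ^+ 2 by rewrite exprn_gt0.
have [n hn] : exists n, dist2 u (phi n) + dist2 g1 ('D_(e1 R) (phi n))
    + dist2 g2 ('D_(e2 R) (phi n)) < eps ^+ 2.
  have c : dist2 u (phi n) + dist2 g1 ('D_(e1 R) (phi n))
    + dist2 g2 ('D_(e2 R) (phi n)) @[n --> \oo] --> (0 + 0 + 0 : R).
    exact: (cvgD (cvgD cu c1) c2).
  rewrite !addr0 in c.
  have [N _ HN] := cvgr_lt _ c _ e3.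
  by exists N; exact: (HN N (leqnn N)).
exists (phi n) => //.
rewrite /H1_norm (form_sub su (test_L2 (tp n)) w1 w2 (test_wd1 (tp n)) (test_wd2 (tp n))).
rewrite -[ltRHS](ger0_norm (ltW eps0)) -sqrtr_sqr ltr_sqrt ?exprn_gt0//.
rewrite addrA (_ : \int[mu]_(x in B) (u x - phi n x) ^+ 2 = dist2 u (phi n))//.
Qed.

Lemma H10_H10g u : H10 u -> exists g1 g2, H10g u g1 g2.
Proof.
move=> [[su [g1 w1] [g2 w2]] Hd].
have [s1 _] := w1; have [s2 _] := w2.
exists g1, g2; split => //.
have : forall n : nat, exists phi, test_function phi /\
    H1_norm (fun x => u x - phi x) < n.+1%:R^-1.
  by move=> n; have [|phi tp h] := Hd n.+1%:R^-1; [rewrite invr_gt0|exists phi].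
move/choice => [phi Hphi]; exists phi.
have tp n : test_function (phi n) by case: (Hphi n).
have bnd n : dist2 u (phi n) + dist2 g1 ('D_(e1 R) (phi n))
    + dist2 g2 ('D_(e2 R) (phi n)) <= n.+1%:R^-1.
  have [_] := Hphi n.
  rewrite /H1_norm (form_sub su (test_L2 (tp n)) w1 w2 (test_wd1 (tp n)) (test_wd2 (tp n))).
  rewrite addrA (_ : \int[mu]_(x in B) (u x - phi n x) ^+ 2 = dist2 u (phi n)); last first.
    by apply: eq_Rintegral => x _; rewrite expr2.
  set S := _ + _; move=> h.
  have S0 : 0 <= S by rewrite !addr_ge0 ?dist2_ge0.
  have h0 : 0 < n.+1%:R^-1 :> R by rewrite invr_gt0.
  (* The norm is below 1/(n+1), so its square is below 1/(n+1)^2 and a fortiori below 1/(n+1), which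
     is compared with the harmonic sequence. *)
  rewrite -(sqr_sqrtr S0) (le_trans (_ : _ <= n.+1%:R^-1 ^+ 2))//.
    by rewrite lerXn2r ?nnegrE ?sqrtr_ge0 ?ltW.
  by rewrite expr2 ler_piMl ?(ltW h0)// invf_le1 ?ltr0n// ler1n.
split => //; apply: (squeeze0 _ (@cvg_harmonic R)) => n /=;
  rewrite ger0_norm ?dist2_ge0//; apply: le_trans (bnd n).
- by rewrite -addrA lerDl addr_ge0 ?dist2_ge0.
- by rewrite addrAC lerDr addr_ge0 ?dist2_ge0.
- by rewrite lerDr addr_ge0 ?dist2_ge0.
Qed.

Lemma ae_H10g u v g1 g2 : H10g u g1 g2 -> measurable_fun B v ->
  {ae mu, forall x, B x -> v x = u x} -> H10g v g1 g2.
Proof.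
move=> [su s1 s2 [phi [tp cu c1 c2]]] mv vu.
have sv : L2 v by exact: (@ae_sqint _ _ R mu B (@mdisk R) u v su mv vu).
split => //; exists phi; split => //.
rewrite (_ : (fun n => dist2 v (phi n)) = (fun n => dist2 u (phi n)))//.
apply/funext => n; have sp := test_L2 (tp n).
have H : {ae mu, forall x, B x -> v x - phi n x = u x - phi n x}.
  by apply: ae_imp vu => x h Bx; rewrite h.
exact: (@ae_ip _ _ R mu B (@mdisk R) _ _ _ _ (L2_sub sv sp) (L2_sub sv sp)
  (L2_sub su sp) (L2_sub su sp) H H).
Qed.

End weak.

(** * The radial ground state *)

Section bessel.
Variable R : realType.

(* [besself m] is the [m]-th derivative of the series [sum_k (-x)^k / k!^2]; [besself 0 (r^2/4)]
   is the Bessel function [J_0 r]. *)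
Definition bessel_coef (m k : nat) : R := (-1) ^+ (k + m) / (k`!%:R * (k + m)`!%:R).

Lemma bessel_diffs m : pseries_diffs (bessel_coef m) = bessel_coef m.+1.
Proof.
apply/funext => k; rewrite /pseries_diffs /bessel_coef addSnnS addnS factS natrM.
have h1 : k`!%:R != 0 :> R by rewrite pnatr_eq0 -lt0n fact_gt0.
have h2 : (k + m).+1`!%:R != 0 :> R by rewrite pnatr_eq0 -lt0n fact_gt0.
have h3 : k.+1%:R != 0 :> R by rewrite pnatr_eq0.
have gen (c N a b : R) : c != 0 -> a != 0 -> b != 0 ->
    c * (N / (c * a * b)) = N / (a * b) by move=> c0 a0 b0; field; rewrite c0 a0 b0.
exact: gen.
Qed.

Lemma bessel_cvg m x : cvgn (pseries (bessel_coef m) x).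
Proof.
apply: normed_cvg.
apply: (@series_le_cvg _ _ (exp_coeff `|x|)) => [n|n|n|].
- exact: normr_ge0.
- by rewrite exp_coeff_ge0.
- rewrite /= normrM normrX /exp_coeff /= mulrC ler_wpM2l// ?exprn_ge0//.
  rewrite /bessel_coef normrM normrX normrN1 expr1n mul1r normfV normrM !normr_nat.
  rewrite lef_pV2 ?posrE ?mulr_gt0 ?ltr0n ?fact_gt0//.
  by rewrite ler_peMr// ?ler1n ?fact_gt0.
- exact: is_cvg_series_exp_coeff.
Qed.

Definition besself m (x : R) : R := limn (pseries (bessel_coef m) x).

Lemma besselfP m (x : R) : is_derive x 1 (besself m) (besself m.+1 x).
Proof.
have := @pseries_snd_diffs R (bessel_coef m) (`|x| + 1) x.
rewrite !bessel_diffs; apply; try exact: bessel_cvg.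
by rewrite [ltRHS]ger0_norm ?addr_ge0// ltrDl.
Qed.

Lemma besselfC m : continuous (besself m).
Proof. by move=> x; exact: is_derive_cont (besselfP m x). Qed.

(** The coefficient of x^(n+1) in the equation x b'' + b' + b = 0. *)
Lemma bessel_coefE n :
  bessel_coef 2 n + bessel_coef 1 n.+1 + bessel_coef 0 n.+1 = 0.
Proof.
rewrite /bessel_coef !addnS !addn0 !exprS !factS !natrM -(natr1 n.+1).
have h1 : n`!%:R != 0 :> R by rewrite pnatr_eq0 -lt0n fact_gt0.
have h3 : n.+1%:R != 0 :> R by rewrite pnatr_eq0.
have h4 : n.+1%:R + 1 != 0 :> R by rewrite natr1 pnatr_eq0.
have gen (N a p : R) : p != 0 -> a != 0 -> p + 1 != 0 ->
    -1 * (-1 * N) / (a * ((p + 1) * (p * a))) +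
    -1 * (-1 * N) / (p * a * ((p + 1) * (p * a))) +
    -1 * N / (p * a * (p * a)) = 0 by move=> c0 a0 b0; field; rewrite c0 a0 b0.
exact: gen.
Qed.

Lemma besselfE x : x * besself 2 x + besself 1 x + besself 0 x = 0.
Proof.
(* With one more term in the last two partial sums, to compensate the factor x, the equation already
   holds exactly for polynomials. *)
have H n : x * pseries (bessel_coef 2) x n + pseries (bessel_coef 1) x n.+1 +
    pseries (bessel_coef 0) x n.+1 = 0.
  rewrite /pseries /series /=; elim: n => [|n IH].
    rewrite big_geq// !big_nat1 /bessel_coef !add0n fact0 (_ : 1`! = 1)%N//.
    by rewrite expr1 !expr0 !mulr1 mulr0 add0r divr1 divr1 addNr.
  rewrite big_nat_recr//= (big_nat_recr n.+1)//= [X in _ + X](big_nat_recr n.+1)//=.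
  have := bessel_coefE n; move: IH; rewrite exprS.
  set s2 := \sum_(0 <= i < n) _; set s1 := \sum_(0 <= i < n.+1) _.
  set s0 := \sum_(0 <= i < n.+1) _ => IH E.
  transitivity ((x * s2 + s1 + s0) + x * x ^+ n *
    (bessel_coef 2 n + bessel_coef 1 n.+1 + bessel_coef 0 n.+1)); first by ring.
  by rewrite IH E mulr0 addr0.
have c : x * pseries (bessel_coef 2) x n + pseries (bessel_coef 1) x n.+1 +
    pseries (bessel_coef 0) x n.+1 @[n --> \oo] -->
    x * besself 2 x + besself 1 x + besself 0 x.
  apply: cvgD; first apply: cvgD.
  - by apply: cvgM; [exact: cvg_cst|exact: bessel_cvg].
  - by rewrite (cvg_shiftS (pseries (bessel_coef 1) x)); exact: bessel_cvg.
  - by rewrite (cvg_shiftS (pseries (bessel_coef 0) x)); exact: bessel_cvg.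
rewrite (funext H) in c.
by apply: (cvg_unique _ c (cvg_cst _)); exact: Rhausdorff.
Qed.

Lemma is_derive_le (F f : R -> R) (a b : R) : a <= b ->
  (forall x : R, is_derive x 1 F (f x)) -> (forall x, a < x < b -> 0 <= f x) ->
  F a <= F b.
Proof.
rewrite le_eqVlt => /predU1P[->//|ab Ff f0].
have cF : {within `[a, b], continuous F}.
  by apply: continuous_subspaceT => x; exact: is_derive_cont (Ff x).
have [c /[!in_itv]/= cab E] := MVT ab (fun x _ => Ff x) cF.
by rewrite -subr_ge0 E mulr_ge0 ?f0// subr_ge0 ltW.
Qed.

Lemma bessel0 : besself 0 0 = 1.
Proof.
rewrite /besself; apply/cvg_lim => //; rewrite -(cvg_shiftS (pseries _ _)).
rewrite (_ : (fun n => _) = (fun=> 1)); first exact: cvg_cst.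
apply/funext => n; rewrite /pseries /series /= big_nat_recl// big1 ?addr0; last first.
  by move=> i _; rewrite expr0n/= mulr0.
by rewrite /bessel_coef addn0 fact0 expr0 !mulr1 divr1.
Qed.

(** The flux t b'(t): by the equation its derivative is -b, so it decreases from 0 as long as b is
    positive. *)
Let D (t : R) := t * besself 1 t.

Let Dd (t : R) : is_derive t 1 D (- besself 0 t).
Proof.
apply: (is_derive_eq (is_derive_mul (is_derive_id t 1) (besselfP 1 t))).
by have := besselfE t; lra.
Qed.

Let D_le0 s : 0 <= s -> (forall t, 0 < t < s -> 0 < besself 0 t) -> D s <= 0.
Proof.
move=> s0 H.
have dN (x : R) : is_derive x 1 (fun x => - D x) (besself 0 x).
  by have := is_derive_opp (Dd x); rewrite opprK.
have := is_derive_le s0 dN (fun x h => ltW (H x h)).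
by rewrite lerN2 /D mul0r.
Qed.

Let b1_le0 s : 0 < s -> (forall t, 0 < t < s -> 0 < besself 0 t) -> besself 1 s <= 0.
Proof.
move=> s0 /(D_le0 (ltW s0)); rewrite /D; rewrite pmulr_rle0//.
Qed.

(** Suppose b > 0 on [0, 2]. Then b' <= 0, so b <= 1; integrating (t b')' = -b gives b' >= -1, so b
    >= 1 - s; integrating again gives b' <= -1 + s/2, so b <= 1 - s + s^2/4. The last polynomial
    vanishes at 2, a contradiction. *)
Lemma bessel2 : exists2 t, 0 <= t <= 2 & besself 0 t <= 0.
Proof.
apply: contrapT => H.
have P t : 0 <= t <= 2 -> 0 < besself 0 t.
  by move=> h; rewrite ltNge; apply/negP => h'; apply: H; exists t.
have dN (x : R) : is_derive x 1 (fun x => - besself 0 x) (- besself 1 x).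
  exact: (is_derive_opp (besselfP 0 x)).
have dD (x : R) : is_derive x 1 (fun x => D x + x) (- besself 0 x + 1).
  exact: (is_derive_add (Dd x) (is_derive_id x 1)).
have dx (x : R) : is_derive x 1 (fun x => besself 0 x + x) (besself 1 x + 1).
  exact: (is_derive_add (besselfP 0 x) (is_derive_id x 1)).
have sqd (c x : R) : is_derive x 1 (fun x => c * (x * x)) (c * (1 * x + x * 1)).
  exact: (is_derive_scal c (is_derive_mul (is_derive_id x 1) (is_derive_id x 1))).
have D0 : D 0 = 0 by rewrite /D mul0r.
have A1 s : 0 <= s <= 2 -> besself 0 s <= 1.
  move=> /andP[s0 s2]; rewrite -bessel0 -lerN2.
  apply: (is_derive_le s0 dN) => x /andP[x0 xs].
  by rewrite oppr_ge0; apply: b1_le0 => // t /andP[t0 tx]; apply: P; lra.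
have A2 s : 0 < s -> s <= 2 -> -1 <= besself 1 s.
  move=> s0 s2.
  have := is_derive_le (ltW s0) dD; rewrite D0 addr0 /D => K.
  have : 0 <= s * (besself 1 s + 1).
    by rewrite mulrDr mulr1; apply: K => x xs; have := A1 x; lra.
  by rewrite pmulr_rge0//; lra.
have A3 s : 0 <= s -> s <= 2 -> 1 - s <= besself 0 s.
  move=> s0 s2; have := is_derive_le s0 dx; rewrite bessel0 => K.
  by have := K (fun x xs => ltac:(have := @A2 x; lra)); lra.
have A4 s : 0 < s -> s <= 2 -> besself 1 s <= -1 + s / 2.
  move=> s0 s2.
  have := is_derive_le (ltW s0)
    (fun x => is_derive_add (is_derive_opp (dD x)) (sqd 2^-1 x)).
  rewrite D0 /D => K.
  have h := K (fun x xs => ltac:(have := @A3 x; lra)).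
  have h' : 0 <= s * (- besself 1 s - 1 + s / 2) by lra.
  by rewrite pmulr_rge0// in h'; lra.
have K := @is_derive_le _ _ 0 2 (ltac:(lra))
    (fun x => is_derive_add (is_derive_opp (dx x)) (sqd 4^-1 x))
    (fun x xs => ltac:(have := @A4 x; lra)).
by rewrite bessel0 in K; have := P 2; lra.
Qed.

(** The zero is the least point of the compact set where b <= 0 in [0, 2]; the intermediate value
    theorem gives a zero up to that point, and positivity before it leaves no other choice. *)
Lemma bessel_zero : exists2 t0, 0 < t0 & besself 0 t0 = 0 /\
  forall t, 0 <= t < t0 -> 0 < besself 0 t.
Proof.
have [t2 t20 t2P] := bessel2.
pose S := `[0, 2]%classic `&` (besself 0) @^-1` [set y | y <= 0].
have cS : compact S.
  apply: (subclosed_compact _ (@segment_compact R 0 2)).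
    apply: closedI.
      exact: (compact_closed (@Rhausdorff R) (@segment_compact R 0 2)).
    by apply: closed_comp => [x _|]; [exact: besselfC|exact: closed_le].
  by move=> x [].
have [||c /set_mem[+ cP] cmin] := @compact_EVT_min _ R id S _ cS.
- by exists t2; split => //=; rewrite in_itv.
- by apply: continuous_subspaceT => x; exact: cvg_id.
rewrite /= in_itv/= => /andP[c0 c2].
have P t : 0 <= t < c -> 0 < besself 0 t.
  move=> /andP[t0 tc]; rewrite ltNge; apply/negP => h.
  have : c <= t by apply: cmin; rewrite inE; split => //=; rewrite in_itv/= t0/= (le_trans (ltW tc)).
  by rewrite leNgt tc.
have c0' : 0 < c.
  rewrite lt_neqAle c0 andbT; apply/eqP => E.
  by move: cP; rewrite /= -E bessel0 ler10.
exists c => //; split => //.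
have [||z zc z0] := @IVT R (besself 0) 0 c 0 c0.
- by apply: continuous_subspaceT => x; exact: besselfC.
- by rewrite bessel0 ge_min le_max cP ler01 orbT.
move: zc; rewrite in_itv/= => /andP[z1]; rewrite le_eqVlt => /predU1P[<-//|zc].
by have := P z; rewrite z1 zc z0 ltxx => /(_ isT).
Qed.

(* The radial profile, in the variable [s = r^2], of the first eigenfunction *)
Lemma first_profile : exists (F F1 F2 : R -> R) (l : R),
  [/\ forall s : R, is_derive s 1 F (F1 s), forall s : R, is_derive s 1 F1 (F2 s),
      continuous F2, 0 < l & forall s, s * F2 s + F1 s = - l * F s] /\
  [/\ F 0 = 1, F 1 = 0, forall s, 0 <= s < 1 -> 0 < F s &
      forall a b, 0 <= a -> a <= b -> b <= 1 -> F b <= F a].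
Proof.
(* The first zero becomes the parameter l: scaling the variable by l moves the zero to s = 1 and
   multiplies the right-hand side of the equation by l. *)
have [l l0 [Fl Pl]] := bessel_zero.
have dl (s : R) : is_derive s 1 (fun s => l * s) l.
  by apply: (is_derive_eq (is_derive_scal l (is_derive_id s 1))); rewrite mulr1.
have db m (s : R) : is_derive s 1 (fun s => besself m (l * s)) (besself m.+1 (l * s) * l).
  exact: (@is_derive1_comp _ (besself m) (fun s => l * s) s _ _ (besselfP m (l * s)) (dl s)).
have dF1 (s : R) : is_derive s 1 (fun s => besself 1 (l * s) * l) (besself 2 (l * s) * l * l).
  apply: (is_derive_eq (is_derive_mul (db 1%N s) (is_derive_const l s 1))).
  by rewrite mulr0 addr0.
exists (fun s => besself 0 (l * s)), (fun s => besself 1 (l * s) * l),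
  (fun s => besself 2 (l * s) * l * l), l; split; split => //.
- move=> s; apply: cvgM; last exact: cvg_cst.
  by apply: cvgM; [exact: is_derive_cont (db 2 s)|exact: cvg_cst].
- by move=> s; have := besselfE (l * s); nra.
- by rewrite mulr0 bessel0.
- by rewrite mulr1.
- move=> s /andP[s0 s1]; apply: Pl; rewrite mulr_ge0 ?(ltW l0)//=.
  by rewrite -[ltRHS]mulr1 ltr_pM2l.
- move=> a b a0 ab b1; rewrite -lerN2.
  apply: (is_derive_le ab (fun x => is_derive_opp (db 0%N x))).
  move=> x /andP[ax xb]; rewrite -mulNr mulr_ge0 ?(ltW l0)// oppr_ge0.
  have x0 : 0 < x by exact: le_lt_trans ax.
  apply: b1_le0; first exact: mulr_gt0.
  move=> t /andP[t0 tx]; apply: Pl; rewrite (ltW t0)/= (lt_le_trans tx)//.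
  by rewrite -[leRHS]mulr1 ler_pM2l// (le_trans _ b1)// ltW.
Qed.

End bessel.

(** * Picone identity and spectral gap *)

Section slices.
Variable R : realType.
Notation B := (disk R).
Notation mu := (mu2 R).
Notation leb := (@lebesgue_measure R).
Implicit Types k : R * R -> R.

Lemma continuous_sqr (T : topologicalType) (f : T -> R) :
  continuous f -> continuous (fun x => f x ^+ 2).
Proof.
move=> cf; rewrite (_ : (fun x => _) = (fun x => f x * f x)).
  by move=> x; apply: cvgM; exact: cf.
by apply/funext => x; rewrite expr2.
Qed.

Lemma Rintegral_subset_le d (T : measurableType d) (m : {measure set T -> \bar R})
    (A A' : set T) (f : T -> R) : measurable A -> measurable A' -> A `<=` A' ->
  m.-integrable A' (EFin \o f) -> (forall x, 0 <= f x) ->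
  \int[m]_(x in A) f x <= \int[m]_(x in A') f x.
Proof.
move=> mA mA' AA' i f0; apply: fine_le.
- by apply: integrable_fin_num => //; exact: integrableS i.
- exact: integrable_fin_num.
apply: ge0_subset_integral => //; first exact: (measurable_int m).
by move=> x _; rewrite lee_fin.
Qed.

Lemma line_patch (f : R -> R) : (forall s, 1 < `|s| -> f s = 0) ->
  (EFin \o f) \_ `[-1, 1]%classic = EFin \o f.
Proof.
move=> f0; apply/funext => x; rewrite patchE; case: ifPn => //.
rewrite notin_setE /= in_itv/= => /negP h.
by rewrite f0// ltNge; apply: contra h; rewrite ler_norml.
Qed.

Lemma line_integrable (f : R -> R) : continuous f -> (forall s, 1 < `|s| -> f s = 0) ->
  leb.-integrable setT (EFin \o f).
Proof.
move=> cf f0.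
have [H _] := @integrable_mkcond _ _ _ leb `[-1, 1]%classic (EFin \o f) (measurable_itv _).
rewrite -(line_patch f0); apply: H; apply: continuous_compact_integrable.
  exact: segment_compact.
exact: continuous_subspaceT.
Qed.

Lemma slice_integrable (f : R -> R) : continuous f -> (forall s, 1 < `|s| -> f s = 0) ->
  leb.-integrable setT (EFin \o (fun s => f s ^+ 2)).
Proof.
move=> cf f0; apply: line_integrable; last by move=> s /f0 ->; rewrite expr0n.
exact: continuous_sqr.
Qed.

(** Cauchy-Schwarz on [a, b], where the weight is at least m. The integral is then enlarged to the
    whole line, so that it no longer depends on the endpoints. *)
Lemma weighted_path (Z dZ p : R -> R) (a b m : R) : a <= b -> 0 <= m ->
  continuous dZ -> continuous p -> (forall s : R, is_derive s 1 Z (dZ s)) ->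
  (forall s, a <= s <= b -> m <= p s) ->
  (forall s, 1 < `|s| -> p s * dZ s = 0) ->
  m ^+ 2 * (Z b - Z a) ^+ 2 <= (b - a) * \int[leb]_s ((p s * dZ s) ^+ 2).
Proof.
move=> ab m0 cdZ cp HZ pm v0.
have mI : measurable (`[a, b]%classic : set (measurableTypeR R)) by exact: measurable_itv.
have cI (f : R -> R) : continuous f -> leb.-integrable `[a, b]%classic (EFin \o f).
  move=> cf; apply: continuous_compact_integrable; first exact: segment_compact.
  exact: continuous_subspaceT.
have cI2 (f : R -> R) : continuous f -> sqint leb `[a, b]%classic f.
  move=> cf; split; first by apply: measurable_funTS; exact: continuous_measurable_fun.
  by apply: cI; exact: continuous_sqr.
have cpd : continuous (fun s => p s * dZ s) by move=> s; apply: cvgM; [exact: cp|exact: cdZ].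
have c1 : continuous (fun _ : R => 1 : R) by move=> x; exact: cvg_cst.
have -> : Z b - Z a = ip leb `[a, b]%classic (fun=> 1) dZ.
  by rewrite -(FTC2R ab cdZ HZ); apply: eq_Rintegral => x _; rewrite mul1r.
have cs := ip_CauchySchwarz mI (cI2 _ c1) (cI2 _ cdZ).
have E1 : ip leb `[a, b]%classic (fun=> 1) (fun=> 1) = b - a.
  rewrite /ip; under eq_Rintegral do rewrite mul1r.
  exact: (FTC2R ab c1 (fun s => is_derive_id s 1)).
rewrite E1 in cs.
apply: (@le_trans _ _ ((b - a) * (m ^+ 2 * ip leb `[a, b]%classic dZ dZ))).
  by rewrite [leRHS]mulrCA ler_wpM2l ?sqr_ge0.
rewrite ler_wpM2l ?subr_ge0// /ip -RintegralZl//; last first.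
  by apply: cI => x; apply: cvgM; exact: cdZ.
apply: (@le_trans _ _ (\int[leb]_(s in `[a, b]) ((p s * dZ s) ^+ 2))).
  apply: le_Rintegral => //.
  - by apply: cI => x; apply: cvgM; [exact: cvg_cst|apply: cvgM; exact: cdZ].
  - by apply: cI; exact: continuous_sqr.
  - move=> s /= /[!in_itv]/= /pm h; rewrite exprMn -expr2.
    by rewrite ler_wpM2r ?sqr_ge0// lerXn2r// nnegrE// (le_trans m0).
apply: Rintegral_subset_le => //; last by move=> x; exact: sqr_ge0.
exact: slice_integrable.
Qed.

Lemma weighted_path_sym (Z dZ p : R -> R) (a b m : R) : 0 <= m ->
  `|a| <= 1 -> `|b| <= 1 ->
  continuous dZ -> continuous p -> (forall s : R, is_derive s 1 Z (dZ s)) ->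
  (forall s, Num.min a b <= s <= Num.max a b -> m <= p s) ->
  (forall s, 1 < `|s| -> p s * dZ s = 0) ->
  m ^+ 2 * (Z b - Z a) ^+ 2 <= 2 * \int[leb]_s ((p s * dZ s) ^+ 2).
Proof.
move=> m0; wlog ab : a b / a <= b => [W a1 b1 cdZ cp HZ pm v0|].
  have [ab|/ltW ba] := leP a b; first exact: W ab a1 b1 cdZ cp HZ pm v0.
  have := W b a ba b1 a1 cdZ cp HZ; rewrite minC maxC -(sqrrN (Z a - Z b)) opprB.
  by apply.
move=> a1 b1 cdZ cp HZ pm v0.
rewrite (min_idPl ab) (max_idPr ab) in pm.
apply: (le_trans (weighted_path ab m0 cdZ cp HZ pm v0)).
apply: ler_wpM2r; first by apply: Rintegral_ge0 => x _; exact: sqr_ge0.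
by move: a1 b1; rewrite !ler_norml => /andP[? ?] /andP[? ?]; lra.
Qed.

Definition hslice k (t : R) := \int[leb]_s (k (s, t) ^+ 2).
Definition vslice k (s : R) := \int[leb]_t (k (s, t) ^+ 2).

Lemma slice_ge0 k t : 0 <= hslice k t /\ 0 <= vslice k t.
Proof. by split; apply: Rintegral_ge0 => x _; exact: sqr_ge0. Qed.

Section one.
Variables (k : R * R -> R) (r : R).
Hypotheses (ck : continuous k) (r1 : r < 1) (vk : vanish r k).

Let k2 := (fun x : R * R => k x ^+ 2).
Let ck2 : continuous k2. Proof. exact: continuous_sqr. Qed.
Let vk2 : vanish r k2. Proof. by move=> x /vk h; rewrite /k2 h expr0n. Qed.
Let ik2 := (vanish_cont_integrable r1 vk2 ck2).1.
Let Ek2 := (vanish_cont_integrable r1 vk2 ck2).2.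
Let mk2 : measurable_fun setT (EFin \o k2) := measurable_int _ ik2.
Let k20 x : (0 <= (EFin \o k2) x)%E. Proof. by rewrite lee_fin sqr_ge0. Qed.

Let ih t : leb.-integrable setT (EFin \o (fun s => k (s, t) ^+ 2)).
Proof.
apply: slice_integrable; first exact: continuous_slice1.
by move=> s hs; apply: (vanish_sq r1 vk); left.
Qed.

Let iv s : leb.-integrable setT (EFin \o (fun t => k (s, t) ^+ 2)).
Proof.
apply: slice_integrable; first exact: continuous_slice2.
by move=> t hs; apply: (vanish_sq r1 vk); right.
Qed.

Let EFh t : (hslice k t)%:E = fubini_G leb (EFin \o k2) t.
Proof. by rewrite /hslice /Rintegral fineK//; exact: integrable_fin_num (ih t). Qed.

Let EFv s : (vslice k s)%:E = fubini_F leb (EFin \o k2) s.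
Proof. by rewrite /vslice /Rintegral fineK//; exact: integrable_fin_num (iv s). Qed.

Let mh : measurable_fun setT (hslice k).
Proof.
apply/measurable_EFinP; rewrite (_ : EFin \o _ = fubini_G leb (EFin \o k2)).
  exact: measurable_fubini_G ik2.
by apply/funext => t; rewrite -EFh.
Qed.

Let mv : measurable_fun setT (vslice k).
Proof.
apply/measurable_EFinP; rewrite (_ : EFin \o _ = fubini_F leb (EFin \o k2)).
  exact: measurable_fubini_F ik2.
by apply/funext => t; rewrite -EFv.
Qed.

Let lebI : leb `[-1, 1]%classic = 2%:E :> \bar R.
Proof. by rewrite lebesgue_measure_itv/= lte_fin (_ : (-1 < 1 :> R))// -EFinB opprK. Qed.

(** The disk is enlarged to the strip |x.1| <= 1; there the integrand depends on x.2 alone, and the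
    factor 2 is the width of the strip. *)
Lemma hslice_integral : mu.-integrable B (EFin \o (fun x => hslice k x.2)) /\
  \int[mu]_(x in B) hslice k x.2 <= 2 * ip mu B k k.
Proof.
pose f (x : R * R) : \bar R := (\1_(`[-1, 1]%classic) x.1 * hslice k x.2)%:E.
have f0 x : (0 <= f x)%E.
  by rewrite lee_fin mulr_ge0 ?(slice_ge0 k x.2).1.
have m2 : measurable_fun setT (fun x : R * R => hslice k x.2).
  exact: measurableT_comp mh measurable_snd.
have mf : measurable_fun setT f.
  apply/measurable_EFinP; apply: measurable_funM => //.
  by apply: measurableT_comp measurable_fst; exact: measurable_indic.
have If : (\int[mu]_x f x = (2 * ip mu B k k)%:E)%E.
  rewrite (@fubini_tonelli2 _ _ _ _ R leb leb f mf f0).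
  transitivity (\int[leb]_y (2%:E * fubini_G leb (EFin \o k2) y))%E.
    apply: eq_integral => y _; rewrite /fubini_G /f /=.
    under eq_integral do rewrite EFinM.
    rewrite ge0_integralZr//.
    - rewrite integral_indic// setIT; congr (_ * _)%E; [exact: lebI|exact: EFh].
    - by apply/measurable_EFinP; exact: measurable_indic.
    - by rewrite lee_fin (slice_ge0 k y).1.
  rewrite ge0_integralZl//.
  - rewrite -(@fubini_tonelli2 _ _ _ _ R leb leb _ mk2 k20) -Ek2 EFinM; congr (_ * _)%E.
    rewrite /ip /Rintegral fineK.
      by apply: eq_integral => x _; rewrite /k2 expr2.
    apply: integrable_fin_num; first exact: mdisk.
    by apply: L2_mul; exact: continuous_L2.
  - exact: measurable_fubini_G ik2.
  - by move=> y _; apply: integral_ge0.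
have le : (\int[mu]_(x in B) (hslice k x.2)%:E <= (2 * ip mu B k k)%:E)%E.
  rewrite -If [leLHS]integral_mkcond; apply: ge0_le_integral => //.
  - by move=> x _; rewrite patchE; case: ifP => //; rewrite lee_fin (slice_ge0 k x.2).1.
  - apply/(measurable_restrictT _ (@mdisk R)); apply: measurable_funTS.
    exact/measurable_EFinP.
  - move=> x _; rewrite patchE; case: ifPn => // /set_mem /diskE /ltW /disk_itv[h _].
    by rewrite /f indicE mem_set ?mul1r//= in_itv/= -ler_norml.
have i : mu.-integrable B (EFin \o (fun x => hslice k x.2)).
  apply/integrableP; split; first by apply/measurable_EFinP; exact: measurable_funTS.
  under eq_integral do rewrite gee0_abs ?lee_fin ?(slice_ge0 k _).1//.
  by rewrite (le_lt_trans le)// ltry.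
split => //.
by rewrite -lee_fin fineK//; apply: integrable_fin_num => //; exact: mdisk.
Qed.

Lemma vslice_integral : mu.-integrable B (EFin \o (fun x => vslice k x.1)) /\
  \int[mu]_(x in B) vslice k x.1 <= 2 * ip mu B k k.
Proof.
pose f (x : R * R) : \bar R := (\1_(`[-1, 1]%classic) x.2 * vslice k x.1)%:E.
have f0 x : (0 <= f x)%E.
  by rewrite lee_fin mulr_ge0 ?(slice_ge0 k x.1).2.
have m2 : measurable_fun setT (fun x : R * R => vslice k x.1).
  exact: measurableT_comp mv measurable_fst.
have mf : measurable_fun setT f.
  apply/measurable_EFinP; apply: measurable_funM => //.
  by apply: measurableT_comp measurable_snd; exact: measurable_indic.
have If : (\int[mu]_x f x = (2 * ip mu B k k)%:E)%E.
  rewrite (@fubini_tonelli1 _ _ _ _ R leb leb f mf f0).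
  transitivity (\int[leb]_y (2%:E * fubini_F leb (EFin \o k2) y))%E.
    apply: eq_integral => y _; rewrite /fubini_F /f /=.
    under eq_integral do rewrite EFinM.
    rewrite ge0_integralZr//.
    - rewrite integral_indic// setIT; congr (_ * _)%E; [exact: lebI|exact: EFv].
    - by apply/measurable_EFinP; exact: measurable_indic.
    - by rewrite lee_fin (slice_ge0 k y).2.
  rewrite ge0_integralZl//.
  - rewrite -(@fubini_tonelli1 _ _ _ _ R leb leb _ mk2 k20) -Ek2 EFinM; congr (_ * _)%E.
    rewrite /ip /Rintegral fineK.
      by apply: eq_integral => x _; rewrite /k2 expr2.
    apply: integrable_fin_num; first exact: mdisk.
    by apply: L2_mul; exact: continuous_L2.
  - exact: measurable_fubini_F ik2.
  - by move=> y _; apply: integral_ge0.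
have le : (\int[mu]_(x in B) (vslice k x.1)%:E <= (2 * ip mu B k k)%:E)%E.
  rewrite -If [leLHS]integral_mkcond; apply: ge0_le_integral => //.
  - by move=> x _; rewrite patchE; case: ifP => //; rewrite lee_fin (slice_ge0 k x.1).2.
  - apply/(measurable_restrictT _ (@mdisk R)); apply: measurable_funTS.
    exact/measurable_EFinP.
  - move=> x _; rewrite patchE; case: ifPn => // /set_mem /diskE /ltW /disk_itv[_ h].
    by rewrite /f indicE mem_set ?mul1r//= in_itv/= -ler_norml.
have i : mu.-integrable B (EFin \o (fun x => vslice k x.1)).
  apply/integrableP; split; first by apply/measurable_EFinP; exact: measurable_funTS.
  under eq_integral do rewrite gee0_abs ?lee_fin ?(slice_ge0 k _).2//.
  by rewrite (le_lt_trans le)// ltry.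
split => //.
by rewrite -lee_fin fineK//; apply: integrable_fin_num => //; exact: mdisk.
Qed.

End one.
End slices.

Section plane_integrals.
Variable R : realType.
Notation B := (disk R).
Notation mu := (mu2 R).
Implicit Types f g : R * R -> R.

Lemma diskI_D f g : mu.-integrable B (EFin \o f) -> mu.-integrable B (EFin \o g) ->
  \int[mu]_(x in B) (f x + g x) = \int[mu]_(x in B) f x + \int[mu]_(x in B) g x.
Proof. exact: (@RintegralD _ _ R mu B f g (@mdisk R)). Qed.

Lemma diskI_Z (c : R) f : mu.-integrable B (EFin \o f) ->
  \int[mu]_(x in B) (c * f x) = c * \int[mu]_(x in B) f x.
Proof. exact: (@RintegralZl _ _ R mu B f c (@mdisk R)). Qed.

Lemma diskI_le f g : mu.-integrable B (EFin \o f) -> mu.-integrable B (EFin \o g) ->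
  (forall x, B x -> f x <= g x) ->
  \int[mu]_(x in B) f x <= \int[mu]_(x in B) g x.
Proof. exact: (@le_Rintegral _ _ R mu B f g (@mdisk R)). Qed.

Lemma disk_intD f g : mu.-integrable B (EFin \o f) -> mu.-integrable B (EFin \o g) ->
  mu.-integrable B (EFin \o (fun x => f x + g x)).
Proof. exact: (@integrableDR _ _ R mu B (@mdisk R) f g). Qed.

Lemma disk_intZ (c : R) f : mu.-integrable B (EFin \o f) ->
  mu.-integrable B (EFin \o (fun x => c * f x)).
Proof. exact: (@integrableZR _ _ R mu B (@mdisk R) c f). Qed.

End plane_integrals.

(** * Picone identity and gap inequality for test functions *)

Section picone.
Variable R : realType.
Notation B := (disk R).
Notation mu := (mu2 R).
Notation ipB := (ip mu B).

Variables (F F1 F2 : R -> R) (l : R).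
Hypotheses (dF : forall s : R, is_derive s 1 F (F1 s))
  (dF1 : forall s : R, is_derive s 1 F1 (F2 s)) (cF2 : continuous F2).
Hypotheses (l0 : 0 < l) (FE : forall s, s * F2 s + F1 s = - l * F s).
Hypotheses (F_0 : F 0 = 1) (F_1 : F 1 = 0) (F_gt0 : forall s, 0 <= s < 1 -> 0 < F s)
  (F_nincr : forall a b, 0 <= a -> a <= b -> b <= 1 -> F b <= F a).

Definition psi (x : R * R) := F (sq x).
(** Later also used with a merely measurable f in place of [F1]: it is then the weak derivative of
    the radial function with primitive [prim f]. *)
Definition psi1 (x : R * R) := F1 (sq x) * (2 * x.1).
Definition psi2 (x : R * R) := F1 (sq x) * (2 * x.2).
Definition psi11 (x : R * R) := F2 (sq x) * (2 * x.1) * (2 * x.1) + F1 (sq x) * 2.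
Definition psi22 (x : R * R) := F2 (sq x) * (2 * x.2) * (2 * x.2) + F1 (sq x) * 2.

Let cF1 : continuous F1. Proof. by move=> s; exact: is_derive_cont (dF1 s). Qed.
Let cF : continuous F. Proof. by move=> s; exact: is_derive_cont (dF s). Qed.

Lemma psi_derive1 x : is_derive x (e1 R) psi (psi1 x).
Proof. exact: (is_derive_compR (dF (sq x)) (is_derive_sq1 x)). Qed.

Lemma psi_derive2 x : is_derive x (e2 R) psi (psi2 x).
Proof. exact: (is_derive_compR (dF (sq x)) (is_derive_sq2 x)). Qed.

Lemma psi1_derive x : is_derive x (e1 R) psi1 (psi11 x).
Proof.
apply: (is_derive_eq (is_derive_mul (is_derive_compR (dF1 (sq x)) (is_derive_sq1 x))
  (is_derive_scal 2 (is_derive_fst1 x)))).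
by rewrite mulr1.
Qed.

Lemma psi2_derive x : is_derive x (e2 R) psi2 (psi22 x).
Proof.
apply: (is_derive_eq (is_derive_mul (is_derive_compR (dF1 (sq x)) (is_derive_sq2 x))
  (is_derive_scal 2 (is_derive_snd2 x)))).
by rewrite mulr1.
Qed.

Let csq (G : R -> R) : continuous G -> continuous (fun x : R * R => G (sq x)).
Proof.
move=> cG x; apply: (@continuous_comp _ _ _ (@sq R) G); last exact: cG.
exact: continuous_sq.
Qed.
Let cM (f g : R * R -> R) : continuous f -> continuous g -> continuous (fun x => f x * g x).
Proof. by move=> cf cg x; apply: cvgM; [exact: cf|exact: cg]. Qed.
Let cA (f g : R * R -> R) : continuous f -> continuous g -> continuous (fun x => f x + g x).
Proof. by move=> cf cg x; apply: cvgD; [exact: cf|exact: cg]. Qed.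
Let cC (c : R) : continuous (fun _ : R * R => c). Proof. by move=> x; exact: cvg_cst. Qed.
Let c_1 : continuous (@fst R R). Proof. by move=> x; exact: cvg_fst. Qed.
Let c_2 : continuous (@snd R R). Proof. by move=> x; exact: cvg_snd. Qed.

Lemma psi_continuous : continuous psi. Proof. exact: csq. Qed.
Lemma psi1_continuous : continuous psi1.
Proof. exact (cM (csq cF1) (cM (@cC 2) c_1)). Qed.
Lemma psi2_continuous : continuous psi2.
Proof. exact (cM (csq cF1) (cM (@cC 2) c_2)). Qed.
Lemma psi11_continuous : continuous psi11.
Proof.
exact (cA (cM (cM (csq cF2) (cM (@cC 2) c_1)) (cM (@cC 2) c_1)) (cM (csq cF1) (@cC 2))).
Qed.
Lemma psi22_continuous : continuous psi22.
Proof.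
exact (cA (cM (cM (csq cF2) (cM (@cC 2) c_2)) (cM (@cC 2) c_2)) (cM (csq cF1) (@cC 2))).
Qed.

(** The Laplacian of F(|x|^2) is 4 (s F'' + F') at s = |x|^2, hence the eigenvalue 4 l. *)
Lemma psi_laplacian x : psi11 x + psi22 x = - (4 * l) * psi x.
Proof.
have E := FE (sq x); rewrite /psi11 /psi22 /psi.
transitivity (4 * (sq x * F2 (sq x) + F1 (sq x))); last by rewrite E; ring.
by move: (F2 (sq x)) (F1 (sq x)) => a b; rewrite /sq; ring.
Qed.

Lemma psi_gt0 x : B x -> 0 < psi x.
Proof. by move=> /diskE h; apply: F_gt0; rewrite sq_ge0. Qed.

Lemma psi_le1 x : B x -> psi x <= 1.
Proof. by move=> /diskE h; rewrite -F_0; apply: F_nincr; rewrite ?sq_ge0// ltW. Qed.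

Section test.
Variables (w : R * R -> R) (tw : test_function w) (r : R) (r1 : r < 1) (vw : vanish r w).

Let w1 := 'D_(e1 R) w.
Let w2 := 'D_(e2 R) w.
Let cw := test_continuous tw.
Let cw1 : continuous w1 := test_continuous1 tw.
Let cw2 : continuous w2 := test_continuous2 tw.
Let dw1 x : is_derive x (e1 R) w (w1 x) := test_derive1 x tw.
Let dw2 x : is_derive x (e2 R) w (w2 x) := test_derive2 x tw.
Let vw1 : vanish r w1. Proof. by move=> x rx; exact: vanish_derive vw rx (dw1 x). Qed.
Let vw2 : vanish r w2. Proof. by move=> x rx; exact: vanish_derive vw rx (dw2 x). Qed.

Let out_nbhs x : 1 <= sq x -> \forall y \near x, r < sq y.
Proof.
move=> x1; have o : open [set y : R * R | r < sq y].
  by move/continuousP: (@continuous_sq R) => /(_ _ (@open_gt _ r)).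
by apply: (open_nbhs_nbhs (conj o _)) => /=; exact: lt_le_trans x1.
Qed.

(** Ground state substitution w = z psi. Since w vanishes for |x|^2 > r with r < 1, the quotient and
    its gradient are continuous on the whole plane, although psi vanishes on the boundary circle. *)
Let z x := w x / psi x.
Let z1 x := (w1 x - z x * psi1 x) / psi x.
Let z2 x := (w2 x - z x * psi2 x) / psi x.

Let vz : vanish r z. Proof. by move=> x rx; rewrite /z vw ?mul0r. Qed.
Let vz1 : vanish r z1. Proof. by move=> x rx; rewrite /z1 vz// vw1// mul0r subr0 mul0r. Qed.
Let vz2 : vanish r z2. Proof. by move=> x rx; rewrite /z2 vz// vw2// mul0r subr0 mul0r. Qed.

Let quot_continuous (a : R * R -> R) : (forall x, B x -> {for x, continuous a}) ->
  vanish r a -> continuous (fun x => a x / psi x).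
Proof.
move=> ca va x; have [x1|x1] := leP 1 (sq x); last first.
  have Bx : B x by apply/diskE.
  apply: cvgM; first exact: ca.
  by apply: cvgV; [rewrite gt_eqF// psi_gt0|exact: psi_continuous].
rewrite /continuous_at va ?mul0r; last exact: lt_le_trans x1.
apply: cvg_near_cst; apply: filterS (out_nbhs x1) => y ry.
by rewrite va ?mul0r.
Qed.

Let cz : continuous z. Proof. by apply: quot_continuous => // x _; exact: cw. Qed.
Let cz1 : continuous z1.
Proof.
apply: quot_continuous => [x _|x rx]; last by rewrite vw1// vz// mul0r subr0.
by apply: cvgB; [exact: cw1|apply: cvgM; [exact: cz|exact: psi1_continuous]].
Qed.
Let cz2 : continuous z2.
Proof.
apply: quot_continuous => [x _|x rx]; last by rewrite vw2// vz// mul0r subr0.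
by apply: cvgB; [exact: cw2|apply: cvgM; [exact: cz|exact: psi2_continuous]].
Qed.

Let dz v psiv wv : (forall x, is_derive x v psi (psiv x)) ->
  (forall x, is_derive x v w (wv x)) -> vanish r wv ->
  forall x, is_derive x v z ((wv x - z x * psiv x) / psi x).
Proof.
move=> dp dwv vwv x; have [x1|x1] := leP 1 (sq x); last first.
  have p0 : psi x != 0 by rewrite gt_eqF// psi_gt0//; apply/diskE.
  have dVp : is_derive x v (fun y => (psi y)^-1) (- (psi x) ^- 2 * psiv x).
    have dinv : is_derive (psi x) 1 (fun y : R => y^-1) (- (psi x) ^- 2).
      by have := is_deriveV p0 (is_derive_id (psi x) 1); rewrite [_ *: _]mulr1.
    exact: (is_derive_compR dinv (dp x)).
  apply: (is_derive_eq (is_derive_mul (dwv x) dVp)).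
  by rewrite /z; field.
have rx : r < sq x by exact: lt_le_trans x1.
rewrite vwv// vz// mul0r subr0 mul0r.
apply: (near_eq_is_derive _ (is_derive_const 0 x v)).
by apply: filterS (out_nbhs x1) => y ry; rewrite vz.
Qed.

Let dz1 x : is_derive x (e1 R) z (z1 x) := dz psi_derive1 dw1 vw1 x.
Let dz2 x : is_derive x (e2 R) z (z2 x) := dz psi_derive2 dw2 vw2 x.

Let k1 x := psi x * z1 x.
Let k2 x := psi x * z2 x.
Let ck1 : continuous k1 := cM psi_continuous cz1.
Let ck2 : continuous k2 := cM psi_continuous cz2.
Let vk1 : vanish r k1. Proof. by move=> x rx; rewrite /k1 vz1// mulr0. Qed.
Let vk2 : vanish r k2. Proof. by move=> x rx; rewrite /k2 vz2// mulr0. Qed.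

Let wE x : B x -> w x = z x * psi x.
Proof. by move=> Bx; rewrite /z divfK// gt_eqF// psi_gt0. Qed.
Let w1E x : B x -> w1 x = psi x * z1 x + z x * psi1 x.
Proof. by move=> Bx; rewrite /z1 mulrC divfK ?subrK// gt_eqF// psi_gt0. Qed.
Let w2E x : B x -> w2 x = psi x * z2 x + z x * psi2 x.
Proof. by move=> Bx; rewrite /z2 mulrC divfK ?subrK// gt_eqF// psi_gt0. Qed.

(** With [g2], the two terms of the divergence of the Picone field z w grad psi = (w^2 / psi) grad
    psi. *)
Let g1 x := (z1 x * w x + z x * w1 x) * psi1 x + z x * w x * psi11 x.
Let g2 x := (z2 x * w x + z x * w2 x) * psi2 x + z x * w x * psi22 x.

Let ig1 : \int[mu]_(x in B) g1 x = 0.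
Proof.
apply: (@int_deriv1 _ r (fun x => z x * w x * psi1 x)) => //.
- by move=> x rx; rewrite vw ?mulr0 ?mul0r.
- exact (cA (cM (cA (cM cz1 cw) (cM cz cw1)) psi1_continuous) (cM (cM cz cw) psi11_continuous)).
- by move=> x; exact: (is_derive_mul (is_derive_mul (dz1 x) (dw1 x)) (psi1_derive x)).
Qed.

Let ig2 : \int[mu]_(x in B) g2 x = 0.
Proof.
apply: (@int_deriv2 _ r (fun x => z x * w x * psi2 x)) => //.
- by move=> x rx; rewrite vw ?mulr0 ?mul0r.
- exact (cA (cM (cA (cM cz2 cw) (cM cz cw2)) psi2_continuous) (cM (cM cz cw) psi22_continuous)).
- by move=> x; exact: (is_derive_mul (is_derive_mul (dz2 x) (dw2 x)) (psi2_derive x)).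
Qed.

Let cint (f : R * R -> R) : continuous f -> mu.-integrable B (EFin \o f).
Proof.
move=> cf; apply: bounded_integrable2; last exact: continuous_bounded_disk.
by apply: continuous_measurable2 => //; exact: mdisk.
Qed.

(** Pointwise, |grad w|^2 - 4 l w^2 = psi^2 |grad z|^2 + div (z w grad psi), and the divergence
    integrates to 0. *)
Lemma picone : ipB w1 w1 + ipB w2 w2 - 4 * l * ipB w w = ipB k1 k1 + ipB k2 k2.
Proof.
have cg1 : continuous g1.
  exact (cA (cM (cA (cM cz1 cw) (cM cz cw1)) psi1_continuous) (cM (cM cz cw) psi11_continuous)).
have cg2 : continuous g2.
  exact (cA (cM (cA (cM cz2 cw) (cM cz cw2)) psi2_continuous) (cM (cM cz cw) psi22_continuous)).
have E : \int[mu]_(x in B) (w1 x * w1 x + w2 x * w2 x) =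
  \int[mu]_(x in B) ((4 * l) * (w x * w x) + ((k1 x * k1 x + k2 x * k2 x) + (g1 x + g2 x))).
  apply: eq_Rintegral => x /set_mem Bx.
  rewrite /g1 /g2 w1E// w2E// wE// /k1 /k2.
  have := psi_laplacian x => L.
  have -> : psi22 x = - (4 * l) * psi x - psi11 x by rewrite -L; ring.
  ring.
have i1 := cint (cM cw1 cw1); have i2 := cint (cM cw2 cw2).
have iw := cint (cM cw cw).
have ik1 := cint (cM ck1 ck1); have ik2 := cint (cM ck2 ck2).
have jg1 := cint cg1; have jg2 := cint cg2.
rewrite (diskI_D i1 i2) (diskI_D (disk_intZ (4 * l) iw)
  (disk_intD (disk_intD ik1 ik2) (disk_intD jg1 jg2))) (diskI_Z (4 * l) iw)
  (diskI_D (disk_intD ik1 ik2) (disk_intD jg1 jg2)) (diskI_D ik1 ik2)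
  (diskI_D jg1 jg2) ig1 ig2 in E.
by rewrite /ip E; ring.
Qed.

Let H := hslice k1.
Let V := vslice k2.

(** Along the horizontal segment from (c, x.2) to x every point is at most as far from the origin as
    x, so psi is at least psi x there. *)
Let path1 x (c : R) : B x -> `|c| <= `|x.1| ->
  psi x ^+ 2 * (z x - z (c, x.2)) ^+ 2 <= 2 * H x.2.
Proof.
move=> Bx cx; have /diskE /ltW sx := Bx; have [h1 h2] := disk_itv sx.
have := @weighted_path_sym R (fun s => z (s, x.2)) (fun s => z1 (s, x.2))
  (fun s => psi (s, x.2)) c x.1 (psi x).
case: x Bx cx sx h1 h2 => a b /= Bx cx sx h1 h2; apply.
- exact: ltW (psi_gt0 Bx).
- exact: le_trans h1.
- by [].
- exact: continuous_slice1.
- exact: (continuous_slice1 psi_continuous).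
- by move=> s; exact: (is_derive_e1 _ (s, b) _).1 (dz1 (s, b)).
- move=> s hs; apply: F_nincr => //; first exact: sq_ge0.
  rewrite /sq/= lerD2r -(real_normK (num_real s)) -(real_normK (num_real a)).
  rewrite lerXn2r ?nnegrE//; move: cx hs; rewrite !ler_norml ge_min le_max.
  have := ler_norm a; have := ler_normr (- a) a; have := ler_norm (- a); rewrite normrN.
  move=> A1 _ A2 /andP[A3 A4] /andP[/orP[A5|A5] /orP[A6|A6]]; apply/andP; split; lra.
- by move=> s hs; apply: (vanish_sq r1 vk1); left.
Qed.

(* Two points are joined by a path with one corner, along which [psi] is at least
   [psi x * psi y] because it is radially decreasing and at most 1. *)
Let path2 x y : B x -> B y -> `|y.1| <= `|x.1| ->
  (psi x * psi y) ^+ 2 * (z (y.1, x.2) - z y) ^+ 2 <= 2 * V y.1.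
Proof.
move=> Bx By yx; have /diskE /ltW sx := Bx; have [x1 x2] := disk_itv sx.
have /diskE /ltW sy := By; have [y1 y2] := disk_itv sy.
have px := psi_gt0 Bx; have py := psi_gt0 By.
have px1 := psi_le1 Bx; have py1 := psi_le1 By.
have := @weighted_path_sym R (fun s => z (y.1, s)) (fun s => z2 (y.1, s))
  (fun s => psi (y.1, s)) y.2 x.2 (psi x * psi y).
case: x y Bx By yx sx x1 x2 sy y1 y2 px py px1 py1 => a b [c e] /=
  Bx By yx sx x1 x2 sy y1 y2 px py px1 py1; apply => //.
- by rewrite mulr_ge0 ?ltW.
- exact: continuous_slice2.
- exact: (continuous_slice2 psi_continuous).
- by move=> s; exact: (is_derive_e2 _ (c, s) _).1 (dz2 (c, s)).
- move=> s hs.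
  have c2 : c ^+ 2 <= a ^+ 2.
    rewrite -(real_normK (num_real c)) -(real_normK (num_real a)).
    by rewrite lerXn2r ?nnegrE.
  (* A number between two others is at most as large in modulus as one of them; the point (c, s) is
     thus no farther from the origin than x or than y. *)
  have [h|h] : s ^+ 2 <= b ^+ 2 \/ s ^+ 2 <= e ^+ 2.
    move: hs; rewrite ge_min le_max => /andP[/orP[A1|A1] /orP[A2|A2]].
    + by right; have -> : s = e; [lra|].
    + have [s0|s0] := leP 0 s; [left|right]; nra.
    + have [s0|s0] := leP 0 s; [right|left]; nra.
    + by left; have -> : s = b; [lra|].
  + apply: (@le_trans _ _ (psi (a, b))); first by rewrite ler_piMr// ltW.
    by apply: F_nincr => //; [exact: sq_ge0|rewrite /sq/= lerD].
  + apply: (@le_trans _ _ (psi (c, e))); first by rewrite ler_piMl// ltW.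
    by apply: F_nincr => //; [exact: sq_ge0|rewrite /sq/= lerD2l].
- by move=> s hs; apply: (vanish_sq r1 vk2); right.
Qed.

(** The left-hand side is (psi x psi y (z x - z y))^2, and the path from x to y turns at (y.1, x.2).
    The constant 4 comes from (A + C)^2 <= 2 A^2 + 2 C^2 and the factor 2 of each leg. *)
Let half x y : B x -> B y -> `|y.1| <= `|x.1| ->
  (w x * psi y - w y * psi x) ^+ 2 <= 4 * (H x.2 + V y.1).
Proof.
move=> Bx By yx; have p1 := path1 Bx yx; have p2 := path2 Bx By yx.
have px := psi_gt0 Bx; have py := psi_gt0 By.
have px1 := psi_le1 Bx; have py1 := psi_le1 By.
rewrite (wE Bx) (wE By).
have -> : z x * psi x * psi y - z y * psi y * psi x =
  psi x * psi y * ((z x - z (y.1, x.2)) + (z (y.1, x.2) - z y)) by ring.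
set A := z x - _ in p1 *; set C := _ - z y in p2 *.
have p1' : (psi x * psi y) ^+ 2 * A ^+ 2 <= 2 * H x.2.
  apply: le_trans p1; rewrite ler_wpM2r ?sqr_ge0// exprMn ler_piMr ?sqr_ge0//.
  by rewrite expr_le1// ltW.
have := sqr_ge0 (psi x * psi y * (A - C)); nra.
Qed.

(** Exchanging x and y removes the condition on the first coordinates; the sum on the right bounds
    both orders. *)
Let full x y : B x -> B y ->
  (w x * psi y - w y * psi x) ^+ 2 <= 4 * (H x.2 + V x.1 + (H y.2 + V y.1)).
Proof.
move=> Bx By.
have H0 t : 0 <= H t := (slice_ge0 k1 t).1; have V0 t : 0 <= V t := (slice_ge0 k2 t).2.
have := H0 x.2; have := H0 y.2; have := V0 x.1; have := V0 y.1.
have [yx|/ltW xy] := leP `|y.1| `|x.1|; first by have := half Bx By yx; lra.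
have := half By Bx xy; rewrite -sqrrN opprB; lra.
Qed.

Let iH := (hslice_integral ck1 r1 vk1).1.
Let iV := (vslice_integral ck2 r1 vk2).1.
Let A := fine (mu B).

(** Integrate [full] over y and then over x: the left side becomes twice the Gram determinant of w
    and psi, the right side 8 A S, where S is at most 2 (|k1|^2 + |k2|^2) by the slice estimates.
    The Picone identity evaluates that sum. *)
Lemma gap_test : ipB w w * ipB psi psi - ipB w psi ^+ 2 <=
  8 * A * (ipB w1 w1 + ipB w2 w2 - 4 * l * ipB w w).
Proof.
rewrite picone.
pose S := \int[mu]_(x in B) H x.2 + \int[mu]_(x in B) V x.1.
have iHV := disk_intD iH iV.
have SE : \int[mu]_(x in B) (H x.2 + V x.1) = S := diskI_D iH iV.
have ic (c : R) : mu.-integrable B (EFin \o (fun _ : R * R => c)) by apply: cint.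
have intc (c : R) : \int[mu]_(x in B) c = c * A.
  exact: (@Rintegral_cst _ _ R mu B (@mdisk R)).
have cp := psi_continuous.
have iww := cint (cM cw cw); have iwp := cint (cM cw cp); have ipp := cint (cM cp cp).
(* Integration in y with x fixed; the slice integrals at x are constants there. *)
have step x : B x ->
    w x ^+ 2 * ipB psi psi - 2 * (w x * psi x) * ipB w psi + psi x ^+ 2 * ipB w w <=
    4 * ((H x.2 + V x.1) * A + S).
  move=> Bx.
  have iZ1 := disk_intZ (w x ^+ 2) ipp; have iZ2 := disk_intZ (- (2 * (w x * psi x))) iwp.
  have iZ3 := disk_intZ (psi x ^+ 2) iww; have ic' := ic (H x.2 + V x.1).
  have := diskI_le (disk_intD iZ1 (disk_intD iZ2 iZ3)) (disk_intZ 4 (disk_intD ic' iHV)).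
  rewrite (diskI_D iZ1 (disk_intD iZ2 iZ3)) (diskI_D iZ2 iZ3) (diskI_Z _ ipp)
    (diskI_Z _ iwp) (diskI_Z _ iww) (diskI_Z 4 (disk_intD ic' iHV)) (diskI_D ic' iHV)
    intc SE => K.
  rewrite /ip; apply: le_trans (K _); first by rewrite le_eqVlt; apply/orP; left; apply/eqP; ring.
  move=> y By; apply: le_trans (full Bx By).
  by rewrite le_eqVlt; apply/orP; left; apply/eqP; ring.
(* Integration in x. The two integrations are done one after the other, so no product of two disks
   is formed. *)
have fin : 2 * (ipB w w * ipB psi psi - ipB w psi ^+ 2) <= 8 * (S * A).
  have iZ1 := disk_intZ (ipB psi psi) iww; have iZ2 := disk_intZ (- (2 * ipB w psi)) iwp.
  have iZ3 := disk_intZ (ipB w w) ipp; have ic' := ic S.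
  have iZ4 := disk_intZ A iHV.
  have := diskI_le (disk_intD iZ1 (disk_intD iZ2 iZ3)) (disk_intZ 4 (disk_intD iZ4 ic')).
  rewrite (diskI_D iZ1 (disk_intD iZ2 iZ3)) (diskI_D iZ2 iZ3) (diskI_Z _ ipp)
    (diskI_Z _ iwp) (diskI_Z _ iww) (diskI_Z 4 (disk_intD iZ4 ic')) (diskI_D iZ4 ic')
    (diskI_Z A iHV) intc SE => K.
  have pt x : B x -> ipB psi psi * (w x * w x) + (- (2 * ipB w psi) * (w x * psi x) +
      ipB w w * (psi x * psi x)) <= 4 * (A * (H x.2 + V x.1) + S).
    move=> Bx; have := step x Bx; move: (ipB psi psi) (ipB w psi) (ipB w w) => p q t.
    by rewrite [A * _]mulrC; apply: le_trans; rewrite le_eqVlt; apply/orP; left; apply/eqP; ring.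
  have {}K := K pt.
  apply: (@le_trans _ _ (4 * (A * S + S * A))); last first.
    by rewrite le_eqVlt; apply/orP; left; apply/eqP; ring.
  by apply: le_trans K; rewrite le_eqVlt; apply/orP; left; apply/eqP; rewrite /ip; ring.
have A0 : 0 <= A by exact: fine_ge0.
have hH := (hslice_integral ck1 r1 vk1).2; have hV := (vslice_integral ck2 r1 vk2).2.
rewrite -/H in hH; rewrite -/V in hV.
have SA : S * A <= 2 * (ipB k1 k1 + ipB k2 k2) * A.
  by rewrite ler_wpM2r// /S mulrDr; exact: lerD hH hV.
rewrite -(ler_pM2l (ltr0n R 2)) (le_trans fin)//.
rewrite (_ : 2 * (8 * A * _) = 8 * (2 * (ipB k1 k1 + ipB k2 k2) * A)); last by ring.
by rewrite ler_pM2l.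
Qed.

End test.

End picone.

Section gap.
Variable R : realType.
Notation B := (disk R).
Notation mu := (mu2 R).
Notation ipB := (ip mu B).

Variables (F F1 F2 : R -> R) (l : R).
Hypotheses (dF : forall s : R, is_derive s 1 F (F1 s))
  (dF1 : forall s : R, is_derive s 1 F1 (F2 s)) (cF2 : continuous F2).
Hypotheses (l0 : 0 < l) (FE : forall s, s * F2 s + F1 s = - l * F s).
Hypotheses (F_0 : F 0 = 1) (F_gt0 : forall s, 0 <= s < 1 -> 0 < F s)
  (F_nincr : forall a b, 0 <= a -> a <= b -> b <= 1 -> F b <= F a).

Let cp : continuous (psi F) := psi_continuous dF.
Let cp1 : continuous (psi1 F1) := psi1_continuous dF1.
Let cp2 : continuous (psi2 F1) := psi2_continuous dF1.
Let sp := continuous_L2 cp.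
Let sp1 := continuous_L2 cp1.
Let sp2 := continuous_L2 cp2.

Lemma psi_eigen_test w : test_function w ->
  ipB ('D_(e1 R) w) (psi1 F1) + ipB ('D_(e2 R) w) (psi2 F1) = 4 * l * ipB w (psi F).
Proof.
move=> tw; have [r r1 vw] := test_vanish tw.
have sw := test_L2 tw; have sw1 := test_L21 tw; have sw2 := test_L22 tw.
have E1 := int_by_parts1 tw (psi1_continuous dF1) (psi11_continuous dF1 cF2) (psi1_derive dF1).
have E2 := int_by_parts2 tw (psi2_continuous dF1) (psi22_continuous dF1 cF2) (psi2_derive dF1).
rewrite [X in X + _]ipC [X in _ + X]ipC E1 E2 -opprD.
have s11 := continuous_L2 (psi11_continuous dF1 cF2).
have s22 := continuous_L2 (psi22_continuous dF1 cF2).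
rewrite -[X in - X](diskI_D (L2_mul s11 sw) (L2_mul s22 sw)).
rewrite -(diskI_Z (4 * l) (L2_mul sw sp)).
rewrite -mulN1r -(diskI_Z (-1) (disk_intD (L2_mul s11 sw) (L2_mul s22 sw))).
apply: eq_Rintegral => x _; rewrite -mulrDl (psi_laplacian FE); ring.
Qed.

(** The weak eigenvalue equation of psi. The boundary condition is carried by u, as a limit of test
    functions. *)
Lemma psi_eigen u g1 g2 : H10g u g1 g2 ->
  ipB g1 (psi1 F1) + ipB g2 (psi2 F1) = 4 * l * ipB u (psi F).
Proof.
move=> [su s1 s2 [phi [tp cu c1 c2]]].
have mB := @mdisk R.
have a1 := @ip_cvgl _ _ R mu B mB g1 _ (fun n => 'D_(e1 R) (phi n)) s1 sp1
  (fun n => test_L21 (tp n)) c1.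
have a2 := @ip_cvgl _ _ R mu B mB g2 _ (fun n => 'D_(e2 R) (phi n)) s2 sp2
  (fun n => test_L22 (tp n)) c2.
have a := @ip_cvgl _ _ R mu B mB u _ phi su sp (fun n => test_L2 (tp n)) cu.
have b : ipB ('D_(e1 R) (phi n)) (psi1 F1) + ipB ('D_(e2 R) (phi n)) (psi2 F1)
    @[n --> \oo] --> ipB g1 (psi1 F1) + ipB g2 (psi2 F1) by exact: cvgD a1 a2.
rewrite (funext (fun n => psi_eigen_test (tp n))) in b.
apply: (cvg_unique _ b (cvgM (cvg_cst (4 * l)) a)); exact: Rhausdorff.
Qed.

Lemma gap u g1 g2 : H10g u g1 g2 ->
  ipB u u * ipB (psi F) (psi F) - ipB u (psi F) ^+ 2 <=
  8 * fine (mu B) * (ipB g1 g1 + ipB g2 g2 - 4 * l * ipB u u).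
Proof.
move=> [su s1 s2 [phi [tp cu c1 c2]]].
have mB := @mdisk R.
have tl n := test_L2 (tp n).
have a := @ip_cvgl _ _ R mu B mB u _ phi su sp tl cu.
have b := @ip_cvg _ _ R mu B mB u u phi phi su su tl tl cu cu.
have b1 := @ip_cvg _ _ R mu B mB g1 g1 (fun n => 'D_(e1 R) (phi n))
  (fun n => 'D_(e1 R) (phi n)) s1 s1 (fun n => test_L21 (tp n)) (fun n => test_L21 (tp n)) c1 c1.
have b2 := @ip_cvg _ _ R mu B mB g2 g2 (fun n => 'D_(e2 R) (phi n))
  (fun n => 'D_(e2 R) (phi n)) s2 s2 (fun n => test_L22 (tp n)) (fun n => test_L22 (tp n)) c2 c2.
have L : ipB (phi n) (phi n) * ipB (psi F) (psi F) - ipB (phi n) (psi F) * ipB (phi n) (psi F)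
    @[n --> \oo] --> ipB u u * ipB (psi F) (psi F) - ipB u (psi F) * ipB u (psi F).
  exact: cvgB (cvgM b (cvg_cst (ipB (psi F) (psi F)))) (cvgM a a).
have RR : 8 * fine (mu B) * (ipB ('D_(e1 R) (phi n)) ('D_(e1 R) (phi n)) +
    ipB ('D_(e2 R) (phi n)) ('D_(e2 R) (phi n)) - 4 * l * ipB (phi n) (phi n))
    @[n --> \oo] --> 8 * fine (mu B) * (ipB g1 g1 + ipB g2 g2 - 4 * l * ipB u u).
  exact: cvgM (cvg_cst (8 * fine (mu B))) (cvgB (cvgD b1 b2) (cvgM (cvg_cst (4 * l)) b)).
rewrite expr2; apply: ler_cvg_to L RR _.
apply: nearW => n /=; have [r r1 vw] := test_vanish (tp n).
have := gap_test dF dF1 cF2 FE F_0 F_gt0 F_nincr (tp n) r1 vw.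
by rewrite expr2.
Qed.

End gap.

(** * Polar coordinates and power substitutions *)

Section restr.
Context d (T : measurableType d) (R : realType).
Variables (M : {measure set T -> \bar R}) (D : set T) (mD : measurable D).

Lemma integral_mrestr (f : T -> \bar R) : measurable_fun setT f -> (forall x, 0 <= f x)%E ->
  (\int[mrestr M mD]_x f x = \int[M]_(x in D) f x)%E.
Proof.
move=> mf f0.
rewrite (@ge0_negligible_integral _ _ _ (mrestr M mD) setT (~` D))//.
- rewrite setTD setCK; apply: eq_measure_integral => A mA AD.
  by have E : M (A `&` D) = M A; [rewrite setIidl|].
- exact: measurableC.
- by have E : M (~` D `&` D) = 0%E; [rewrite setICl measure0|].
Qed.

End restr.

Section cdf.
Context d (T : measurableType d) (R : realType).
Variables (M : {measure set T -> \bar R}) (D : set T) (mD : measurable D).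
Variables (h : T -> R) (mh : measurable_fun setT h) (k : {nonneg R}).
Notation leb := (@lebesgue_measure R).
Notation I01 := (`]0, 1[%classic : set R).

Hypothesis hcdf : forall a, M (D `&` h @^-1` `]-oo, a[%classic) =
  (k%:num * Num.max 0 (Num.min a 1))%:E.

Let mI : measurable (I01 : set (measurableTypeR R)) := measurable_itv _.
Let mh' : @measurable_fun _ _ T (measurableTypeR R) setT h := mh.

Let lebI a : leb (`]-oo, a[%classic `&` I01) = (Num.max 0 (Num.min a 1))%:E.
Proof.
have [a0|a0] := leP a 0.
  rewrite (_ : _ `&` _ = set0) ?measure0.
    by rewrite (min_idPl _) ?(max_idPl _)// (le_trans a0).
  by rewrite -subset0 => x /= []; rewrite !in_itv/= => xa /andP[x0 _]; lra.
have -> : `]-oo, a[%classic `&` I01 = `]0, Num.min a 1[%classic.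
  apply/seteqP; split => x /=; rewrite !in_itv/= lt_min; first by case=> -> /andP[-> ->].
  by move=> /andP[-> /andP[-> ->]].
have m0 : 0 < Num.min a 1 by rewrite lt_min a0 ltr01.
by rewrite lebesgue_measure_itv/= lte_fin m0 -EFinB subr0 (max_idPr (ltW m0)).
Qed.

Let nu1 : {measure set (measurableTypeR R) -> \bar R} :=
  measure_function_pushforward__canonical__measure_function_Measure (mrestr M mD) mh'.
Let nu2 : {measure set (measurableTypeR R) -> \bar R} :=
  @mscale _ (measurableTypeR R) R k (mrestr leb mI).

Let meas_eq A : measurable A -> nu1 A = nu2 A.
Proof.
apply: (@measure_unique _ R (measurableTypeR R) (@RGenInftyO.G R)
  (fun n => `]-oo, n%:R[%classic) _ _ _ _ nu1 nu2).
- exact: RGenInftyO.measurableE.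
- move=> _ _ [a ->] [b ->]; exists (Num.min a b).
  by apply/seteqP; split => x /=; rewrite !in_itv/= lt_min; [case=> -> ->|move=> /andP[]].
- by move=> i; exists i%:R.
- rewrite -subTset => x _; exists (Num.truncn x).+1 => //=.
  by rewrite in_itv/= Num.Theory.truncnS_gt.
- move=> _ [a ->].
  transitivity (M (D `&` h @^-1` `]-oo, a[%classic)); first by congr (M _); rewrite setIC.
  by rewrite hcdf EFinM; congr (_ * _)%E; rewrite -lebI.
- move=> n.
  have -> : nu1 `]-oo, n%:R[%classic =
      M (D `&` h @^-1` `]-oo, n%:R[%classic) by congr (M _); rewrite setIC.
  by rewrite hcdf ltry.
Qed.

(** By [hcdf], the image under h of M restricted to D and k times the Lebesgue measure of []0, 1[]
    agree on half-lines, hence on all measurable sets. *)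
Lemma cdf_integral (f : R -> \bar R) : measurable_fun setT f -> (forall x, 0 <= f x)%E ->
  (\int[M]_(x in D) f (h x) = k%:num%:E * \int[leb]_(s in I01) f s)%E.
Proof.
move=> mf f0.
have mfh : measurable_fun setT (f \o h) by exact: measurableT_comp.
rewrite -[LHS](@integral_mrestr _ _ R M D mD (f \o h) mfh (fun x => f0 (h x))).
have := @ge0_integral_pushforward _ _ _ (measurableTypeR R) _ h mh' (mrestr M mD) setT f
  measurableT mf (fun x _ => f0 x).
rewrite preimage_setT => <-.
rewrite -(@integral_mrestr _ (measurableTypeR R) R leb _ mI f mf f0) -ge0_integral_mscale//.
by apply: eq_measure_integral => A mA _; exact: meas_eq.
Qed.

End cdf.

Lemma measurable_ltset d (T : measurableType d) (R : realType) (f g : T -> R) :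
  measurable_fun setT f -> measurable_fun setT g -> measurable [set x | f x < g x].
Proof.
move=> mf mg; have := @measurable_fun_ltr _ _ _ setT f g mf mg.
move=> /(_ measurableT [set true] (I : measurable [set true])).
by rewrite setTI; congr measurable; apply/seteqP; split => p.
Qed.

Section weighted_cdf.
Context (R : realType).
Notation leb := (@lebesgue_measure R).
Notation I01 := (`]0, 1[%classic : set R).
Variables (h w : R -> R) (mh : measurable_fun setT h) (mw : measurable_fun setT w).
Hypothesis w0 : forall x, 0 <= w x.
Hypothesis hcdf : forall a, (\int[leb]_(x in I01 `&` h @^-1` `]-oo, a[%classic) (w x)%:E =
  (Num.max 0 (Num.min a 1))%:E)%E.

Let mI : measurable (I01 : set (measurableTypeR R)) := measurable_itv _.

(* Layer cake: the weight [w] becomes the plane region below its graph *)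
Lemma weighted_cdf_integral (f : R -> R) : measurable_fun setT f -> (forall x, 0 <= f x) ->
  (\int[leb]_(x in I01) (f (h x) * w x)%:E = \int[leb]_(s in I01) (f s)%:E)%E.
Proof.
move=> mf f0.
pose D := [set p : R * R | I01 p.1 /\ 0 < p.2 < w p.1].
have m1 : measurable_fun setT (fst : R * R -> R) := measurable_fst.
have m2 : measurable_fun setT (snd : R * R -> R) := measurable_snd.
have mD : measurable D.
  have -> : D = (fst @^-1` I01) `&` ([set p | (fun=> 0) p < p.2] `&` [set p | p.2 < (w \o fst) p]).
    by apply/seteqP; split => p /=; [case=> ? /andP[? ?]|case=> ? [? ?]; split=> //; apply/andP].
  apply: measurableI; first by rewrite -[X in measurable X]setTI; exact: m1.
  apply: measurableI; apply: measurable_ltset => //.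
  exact: measurableT_comp.
have sec x : xsection D x = if x \in I01 then `]0, w x[%classic else set0.
  apply/seteqP; split => y; rewrite /xsection/= inE /D/=.
    by move=> [Ix yw]; rewrite mem_set//= in_itv.
  by case: ifPn => // /set_mem Ix; rewrite /= in_itv.
have lebw x : leb `]0, w x[%classic = (w x)%:E.
  rewrite lebesgue_measure_itv/= lte_fin; case: ltP => h0; first by rewrite -EFinB subr0.
  by congr EFin; apply/eqP; rewrite eq_le w0 h0.
have hcdf' a : mu2 R (D `&` (h \o fst) @^-1` `]-oo, a[%classic) =
    ((1%:nng : {nonneg R})%:num * Num.max 0 (Num.min a 1))%:E.
  rewrite /= mul1r -hcdf [RHS]integral_mkcond /product_measure1; apply: eq_integral => x _ /=.
  have -> : xsection (D `&` (h \o fst) @^-1` `]-oo, a[%classic) x =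
      if x \in I01 `&` h @^-1` `]-oo, a[%classic then `]0, w x[%classic else set0.
    apply/seteqP; split => y; rewrite /xsection/= inE /D/=.
      by move=> [[Ix yw] xa]; rewrite mem_set//= in_itv.
    by case: ifPn => // /set_mem [Ix xa]; rewrite /= in_itv => yw; split.
  by rewrite patchE; case: ifP => _; [exact: lebw|rewrite measure0].
have mfh : measurable_fun setT (EFin \o (f \o h)).
  by apply/measurable_EFinP; exact: measurableT_comp.
have mhf : measurable_fun setT (h \o fst : R * R -> R) by exact: measurableT_comp.
have := @cdf_integral _ _ R (mu2 R) D mD (h \o fst) mhf 1%:nng hcdf' (EFin \o f)
  (ltac:(exact/measurable_EFinP)) (fun x => f0 x).
rewrite mul1e => <-; rewrite [RHS]integral_mkcond.
pose Gf := (fun p : R * R => (EFin \o f) ((h \o fst) p)) \_ D.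
have mG : measurable_fun setT Gf.
  apply/(measurable_restrictT _ mD); apply: measurable_funTS.
  by apply/measurable_EFinP; apply: measurableT_comp => //; exact: measurableT_comp.
have G0 p : (0 <= Gf p)%E by rewrite /Gf patchE; case: ifP => // _; rewrite lee_fin f0.
rewrite [RHS](@fubini_tonelli1 _ _ _ _ R leb leb Gf mG G0) [LHS]integral_mkcond.
apply: eq_integral => x _; rewrite patchE /fubini_F.
have E y : Gf (x, y) = (((f (h x))%:E * (\1_(xsection D x) y)%:E)%E : \bar R).
  rewrite /Gf patchE indicE /xsection/=.
  have -> : (y \in [set y0 | (x, y0) \in D]) = ((x, y) \in D).
    by apply/idP/idP => [/set_mem//|yD]; apply: mem_set.
  by case: ifP => _; rewrite ?mule1 ?mule0.
under eq_integral do rewrite E.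
have mS : measurable (xsection D x) by exact: measurable_xsection.
rewrite ge0_integralZl//.
- rewrite integral_indic// setIT sec; case: ifP => _; last by rewrite measure0 mule0.
  by rewrite EFinM; congr (_ * _)%E; exact/esym/lebw.
- by apply/measurable_EFinP; exact: measurable_indic.
- by rewrite lee_fin.
Qed.

End weighted_cdf.

Section scaling.
Variable R : realType.
Notation leb := (@lebesgue_measure R).

Lemma leb_scale (c : R) (A : set (measurableTypeR R)) : 0 < c -> measurable A ->
  leb ((fun x => x / c) @^-1` A) = (c%:E * leb A)%E.
Proof.
move=> c0 mA.
have mh : @measurable_fun _ _ (measurableTypeR R) (measurableTypeR R) setT
    (fun x : R => x / c) by exact: mulrr_measurable.
have ci0 : 0 <= c^-1 by rewrite invr_ge0 ltW.
pose m : {measure set (measurableTypeR R) -> \bar R} :=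
  @mscale _ (measurableTypeR R) R (NngNum ci0)
  (measure_function_pushforward__canonical__measure_function_Measure leb mh).
have := @lebesgue_measure_unique R m _ A mA.
rewrite {2}/m /= /mscale /= => H.
rewrite H; last first.
  move=> _ [[a b] /= ab <-]; rewrite /m/= /mscale/= /pushforward.
  have -> : (fun x : R => x / c) @^-1` `]a, b]%classic = `]a * c, b * c]%classic.
    by apply/seteqP; split => x /=; rewrite !in_itv/= ltr_pdivlMr// ler_pdivrMr.
  rewrite !lebesgue_measure_itv/= !lte_fin ltr_pM2r//; case: ltP => _; last by rewrite mule0.
  by rewrite -!EFinB -EFinM -mulrBl mulrC mulfK// gt_eqF.
by rewrite muleA -EFinM divff ?gt_eqF// mul1e.
Qed.

(** Homogeneity of degree 2 of the plane measure, which takes the place of polar coordinates; it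
    follows from uniqueness of the product measure. *)
Lemma mu2_scale (c : R) (A : set (R * R)) : 0 < c -> measurable A ->
  mu2 R ((fun x => (x.1 / c, x.2 / c)) @^-1` A) = ((c ^+ 2)%:E * mu2 R A)%E.
Proof.
move=> c0 mA.
have mh : @measurable_fun _ _ (measurableTypeR R * measurableTypeR R)%type
    (measurableTypeR R * measurableTypeR R)%type setT
    (fun x : R * R => (x.1 / c, x.2 / c)).
  apply/measurable_fun_pairP; split.
    by apply: measurable_funM; [exact: measurable_fst|exact: measurable_cst].
  by apply: measurable_funM; [exact: measurable_snd|exact: measurable_cst].
have ms : @measurable_fun _ _ (measurableTypeR R) (measurableTypeR R) setT
    (fun x : R => x / c) by exact: mulrr_measurable.
have ci0 : 0 <= (c ^+ 2)^-1 by rewrite invr_ge0 exprn_ge0 ?ltW.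
pose m : {measure set (measurableTypeR R * measurableTypeR R) -> \bar R} :=
  @mscale _ _ R (NngNum ci0)
  (measure_function_pushforward__canonical__measure_function_Measure (mu2 R) mh).
have := @product_measure_unique _ _ _ _ R leb leb m _ A mA.
rewrite {2}/m /= /mscale /= => H.
rewrite H; last first.
  move=> A1 A2 mA1 mA2; rewrite /m/= /mscale/= /pushforward.
  have -> : (fun x : R * R => (x.1 / c, x.2 / c)) @^-1` (A1 `*` A2) =
    ((fun x => x / c) @^-1` A1) `*` ((fun x => x / c) @^-1` A2) by [].
  rewrite product_measure1E; last 2 first.
  - by have := ms measurableT _ mA1; rewrite setTI.
  - by have := ms measurableT _ mA2; rewrite setTI.
  transitivity ((c ^- 2)%:E * ((c%:E * leb A1) * (c%:E * leb A2)))%E.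
    by congr (_ * (_ * _))%E; exact: leb_scale.
  rewrite muleACA (muleA (c ^- 2)%:E) -EFinM -expr2 mulVf ?mul1e//.
  by rewrite expf_neq0// gt_eqF.
by rewrite muleA -EFinM divff ?mul1e// expf_neq0// gt_eqF.
Qed.

(* The area of the disk; that it equals [pi] is never needed. *)
Definition kappa := fine (mu2 R (disk R)).

Lemma kappaE : mu2 R (disk R) = kappa%:E.
Proof. by rewrite /kappa fineK// ge0_fin_numE// mu_disk_lty. Qed.

Lemma kappa_gt0 : 0 < kappa.
Proof.
rewrite -lte_fin -kappaE.
pose S : set (R * R) := `]0, 2^-1[%classic `*` `]0, 2^-1[%classic.
apply: (@lt_le_trans _ _ (mu2 R S)).
  have L : leb `]0, 2^-1[%classic = (2^-1)%:E.
    by rewrite lebesgue_measure_itv/= lte_fin invr_gt0 ltr0n sube0.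
  rewrite product_measure1E// (_ : (_ * _)%E = (2^-1 * 2^-1)%:E) ?lte_fin; last first.
    by rewrite EFinM; congr (_ * _)%E; exact: L.
  by rewrite mulr_gt0 ?invr_gt0 ?ltr0n.
apply: le_measure; rewrite ?inE; [exact: measurableX|exact: mdisk|].
move=> x [/=]; rewrite !in_itv/= => /andP[a1 a2] /andP[b1 b2]; apply/diskE.
by rewrite /sq; nra.
Qed.

(** The set |x|^2 < b is the disk scaled by sqrt b, so its area is linear in b: |x|^2 is uniformly
    distributed on the disk. *)
Lemma area_disk (a : R) : mu2 R (disk R `&` (@sq R) @^-1` `]-oo, a[%classic) =
  (kappa * Num.max 0 (Num.min a 1))%:E.
Proof.
have [a0|a0] := leP a 0.
  rewrite (_ : _ `&` _ = set0) ?measure0.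
    by rewrite (min_idPl _) ?(max_idPl _) ?mulr0// (le_trans a0).
  by rewrite -subset0 => x /= []; rewrite !in_itv/= => _; have := sq_ge0 x; lra.
set b := Num.min a 1.
have b0 : 0 < b by rewrite lt_min a0 ltr01.
rewrite (max_idPr (ltW b0)).
have -> : disk R `&` (@sq R) @^-1` `]-oo, a[%classic =
    (fun x => (x.1 / Num.sqrt b, x.2 / Num.sqrt b)) @^-1` disk R.
  have E (x : R * R) : sq (x.1 / Num.sqrt b, x.2 / Num.sqrt b) = sq x / b.
    by rewrite {1}/sq/= !expr_div_n sqr_sqrtr ?ltW// -mulrDl.
  apply/seteqP; split => x /=; rewrite in_itv/=.
    by move=> [/diskE x1 xa]; apply/diskE; rewrite E ltr_pdivrMr// mul1r lt_min xa x1.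
  move/diskE; rewrite E ltr_pdivrMr// mul1r lt_min => /andP[xa x1].
  by split => //; apply/diskE.
rewrite mu2_scale ?sqrtr_gt0//; last exact: mdisk.
by rewrite sqr_sqrtr ?ltW// kappaE -EFinM mulrC.
Qed.

Lemma measurable_sq : measurable_fun setT (@sq R).
Proof. by apply: continuous_measurable2 => //; exact: continuous_sq. Qed.

Lemma polar (h : R -> R) : measurable_fun setT h -> (forall s, 0 <= h s) ->
  (\int[mu2 R]_(x in disk R) (h (sq x))%:E =
   kappa%:E * \int[leb]_(s in `]0%R, 1%R[) (h s)%:E)%E.
Proof.
move=> mh h0.
exact: (@cdf_integral _ _ R (mu2 R) (disk R) (@mdisk R) (@sq R) measurable_sq
  (NngNum (ltW kappa_gt0)) area_disk (EFin \o h) (ltac:(exact/measurable_EFinP)) (fun s => h0 s)).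
Qed.

End scaling.

(** * Power substitutions on the unit interval *)

Section power.
Variable R : realType.
Notation leb := (@lebesgue_measure R).
Notation I01 := (`]0, 1[%classic : set R).

(** For g > 1 the integrand is continuous up to 0 with value 0, so the fundamental theorem of
    calculus applies on the closed interval. *)
Lemma int_power (g c : R) : 1 < g -> 0 < c ->
  (\int[leb]_(x in `]0%R, c[) (g * x `^ (g - 1))%:E = (c `^ g)%:E)%E.
Proof.
move=> g1 c0.
have g0 : 0 < g by exact: lt_trans g1.
have dp (a x : R) : 0 < x -> {for x, continuous (fun t : R => t `^ a)}.
  by move=> x0; exact: (@is_derive_cont R (fun t : R => t `^ a) x _ (is_derive1_powR a x0)).
rewrite integral_itv_bndo_bndc; last first.
  by apply/measurable_EFinP; apply: measurable_funM => //; apply: measurable_funTS; exact: measurable_powR.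
rewrite integral_itv_obnd_cbnd; last first.
  by apply/measurable_EFinP; apply: measurable_funM => //; apply: measurable_funTS; exact: measurable_powR.
rewrite (@continuous_FTC2 _ _ (fun t : R => t `^ g))//.
- by rewrite powR0 ?sube0// gt_eqF.
- apply/continuous_within_itvP => //; split.
  + move=> x; rewrite in_itv/= => /andP[x0 _]; apply: cvgM; [exact: cvg_cst|exact: dp].
  + rewrite powR0 ?mulr0; last by rewrite gt_eqF// subr_gt0.
    rewrite -[X in _ --> X](mulr0 g); apply: cvgM; first exact: cvg_cst.
    by apply: powR_cvg0; rewrite subr_gt0.
  + by apply: cvg_at_left_filter; apply: cvgM; [exact: cvg_cst|exact: dp].
- split.
  + by move=> x; rewrite in_itv/= => /andP[x0 _]; case: (is_derive1_powR g x0).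
  + by rewrite powR0 ?gt_eqF//; exact: powR_cvg0.
  + by apply: cvg_at_left_filter; exact: dp.
- move=> x; rewrite in_itv/= => /andP[x0 _]; rewrite derive1E.
  by case: (is_derive1_powR g x0).
Qed.

(** Under the density g s^(g-1) on []0, 1[] the variable s^g is uniformly distributed, by
    [int_power]. *)
Lemma pow_gt1 (g : R) (h : R -> R) : 1 < g ->
  measurable_fun setT h -> (forall s, 0 <= h s) ->
  (\int[leb]_(s in I01) (h (s `^ g) * (g * s `^ (g - 1)))%:E = \int[leb]_(s in I01) (h s)%:E)%E.
Proof.
move=> g1 mh h0.
have g0 : 0 < g by exact: lt_trans g1.
apply: (@weighted_cdf_integral R (fun t : R => t `^ g) (fun s => g * s `^ (g - 1))) => //.
- by apply: measurable_funM => //; exact: measurable_powR.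
- by move=> x; rewrite mulr_ge0 ?powR_ge0// ltW.
move=> a; have [a0|a0] := leP a 0.
  rewrite (_ : _ `&` _ = set0) ?integral_set0.
    by rewrite (min_idPl _) ?(max_idPl _)// (le_trans a0).
  rewrite -subset0 => x /= []; rewrite !in_itv/= => _; have := powR_ge0 x g; lra.
set b := Num.min a 1.
have b0 : 0 < b by rewrite lt_min a0 ltr01.
have bi0 : 0 < b `^ g^-1 by exact: powR_gt0.
have bE : (b `^ g^-1) `^ g = b by rewrite -powRrM mulVf ?gt_eqF// powRr1// ltW.
rewrite (max_idPr (ltW b0)) -[in RHS]bE -int_power//; congr (integral _ _ _).
apply/seteqP; split => x /=; rewrite !in_itv/=.
  move=> [/andP[x0 x1] xa]; rewrite x0/= ltNge; apply/negP => bx.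
  have : b <= x `^ g by rewrite -bE; apply: ge0_ler_powR; rewrite ?nnegrE //; exact: ltW.
  rewrite ge_min => /orP[|]; first by rewrite leNgt xa.
  have : x `^ g < 1 `^ g by apply: gt0_ltr_powR; rewrite ?nnegrE //; exact: ltW.
  by rewrite powR1 ltNge => /negP.
move=> /andP[x0 xb].
have : x `^ g < b by rewrite -bE; apply: gt0_ltr_powR; rewrite ?nnegrE //; exact: ltW.
rewrite lt_min => /andP[xa x1]; split => //; rewrite x0/= ltNge; apply/negP => x1'.
have : 1 `^ g <= x `^ g by apply: ge0_ler_powR; rewrite ?nnegrE //; exact: ltW.
by rewrite powR1 leNgt x1.
Qed.

(** The Jacobian is now unbounded at 0, so the case of the exponent 1/b > 1 is applied to the
    left-hand integrand, and the two Jacobians cancel. *)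
Lemma pow_lt1 (b : R) (h : R -> R) : 0 < b < 1 ->
  measurable_fun setT h -> (forall s, 0 <= h s) ->
  (\int[leb]_(s in I01) (h (s `^ b) * (b * s `^ (b - 1)))%:E = \int[leb]_(s in I01) (h s)%:E)%E.
Proof.
move=> /andP[b0 b1] mh h0.
have bi1 : 1 < b^-1 by rewrite invf_gt1.
rewrite -(@pow_gt1 b^-1 (fun s => h (s `^ b) * (b * s `^ (b - 1))) bi1).
- apply: eq_integral => s /set_mem /=; rewrite in_itv/= => /andP[s0 s1]; congr EFin.
  rewrite -!powRrM mulVf ?gt_eqF// powRr1 ?ltW//.
  rewrite -!mulrA [X in h s * (b * X)]mulrCA mulVKf ?gt_eqF//.
  rewrite -powRD; last by apply/implyP => _; rewrite gt_eqF.
  by rewrite mulrBr mulVf ?gt_eqF// mulr1 addrA subrK subrr powRr0 mulr1.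
- apply: measurable_funM; first by apply: measurableT_comp => //; exact: measurable_powR.
  by apply: measurable_funM => //; exact: measurable_powR.
- by move=> s; rewrite !mulr_ge0 ?powR_ge0// ltW.
Qed.

Lemma pow_subst (b : R) (h : R -> R) : 0 < b ->
  measurable_fun setT h -> (forall s, 0 <= h s) ->
  (\int[leb]_(s in I01) (h (s `^ b) * (b * s `^ (b - 1)))%:E = \int[leb]_(s in I01) (h s)%:E)%E.
Proof.
move=> b0 mh h0; have [b1|b1|->] := ltgtP b 1.
- by apply: pow_lt1 => //; rewrite b0.
- exact: pow_gt1.
apply: eq_integral => s /set_mem /=; rewrite in_itv/= => /andP[s0 _].
by rewrite powRr1 ?ltW// subrr powRr0 !mulr1.
Qed.

End power.

(** * Radial functions of finite energy *)

Section simple_induction.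
Import HBSimple HBNNSimple.
Variable R : realType.

(** Simple functions, then their monotone limits for the positive and negative parts. The limits
    considered are dominated by f, so that P may include integrability or boundedness. *)
Lemma measurable_fun_induction (P : (R -> R) -> Prop) (f : R -> R) :
  measurable_fun setT f ->
  (forall A, measurable A -> P \1_A) ->
  (forall g h, P g -> P h -> P (fun s => g s + h s)) ->
  (forall c g, P g -> P (fun s => c * g s)) ->
  (forall (g_ : nat -> R -> R) (g : R -> R), measurable_fun setT g -> (forall s, `|g s| <= `|f s|) ->
    (forall n, P (g_ n)) -> (forall s, g_ n s @[n --> \oo] --> g s) ->
    (forall n s, `|g_ n s| <= `|g s|) -> P g) ->
  P f.
Proof.
move=> mf P1 PD PZ Pl.
have P0 : P (fun=> 0).
  have := PZ 0 _ (P1 _ measurable0); congr P; apply/funext => s; exact: mul0r.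
have Pn (g : {nnsfun R >-> R}) : P g.
  have -> : (g : R -> R) = fun s => \sum_(y <- finmap.enum_fset (fset_set (range g))) (y * \1_(g @^-1` [set y]) s).
    by apply/funext => s; rewrite fimfunE fsbig_finite.
  elim: (finmap.enum_fset _) => [|y l IH].
    by move: P0; congr P; apply/funext => s; rewrite big_nil.
  have my : measurable (g @^-1` [set y]).
    by rewrite -[X in measurable X]setTI; exact: measurable_funP.
  have := PD _ _ (PZ y _ (P1 _ my)) IH.
  by congr P; apply/funext => s; rewrite big_cons.
have Pp (g : R -> R) : measurable_fun setT g -> (forall s, `|g s| <= `|f s|) ->
    (forall s, 0 <= g s) -> P g.
  move=> mg gf g0.
  have mg' : measurable_fun setT (EFin \o g) by exact/measurable_EFinP.
  pose a n := nnsfun_approx measurableT mg' n.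
  have g0' x : [set: R] x -> (0 <= (EFin \o g) x)%E by move=> _; rewrite /= lee_fin.
  have ca (s : R) : a n s @[n --> \oo] --> g s.
    have := cvg_nnsfun_approx measurableT mg' g0' (I : [set: R] s).
    by move/fine_cvg.
  apply: (Pl (fun n => a n : R -> R)) => // n s.
  rewrite (ger0_norm (g0 s)) ger0_norm; last exact: fun_ge0.
  rewrite -lee_fin; by rewrite nnsfun_approxE; exact: le_approx.
have := PD _ _ (Pp (f ^\+)%R _ _ _) (PZ (-1) _ (Pp (f ^\-)%R _ _ _)).
have H1 : measurable_fun setT (f ^\+)%R by exact: measurable_funrpos.
have H2 : measurable_fun setT (f ^\-)%R by exact: measurable_funrneg.
have H3 s : `|(f ^\+)%R s| <= `|f s|.
  by rewrite ger0_norm ?funrpos_ge0// /funrpos ge_max normr_ge0 ler_norm.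
have H4 s : `|(f ^\-)%R s| <= `|f s|.
  by rewrite ger0_norm ?funrneg_ge0// /funrneg ge_max normr_ge0 -normrN ler_norm.
move=> /(_ H1 H3 (funrpos_ge0 f) H2 H4 (funrneg_ge0 f)); congr P.
by apply/funext => s; rewrite mulN1r -{3}(funrposBneg f).
Qed.

End simple_induction.

(** * Density of smooth functions in the weighted space *)

Section density.
Variable R : realType.
Notation leb := (@lebesgue_measure R).
Notation I01 := (`]0, 1[%classic : set R).
Notation sqI := (@sqint _ (measurableTypeR R) R leb I01).
Notation ipI := (@ip _ (measurableTypeR R) R leb I01).

(** Turns the weighted energy, the integral of s f(s)^2, into an ordinary squared L^2 norm. *)
Definition wgt (f : R -> R) (s : R) := Num.sqrt s * f s.

Lemma mI01 : measurable (I01 : set (measurableTypeR R)).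
Proof. exact: measurable_itv. Qed.

Lemma leb_I01 : (leb I01 < +oo)%E.
Proof. by rewrite lebesgue_measure_itv/= lte_fin ltr01 -EFinB ltry. Qed.

Lemma measurable_sqrt : measurable_fun setT (@Num.sqrt R).
Proof. by apply: continuous_measurable_fun; exact: sqrt_continuous. Qed.

Lemma measurable_wgt (f : R -> R) : measurable_fun setT f -> measurable_fun setT (wgt f).
Proof. by move=> mf; apply: measurable_funM => //; exact: measurable_sqrt. Qed.

Lemma wgt_bounded (f : R -> R) M : measurable_fun setT f ->
  (forall s, I01 s -> `|f s| <= M) -> sqI (wgt f).
Proof.
move=> mf fM; split; first by apply: measurable_funTS; exact: measurable_wgt.
apply: (@le_integrableR _ _ _ _ _ mI01 _ (fun=> M ^+ 2)).
- by apply: measurable_funX; apply: measurable_funTS; exact: measurable_wgt.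
- apply: measurable_bounded_integrable => //.
    exact: leb_I01.
  exists (M ^+ 2); split; first exact: num_real.
  by move=> N MN x _ /=; rewrite ger0_norm ?sqr_ge0 ?ltW.
move=> s Is; rewrite ger0_norm ?sqr_ge0// /wgt exprMn sqr_sqrtr; last first.
  by move: Is; rewrite /= in_itv/= => /andP[/ltW].
have := fM s Is; move: Is; rewrite /= in_itv/= => /andP[s0 s1] fs.
rewrite -(real_normK (num_real (f s))).
have : `|f s| ^+ 2 <= M ^+ 2 by rewrite ler_sqr ?nnegrE// (le_trans _ fs).
by have := sqr_ge0 `|f s|; nra.
Qed.

(** The distance d from the endpoint 1 makes the primitive of b vanish near the boundary circle,
    hence a test function after composition with |x|^2. *)
Definition nice (b : R -> R) := [/\ forall k, Ck1 k b, exists M, forall s, `|b s| <= M &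
  exists2 d, 0 < d < 1 & forall s, ~ (d < s < 1 - d) -> b s = 0].

Definition wdist (f g : R -> R) :=
  ipI (wgt (fun s => f s - g s)) (wgt (fun s => f s - g s)).

Definition dense (f : R -> R) := [/\ measurable_fun setT f, sqI (wgt f) &
  forall e, 0 < e -> exists2 b, nice b & wdist f b < e].

Lemma nice_measurable b : nice b -> measurable_fun setT b.
Proof. by case=> /(_ 0%N) /Ck1_continuous cb _ _; exact: continuous_measurable_fun. Qed.

Lemma nice_sq b : nice b -> sqI (wgt b).
Proof.
by move=> nb; have [_ [M bM] _] := nb; apply: (@wgt_bounded _ M) => //; exact: nice_measurable.
Qed.

Lemma niceD b c : nice b -> nice c -> nice (fun s => b s + c s).
Proof.
move=> [Cb [M bM] [d /andP[d0 d1] bd]] [Cc [N cN] [e /andP[e0 e1] ce]]; split.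
- by move=> k; exact: Ck1D.
- by exists (M + N) => s; rewrite (le_trans (ler_normD _ _))// lerD.
exists (Num.min d e); first by rewrite lt_min d0 e0 gt_min d1.
have [] : Num.min d e <= d /\ Num.min d e <= e by rewrite !ge_min !lexx orbT.
move: (Num.min d e) => m md me s h.
by rewrite bd ?ce ?addr0// => /andP[? ?]; apply: h; apply/andP; split; lra.
Qed.

Lemma niceZ k b : nice b -> nice (fun s => k * b s).
Proof.
move=> [Cb [M bM] [d d01 bd]]; split.
- by move=> n; apply: Ck1M => //; exact: Ck1_cst.
- by exists (`|k| * M) => s; rewrite normrM ler_wpM2l.
by exists d => // s h; rewrite bd ?mulr0.
Qed.

Lemma wgt_sqB f g : sqI (wgt f) -> sqI (wgt g) -> sqI (wgt (fun s => f s - g s)).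
Proof.
move=> sf sg; have := @sqintB _ _ _ _ _ mI01 _ _ sf sg.
by congr sqint; apply/funext => s; rewrite /wgt mulrBr.
Qed.

Lemma wdist_tri f g h : sqI (wgt f) -> sqI (wgt g) -> sqI (wgt h) ->
  wdist f h <= 2 * wdist f g + 2 * wdist g h.
Proof.
move=> sf sg sh.
have := @ip_sum2 _ _ _ _ _ mI01 _ _ (wgt_sqB sf sg) (wgt_sqB sg sh).
congr (_ <= _); rewrite /wdist; congr ip; apply/funext => s; rewrite /wgt; ring.
Qed.

Lemma dense_lim f : measurable_fun setT f -> sqI (wgt f) ->
  (forall e, 0 < e -> exists2 g, dense g & wdist f g < e) -> dense f.
Proof.
move=> mf sf H; split => // e e0.
have e4 : 0 < e / 4 by rewrite divr_gt0.
have [g [mg sg /(_ _ e4)[b nb gb]] fg] := H _ e4.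
exists b => //; have := wdist_tri sf sg (nice_sq nb); lra.
Qed.

Lemma dense_dom (f_ : nat -> R -> R) (f g : R -> R) : measurable_fun setT f ->
  sqI (wgt g) -> (forall n, dense (f_ n)) ->
  (forall s, I01 s -> f_ n s @[n --> \oo] --> f s) ->
  (forall n s, I01 s -> `|f_ n s| <= `|g s|) -> dense f.
Proof.
move=> mf sg df cf fg.
have fg' s : I01 s -> `|f s| <= `|g s|.
  move=> Is; have c : `|f_ n s| @[n --> \oo] --> `|f s| by apply: cvg_norm; exact: cf.
  rewrite -(cvg_lim _ c)//; apply: limr_le; first exact: cvgP c.
  by apply: nearW => n; exact: fg.
have sf : sqI (wgt f).
  apply: (sqint_le mI01 _ sg); first by apply: measurable_funTS; exact: measurable_wgt.
  by move=> s Is; rewrite /wgt !normrM ler_wpM2l// fg'.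
apply: dense_lim => // e e0.
have [||s Is||n s Is|_ c] := @dominatedR _ (measurableTypeR R) R leb I01
  (fun n s => wgt (fun s => f s - f_ n s) s * wgt (fun s => f s - f_ n s) s) (fun=> 0)
  (fun s => 4 * (wgt g s ^+ 2)).
- exact: mI01.
- move=> n; apply: measurable_funM; apply: measurable_funTS; apply: measurable_wgt;
    by apply: measurable_funB => //; case: (df n).
- have c : wgt (fun s => f s - f_ n s) s @[n --> \oo] --> (0 : R).
    rewrite -[X in _ --> X](mulr0 (Num.sqrt s)) -[X in _ * X](subrr (f s)).
    by apply: cvgM; [exact: cvg_cst|apply: cvgB; [exact: cvg_cst|exact: cf]].
  by rewrite -[X in _ --> X](mulr0 0); exact: cvgM.
- by apply: (integrableZR mI01); case: sg.
- rewrite normrM -expr2 /wgt normrM !exprMn real_normK ?num_real//.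
  (* The dominating function 4 (wgt g)^2 comes from |f - f_n| <= 2 |g|. *)
  rewrite [leRHS]mulrCA; apply: ler_wpM2l; first exact: sqr_ge0.
  have h1 : `|f s - f_ n s| <= 2 * `|g s|.
    have := ler_normB (f s) (f_ n s); have := fg' s Is; have := fg n s Is; lra.
  have : `|f s - f_ n s| ^+ 2 <= (2 * `|g s|) ^+ 2 by rewrite ler_sqr ?nnegrE// mulr_ge0.
  by rewrite exprMn (real_normK (num_real (g s))); congr (_ <= _ * _); ring.
have c0 : wdist f (f_ n) @[n --> \oo] --> (0 : R).
  by move: c; rewrite /Rintegral integral0.
have /(_ _ e e0) := @cvgr_lt _ _ _ _ _ _ c0.
case=> n _ /(_ n (leqnn n)) h; exists (f_ n) => //.
Qed.

Lemma dense_eq (f g : R -> R) : measurable_fun setT g -> (forall s, I01 s -> f s = g s) ->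
  dense f -> dense g.
Proof.
move=> mg fg df; have [_ sf _] := df; apply: (@dense_dom (fun=> f) _ f) => //.
by move=> s /fg ->; exact: cvg_cst.
Qed.

Lemma dense_nice b : nice b -> dense b.
Proof.
move=> nb; split; [exact: nice_measurable|exact: nice_sq|move=> e e0; exists b => //].
rewrite /wdist /ip (_ : (fun=> _) = cst 0) ?Rintegral_cst0//.
  by rewrite /Rintegral integral0.
by apply/funext => s; rewrite /wgt subrr !mulr0.
Qed.

Lemma denseD f g : dense f -> dense g -> dense (fun s => f s + g s).
Proof.
move=> [mf sf df] [mg sg dg]; split; first exact: measurable_funD.
  have := @sqintD _ _ _ _ _ mI01 _ _ sf sg.
  by congr sqint; apply/funext => s; rewrite /wgt mulrDr.
move=> e e0; have e4 : 0 < e / 4 by rewrite divr_gt0.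
have [b nb fb] := df _ e4; have [c nc gc] := dg _ e4.
exists (fun s => b s + c s); first exact: niceD.
have := @ip_sum2 _ _ _ _ _ mI01 _ _ (wgt_sqB sf (nice_sq nb)) (wgt_sqB sg (nice_sq nc)).
rewrite -/(wdist f b) -/(wdist g c).
have -> : ipI (fun x => wgt (fun s => f s - b s) x + wgt (fun s => g s - c s) x)
  (fun x => wgt (fun s => f s - b s) x + wgt (fun s => g s - c s) x) =
  wdist (fun s => f s + g s) (fun s => b s + c s).
  by rewrite /wdist; congr ip; apply/funext => s; rewrite /wgt; ring.
lra.
Qed.

Lemma denseZ k f : dense f -> dense (fun s => k * f s).
Proof.
move=> [mf sf df]; split; first exact: measurable_funM.
  have := @sqintZ _ _ _ _ _ mI01 k _ sf.
  by congr sqint; apply/funext => s; rewrite /wgt mulrCA.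
move=> e e0; have k0 : 0 < k ^+ 2 + 1 by rewrite ltr_wpDl ?sqr_ge0.
have [b nb fb] := df _ (divr_gt0 e0 k0); exists (fun s => k * b s); first exact: niceZ.
have sfb := wgt_sqB sf (nice_sq nb).
have -> : wdist (fun s => k * f s) (fun s => k * b s) = k ^+ 2 * wdist f b.
  rewrite /wdist expr2 -mulrA -(ipZr mI01 k sfb sfb) -(ipZl mI01 k sfb (sqintZ mI01 k sfb)).
  by congr ip; apply/funext => s; rewrite /wgt; ring.
have d0 : 0 <= wdist f b := ip_ge0 _ _ _.
by move: fb; rewrite ltr_pdivlMr//; nra.
Qed.

Lemma dense_bump (a b : R) : 0 < a -> b < 1 -> dense \1_(`]a, b[%classic).
Proof.
move=> a0 b1; apply: (@dense_dom (bumpf a b) _ (fun=> 1)).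
- exact: measurable_indic.
- by apply: (@wgt_bounded _ 1) => // s _; rewrite normr1.
- move=> n; apply: dense_nice; split.
  + by move=> k; exact: bump_Ck1.
  + by exists 1 => s; rewrite ger0_norm ?bump_le1// bump_ge0.
  (* The entries a and 1 - b put []a, b[] inside the admissible support; 1/2 keeps d below 1. *)
  exists (Num.min (2^-1) (Num.min a (1 - b))).
    by rewrite !lt_min invr_gt0 ltr0n a0 subr_gt0 b1 gt_min invf_lt1// ltr1n.
  have [] : Num.min (2^-1) (Num.min a (1 - b)) <= a /\ Num.min (2^-1) (Num.min a (1 - b)) <= 1 - b.
    by rewrite !ge_min !lexx !orbT.
  move: (Num.min _ _) => m ma mb s h; apply: bump_out => /andP[? ?].
  by apply: h; apply/andP; split; lra.
- by move=> s _; exact: bump_cvg.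
by move=> n s _; rewrite normr1 ger0_norm ?bump_le1// bump_ge0.
Qed.

Lemma cvg_indic_eventually (T : Type) (A_ : nat -> set T) (A : set T) (s : T) (N : nat) :
  (forall n, (N <= n)%N -> A_ n s <-> A s) -> (\1_(A_ n) s : R) @[n --> \oo] --> (\1_A s : R).
Proof.
move=> H; apply: cvg_near_cst; exists N => // n /= /H AA.
by rewrite !indicE; congr (nat_of_bool _)%:R; apply/idP/idP => /set_mem h; apply: mem_set; apply/AA.
Qed.

Lemma dense_itv (a b : R) : dense \1_(`]a, b[%classic).
Proof.
pose r n : R := n.+1%:R^-1.
have r0 n : 0 < r n by rewrite invr_gt0.
apply: (@dense_dom (fun n => \1_(`]Num.max a (r n), Num.min b (1 - r n)[%classic)) _ (fun=> 1)).
- exact: measurable_indic.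
- by apply: (@wgt_bounded _ 1) => // s _; rewrite normr1.
- move=> n; apply: dense_bump; first by rewrite lt_max r0 orbT.
  by rewrite gt_min ltrBlDr ltrDl r0 orbT.
- move=> s; rewrite /= in_itv/= => /andP[s0 s1].
  (* From this index on, [r n] is below both s and 1 - s, so that the truncation no longer affects
     s. *)
  pose N := (Num.truncn (Num.max s^-1 (1 - s)^-1)).
  apply: (@cvg_indic_eventually _ _ _ _ N) => n Nn.
  have h : Num.max s^-1 (1 - s)^-1 < n.+1%:R.
    by apply: (lt_le_trans (Num.Theory.truncnS_gt _)); rewrite ler_nat ltnS.
  move: h; rewrite gt_max => /andP[h1 h2].
  have h3 : r n < s by rewrite /r invf_plt ?posrE.
  have h4 : r n < 1 - s by rewrite /r invf_plt ?posrE// subr_gt0.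
  rewrite /= !in_itv/= gt_max lt_min h3 andbT.
  by rewrite (_ : s < 1 - r n) ?andbT//; lra.
by move=> n s _; rewrite normr1 indicE ger0_norm//; case: (_ \in _).
Qed.

Lemma dense_indic (A : set R) : measurable A -> dense \1_A.
Proof.
have s1 : sqI (wgt (fun=> 1)) by apply: (@wgt_bounded _ 1) => // s _; rewrite normr1.
have i1 (S : set R) (s : R) : `|\1_S s : R| <= `|1 : R|.
  by rewrite normr1 indicE ger0_norm//; case: (_ \in _).
have d1 : dense \1_(setT : set R).
  apply: dense_eq (dense_itv 0 1) => [|s Is]; first exact: measurable_indic.
  by rewrite !indicE !mem_set.
have := @dynkin_induction _ (measurableTypeR R) (@RGenOpens.G R) (fun S => measurable S /\ dense \1_S).
have GE : @measurable _ (measurableTypeR R) = <<s @RGenOpens.G R >>.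
  exact: RGenOpens.measurableE.
move=> H mA; suff [] : measurable A /\ dense \1_A by [].
apply: H.
- exact: RGenOpens.measurableE.
- exact: RGenOO_setI.
- by split => //; exact: measurableT.
- by move=> _ [a [b ->]]; split; [exact: measurable_itv|exact: dense_itv].
- move=> S mS [_ dS]; split; first exact: measurableC.
  have := denseD d1 (denseZ (-1) dS); congr dense; apply/funext => s.
  by rewrite !indicE in_setC in_setT; case: (s \in S); rewrite /= ?mulr1 ?mulr0 ?subrr ?addr0.
- move=> F mF tF dF; split; first by apply: bigcupT_measurable.
  apply: (@dense_dom (fun n => \1_(\bigcup_(k in `I_n) F k)) _ (fun=> 1)) => //.
  + by apply: measurable_indic; exact: bigcupT_measurable.
  + elim=> [|n IH].
      rewrite II0 bigcup_set0 indic0; have := denseZ 0 d1.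
      by congr dense; apply/funext => s; rewrite mul0r.
    have := denseD IH (dF n).2; congr dense; apply/funext => s.
    rewrite !indicE -natrD; congr (_%:R).
    have [sn|sn] := boolP (s \in F n).
      rewrite (_ : (s \in \bigcup_(k in `I_n) F k) = false); last first.
        apply/negbTE/negP => /set_mem[k /= kn Fk].
        have := tF k n I I; move/(_ (ex_intro _ s (conj Fk (set_mem sn)))) => E.
        by move: kn; rewrite E ltnn.
      by rewrite mem_set//; exists n => //=; exact: set_mem.
    rewrite addn0; congr (nat_of_bool _); apply/idP/idP => /set_mem[k /= kn Fk]; apply: mem_set.
      by exists k => //=; exact: ltnW.
    exists k => //=; move: kn; rewrite ltnS leq_eqVlt => /predU1P[kn|//].
    by move: sn; rewrite -kn mem_set.
  move=> s _; have [[k _ Fk]|nF] := pselect ((\bigcup_k F k) s).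
    apply: (@cvg_indic_eventually _ _ _ _ k.+1) => n kn; split=> _; first by exists k.
    by exists k.
  by apply: (@cvg_indic_eventually _ _ _ _ 0%N) => n _; split=> -[k _ Fk]; case: nF; exists k.
by rewrite -GE.
Qed.

Lemma dense_all f : measurable_fun setT f -> sqI (wgt f) -> dense f.
Proof.
move=> mf sf; apply: (@measurable_fun_induction _ dense f mf dense_indic denseD denseZ).
move=> f_ g mg gf df cf fg; apply: (dense_dom mg _ df (fun s _ => cf s) (fun n s _ => fg n s)).
apply: (sqint_le mI01 _ sf); first by apply: measurable_funTS; exact: measurable_wgt.
by move=> s Is; rewrite /wgt !normrM ler_wpM2l.
Qed.

End density.

(** * Primitives vanishing at 1 and the logarithmic bound *)

Section prim.
Variable R : realType.
Notation leb := (@lebesgue_measure R).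
Notation I01 := (`]0, 1[%classic : set R).
Notation sqI := (@sqint _ (measurableTypeR R) R leb I01).
Notation ipI := (@ip _ (measurableTypeR R) R leb I01).

(** From ln y < y at y = s^(-c). *)
Lemma neg_ln_le (c s : R) : 0 < c -> 0 < s -> - ln s <= c^-1 * s `^ (- c).
Proof.
move=> c0 s0; have := ltW (ln_sublinear (powR_gt0 (- c) s0)).
by rewrite ln_powR mulNr -mulrN ler_pdivlMl.
Qed.

(** The power substitution applied to the constant 1 with exponent 1 - c; no improper integral has
    to be computed. *)
Lemma int_powN (c : R) : 0 < c < 1 ->
  (\int[leb]_(s in I01) (s `^ (- c))%:E = ((1 - c)^-1)%:E)%E.
Proof.
move=> /andP[c0 c1]; have b0 : 0 < 1 - c by rewrite subr_gt0.
have := @pow_subst R (1 - c) (fun=> 1) b0 (measurable_cst _) (fun=> ler01).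
rewrite integral_cst ?mul1e; last exact: mI01.
have L1 : leb I01 = 1%E by rewrite lebesgue_measure_itv/= lte_fin ltr01 oppr0 adde0.
rewrite [X in _ = X -> _](_ : _ = 1%E); last exact: L1.
under eq_integral do rewrite mul1r addrAC subrr add0r EFinM.
rewrite ge0_integralZl//; last 3 first.
- by apply/measurable_EFinP; apply: measurable_funTS; exact: measurable_powR.
- by move=> s _; rewrite lee_fin powR_ge0.
- by rewrite lee_fin ltW.
by move=> H; rewrite -[RHS]mule1 -H muleA -EFinM mulVf ?gt_eqF// mul1e.
Qed.

Lemma integrable_powN (c : R) : 0 < c < 1 ->
  leb.-integrable I01 (EFin \o (fun s => s `^ (- c))).
Proof.
move=> c01; apply/integrableP; split.
  by apply/measurable_EFinP; apply: measurable_funTS; exact: measurable_powR.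
under eq_integral do rewrite gee0_abs ?lee_fin ?powR_ge0//.
by rewrite int_powN// ltry.
Qed.

Lemma int_inv (s : R) : 0 < s < 1 -> \int[leb]_(t in `]s, 1[) t `^ (-1) = - ln s.
Proof.
move=> /andP[s0 s1].
have dl (x : R) : 0 < x -> {for x, continuous (@ln R)}.
  by move=> x0; exact: (@is_derive_cont R (@ln R) x _ (is_derive1_ln x0)).
have dp (x : R) : 0 < x -> {for x, continuous (fun t : R => t `^ (-1))}.
  by move=> x0; exact: (@is_derive_cont R (fun t : R => t `^ (-1)) x _ (is_derive1_powR (-1) x0)).
have mp : measurable_fun setT (EFin \o (fun t : R => t `^ (-1))).
  by apply/measurable_EFinP; exact: measurable_powR.
rewrite /Rintegral integral_itv_obnd_cbnd; last exact: measurable_funTS.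
rewrite integral_itv_bndo_bndc; last exact: measurable_funTS.
rewrite (@continuous_FTC2 _ _ (@ln R))//.
- by rewrite ln1 sub0e.
- apply: continuous_in_subspaceT => x; rewrite inE/= in_itv/= => /andP[sx _].
  by apply: dp; rewrite (lt_le_trans s0).
- split.
  + by move=> x; rewrite in_itv/= => /andP[/(lt_trans s0) x0 _]; case: (is_derive1_ln x0).
  + by apply: cvg_at_right_filter; exact: dl.
  + by apply: cvg_at_left_filter; exact: dl.
- move=> x; rewrite in_itv/= => /andP[/(lt_trans s0) x0 _]; rewrite derive1E powR_inv1 ?ltW//.
  by case: (is_derive1_ln x0).
Qed.

(* [f] plays the role of [dF/ds] for the radial function [u(x) = F(s)], [s = |x|^2], so that
   [grad u = 2 f(s) x] and the Dirichlet energy is [4 kappa int_0^1 s f(s)^2 ds]. *)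
Definition prim (f : R -> R) (s : R) := if (0 < s < 1) then - \int[leb]_(t in `]s, 1[) f t else 0.

(** A tail integral is a partial integral of a function on the plane, so Tonelli gives
    measurability. Positive and negative parts are treated separately because f is not assumed
    integrable. *)
Lemma measurable_prim f : measurable_fun setT f -> measurable_fun setT (prim f).
Proof.
move=> mf.
have main (g : R -> \bar R) : measurable_fun setT g -> (forall t, 0 <= g t)%E ->
    measurable_fun setT (fun s : R => \int[leb]_(t in `]s, 1%R[) g t)%E.
  move=> mg g0.
  pose S := [set p : R * R | p.1 < p.2] `&` [set p : R * R | p.2 < 1].
  have mS : measurable S.
    by apply: measurableI; exact: measurable_ltset.
  have := @measurable_fun_fubini_tonelli_F _ _ (measurableTypeR R) (measurableTypeR R) R leb
    (fun p => g p.2 * (\1_S p)%:E)%E.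
  have H1 : measurable_fun setT (fun p : measurableTypeR R * measurableTypeR R => g p.2 * (\1_S p)%:E)%E.
    apply: emeasurable_funM; first exact: measurableT_comp measurable_snd.
    by apply/measurable_EFinP; exact: measurable_indic.
  have H2 p : (0 <= g p.2 * (\1_S p)%:E)%E by rewrite mule_ge0// lee_fin.
  move=> /(_ H1 H2); congr measurable_fun; apply/funext => s.
  rewrite /fubini_F [RHS]integral_mkcond; apply: eq_integral => t _.
  rewrite patchE indicE; have [ts|ts] := boolP (t \in _).
    rewrite mem_set ?mule1//; move: ts; rewrite inE/= in_itv/= => /andP[? ?]; by split.
  rewrite (_ : (_ \in S) = false) ?mule0//; apply/negbTE; apply: contra ts.
  by move=> /set_mem[/= h1 h2]; rewrite inE/= in_itv/= h1.
have mI : measurable_fun setT (fun s : R => \int[leb]_(t in `]s, 1[) f t).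
  have -> : (fun s : R => \int[leb]_(t in `]s, 1[) f t) = fun s : R => fine
    (\int[leb]_(t in `]s, 1%R[) (EFin \o f)^\+ t - \int[leb]_(t in `]s, 1%R[) (EFin \o f)^\- t)%E.
    by apply/funext => s; rewrite /Rintegral integralE.
  have mE : measurable_fun setT (EFin \o f) by exact/measurable_EFinP.
  apply: (measurableT_comp (fine_measurable measurableT)).
  apply: emeasurable_funB; apply: main => //.
    exact: measurable_funepos.
  exact: measurable_funeneg.
apply: measurable_fun_ifT => //.
  by apply: measurable_and; apply: measurable_fun_ltr.
exact: measurableT_comp.
Qed.

Section tail.
Variables (f : R -> R) (mf : measurable_fun setT f) (sf : sqI (wgt f)).

Lemma sub_I01 (s : R) : 0 <= s -> `]s, 1[%classic `<=` I01.
Proof. by move=> s0 t /=; rewrite !in_itv/= => /andP[/(le_lt_trans s0) -> ->]. Qed.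

Lemma tail_integrable (s : R) : 0 < s -> leb.-integrable `]s, 1[%classic (EFin \o f).
Proof.
move=> s0; have mt : measurable (`]s, 1[%classic : set (measurableTypeR R)) := measurable_itv _.
have it (g : R -> R) : leb.-integrable I01 (EFin \o g) -> leb.-integrable `]s, 1[%classic (EFin \o g).
  by apply: integrableS => //; apply: sub_I01; exact: ltW.
have i1 : leb.-integrable `]s, 1[%classic (EFin \o (fun=> 1 : R)).
  apply: it; apply: measurable_bounded_integrable => //; first exact: leb_I01.
  exists 1; split; first exact: num_real.
  by move=> N MN x _ /=; rewrite normr1 ltW.
(* On []s, 1[], |f| <= 1 + f^2 and f(t)^2 <= t f(t)^2 / s. *)
apply: (@le_integrableR _ _ _ _ _ mt _ (fun t => 1 + s^-1 * wgt f t ^+ 2)).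
- exact: measurable_funTS.
- apply: integrableDR => //; apply: integrableZR => //; apply: it; exact: sf.2.
move=> t /=; rewrite in_itv/= => /andP[st t1].
rewrite /wgt exprMn sqr_sqrtr; last by rewrite ltW// (lt_trans s0).
have h : f t ^+ 2 <= s^-1 * (t * f t ^+ 2).
  by rewrite mulrA ler_peMl ?sqr_ge0// mulrC ler_pdivlMr// mul1r ltW.
have := sqr_ge0 (`|f t| - 1); rewrite sqrrB real_normK ?num_real//; nra.
Qed.

(** Cauchy-Schwarz for the factorisation f = t^(-1/2) (t^(1/2) f); the first factor contributes the
    integral of 1/t over []s, 1[]. *)
Lemma prim_sq_le (s : R) : 0 < s < 1 -> prim f s ^+ 2 <= - ln s * ipI (wgt f) (wgt f).
Proof.
move=> /[dup] s01 /andP[s0 s1]; rewrite /prim s01 sqrrN.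
have mt : measurable (`]s, 1[%classic : set (measurableTypeR R)) := measurable_itv _.
have pos (t : R) : `]s, 1[%classic t -> 0 < t.
  by rewrite /= in_itv/= => /andP[/(lt_trans s0)].
pose h (t : R) := t `^ (- 2^-1).
have mh : measurable_fun (`]s, 1[%classic : set R) h.
  by apply: measurable_funTS; exact: measurable_powR.
have hh t : 0 < t -> h t * h t = t `^ (-1).
  move=> t0; rewrite /h -powRD; last by apply/implyP => _; rewrite gt_eqF.
  by congr (_ `^ _); field.
have ltS : (leb `]s, 1%R[%classic < +oo)%E.
  by rewrite lebesgue_measure_itv/= lte_fin s1 -EFinB ltry.
have sh : @sqint _ (measurableTypeR R) R leb `]s, 1[%classic h.
  split => //; apply: measurable_bounded_integrable => //.
  - exact: measurable_funX.
  exists s^-1; split; first exact: num_real.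
  move=> N MN t /[dup] /pos t0 /=; rewrite in_itv/= => /andP[st _].
  rewrite ger0_norm ?sqr_ge0// expr2 hh// powR_inv1 ?ltW//.
  by rewrite (le_lt_trans _ MN)// lef_pV2 ?posrE// ltW.
have sft : @sqint _ (measurableTypeR R) R leb `]s, 1[%classic (wgt f).
  split; first by apply: measurable_funTS; exact: measurable_wgt.
  by apply: integrableS sf.2 => //; exact: sub_I01 (ltW s0).
have := @ip_CauchySchwarz _ _ _ _ _ mt _ _ sh sft.
have -> : ip leb `]s, 1[%classic h (wgt f) = \int[leb]_(t in `]s, 1[) f t.
  apply: eq_Rintegral => t /set_mem/pos t0; rewrite /h /wgt -powR12_sqrt ?ltW// mulrA.
  rewrite -powRD; last by apply/implyP => _; rewrite gt_eqF.
  by rewrite addNr powRr0 mul1r.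
have -> : ip leb `]s, 1[%classic h h = - ln s.
  rewrite -int_inv//; apply: eq_Rintegral => t /set_mem/pos t0.
  exact: hh.
move=> H; apply: (le_trans H); rewrite ler_wpM2l//.
  by rewrite oppr_ge0 ln_le0// ltW.
rewrite /ip; under eq_Rintegral do rewrite -expr2.
under [leRHS]eq_Rintegral do rewrite -expr2.
apply: Rintegral_subset_le; [exact: mt|exact: mI01|exact: sub_I01 (ltW s0)|exact: sf.2|].
by move=> x; exact: sqr_ge0.
Qed.

Lemma prim_sqI : sqI (prim f).
Proof.
have mp := measurable_prim mf; split; first exact: measurable_funTS.
have c0 : 0 < (2^-1 : R) < 1 by apply/andP; split; lra.
apply: (@le_integrableR _ _ _ _ _ (@mI01 R) _ (fun s => (2 * ipI (wgt f) (wgt f)) * s `^ (- 2^-1))).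
- by apply: measurable_funTS; exact: measurable_funX.
- by apply: (integrableZR (@mI01 R)); exact: integrable_powN.
move=> s /=; rewrite in_itv/= => s01; rewrite ger0_norm ?sqr_ge0//.
apply: (le_trans (prim_sq_le s01)); rewrite mulrAC ler_wpM2r ?ip_ge0//.
by have := neg_ln_le (andP c0).1 (andP s01).1; rewrite invrK.
Qed.

(** A radial Poincare inequality: the logarithm is at most 2 s^(-1/2), whose integral is 4. *)
Lemma prim_ip_le : ipI (prim f) (prim f) <= 4 * ipI (wgt f) (wgt f).
Proof.
have c0 : 0 < (2^-1 : R) < 1 by apply/andP; split; lra.
set E := ipI (wgt f) (wgt f).
rewrite /ip; under eq_Rintegral do rewrite -expr2.
apply: (@le_trans _ _ (\int[leb]_(s in I01) ((2 * E) * s `^ (- 2^-1)))).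
  apply: (@le_Rintegral _ (measurableTypeR R) R leb I01 _ _ (@mI01 R)).
  - exact: prim_sqI.2.
  - by apply: (integrableZR (@mI01 R)); exact: integrable_powN.
  move=> s /=; rewrite in_itv/= => s01.
  apply: (le_trans (prim_sq_le s01)); rewrite mulrAC ler_wpM2r ?ip_ge0//.
  by have := neg_ln_le (andP c0).1 (andP s01).1; rewrite invrK.
rewrite (@RintegralZl _ (measurableTypeR R) R leb I01 _ _ (@mI01 R)); last exact: integrable_powN.
rewrite /Rintegral int_powN//=.
have -> : (1 - 2^-1 : R)^-1 = 2 by field.
by have E0 : 0 <= E := ip_ge0 _ _ _; lra.
Qed.

End tail.

Lemma primB f g (s : R) : measurable_fun setT f -> measurable_fun setT g ->
  sqI (wgt f) -> sqI (wgt g) -> prim (fun t => f t - g t) s = prim f s - prim g s.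
Proof.
move=> mf mg sf sg; rewrite /prim; case: ifP => [/andP[s0 s1]|]; last by rewrite subr0.
rewrite (@RintegralB _ (measurableTypeR R) R leb `]s, 1[%classic) ?opprB 1?addrC//;
  [by rewrite opprK|exact: tail_integrable..].
Qed.

End prim.

(** * From one-dimensional primitives to Sobolev functions on the disk *)

Section radial.
Variable R : realType.
Notation leb := (@lebesgue_measure R).
Notation I01 := (`]0, 1[%classic : set R).
Notation sqI := (@sqint _ (measurableTypeR R) R leb I01).
Notation ipI := (@ip _ (measurableTypeR R) R leb I01).
Notation B := (disk R).
Notation mu := (mu2 R).
Notation ipB := (ip mu B).

Section nonneg.
Variables (h : R -> R) (mh : measurable_fun setT h) (h0 : forall s, 0 <= h s).

Lemma measurable_radial : measurable_fun setT (h \o @sq R).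
Proof. by apply: measurableT_comp => //; exact: measurable_sq. Qed.

Lemma polar_integrable : leb.-integrable I01 (EFin \o h) -> mu.-integrable B (EFin \o (h \o @sq R)).
Proof.
move=> /integrableP[_ ih]; apply/integrableP; split.
  by apply/measurable_EFinP; apply: measurable_funTS; exact: measurable_radial.
under eq_integral do rewrite /= ger0_norm//.
rewrite (polar mh h0) lte_mul_pinfty ?lee_fin ?ltW ?kappa_gt0//.
by under eq_integral do rewrite -[h _]ger0_norm//.
Qed.

Lemma polarR : leb.-integrable I01 (EFin \o h) ->
  \int[mu]_(x in B) h (sq x) = kappa R * \int[leb]_(s in I01) h s.
Proof.
move=> ih; rewrite /Rintegral (polar mh h0) fineM//.
exact: (integrable_fin_num (@mI01 R) ih).
Qed.

End nonneg.

Lemma L2_radial h : measurable_fun setT h -> sqI h -> L2 (h \o @sq R).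
Proof.
move=> mh [_ h2]; split; first by apply: measurable_funTS; exact: measurable_radial.
apply: (@polar_integrable (fun s => h s ^+ 2) _ _ h2); first exact: measurable_funX.
by move=> s; exact: sqr_ge0.
Qed.

Lemma ip_radial h : measurable_fun setT h -> sqI h ->
  ipB (h \o @sq R) (h \o @sq R) = kappa R * ipI h h.
Proof.
move=> mh [_ h2]; rewrite /ip.
have := @polarR (fun s => h s ^+ 2) (measurable_funX 2 mh) (fun s => sqr_ge0 _) h2.
by under eq_Rintegral do rewrite expr2; under [in RHS]eq_Rintegral do rewrite expr2.
Qed.

Section gradient.
Variables (f : R -> R) (mf : measurable_fun setT f) (sf : sqI (wgt f)).

Let sW : sqI (fun s => 2 * wgt f s). Proof. exact: (sqintZ (@mI01 R)). Qed.
Let mW : measurable_fun setT (fun s => 2 * wgt f s).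
Proof. by apply: measurable_funM => //; exact: measurable_wgt. Qed.

Let grad_sq (x : R * R) : psi1 f x ^+ 2 + psi2 f x ^+ 2 = (2 * wgt f (sq x)) ^+ 2.
Proof.
by rewrite /psi1 /psi2 /wgt !exprMn sqr_sqrtr ?sq_ge0// /sq; ring.
Qed.

Let mf' : measurable_fun B (f \o @sq R).
Proof. by apply: measurable_funTS; exact: measurable_radial. Qed.

Lemma L2_psi1 : L2 (psi1 f).
Proof.
apply: (@sqint_le _ _ R mu B (@mdisk R) _ _ _ (L2_radial mW sW)).
  apply: measurable_funM => //; apply: measurable_funM => //.
  by apply: measurable_funTS; exact: measurable_fst.
move=> x _; rewrite /= -(@ler_pXn2r _ 2)// ?nnegrE//.
by rewrite !real_normK ?num_real// -grad_sq lerDl sqr_ge0.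
Qed.

Lemma L2_psi2 : L2 (psi2 f).
Proof.
apply: (@sqint_le _ _ R mu B (@mdisk R) _ _ _ (L2_radial mW sW)).
  apply: measurable_funM => //; apply: measurable_funM => //.
  by apply: measurable_funTS; exact: measurable_snd.
move=> x _; rewrite /= -(@ler_pXn2r _ 2)// ?nnegrE//.
by rewrite !real_normK ?num_real// -grad_sq lerDr sqr_ge0.
Qed.

Lemma radial_energy : ipB (psi1 f) (psi1 f) + ipB (psi2 f) (psi2 f) =
  4 * kappa R * ipI (wgt f) (wgt f).
Proof.
transitivity (ipB ((fun s => 2 * wgt f s) \o @sq R) ((fun s => 2 * wgt f s) \o @sq R)).
  rewrite /ip -diskI_D; [|exact: (@sqint_mul _ _ R mu B (@mdisk R) _ _ L2_psi1 L2_psi1)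
    |exact: (@sqint_mul _ _ R mu B (@mdisk R) _ _ L2_psi2 L2_psi2)].
  by apply: eq_Rintegral => x _; rewrite -!expr2 grad_sq.
rewrite ip_radial// (ipZl (@mI01 R) 2 sf sW) (ipZr (@mI01 R) 2 sf sf); ring.
Qed.

End gradient.

Lemma supported_antiderivative (b : R -> R) (d M : R) : continuous b ->
  (forall s, `|b s| <= M) -> 0 < d < 1 -> (forall s, ~ (d < s < 1 - d) -> b s = 0) ->
  exists G : R -> R,
  [/\ forall s : R, is_derive s 1 G (b s), forall s, s < d -> G s = 0,
      forall s, 1 - d < s -> G s = G 1 &
      forall s t, s <= t -> leb.-integrable `[s, t[ (EFin \o b) /\
        \int[leb]_(x in `[s, t]) b x = G t - G s].
Proof.
move=> cb bM /andP[d0 d1] bd.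
have mb : measurable_fun setT b by exact: continuous_measurable_fun.
have i1 : leb.-integrable I01 (EFin \o b).
  apply: measurable_bounded_integrable => //; first exact: leb_I01.
    exact: measurable_funTS.
  by exists M; split; [exact: num_real|move=> N MN x _ /=; rewrite (le_trans (bM x))// ltW].
have iT : leb.-integrable setT (EFin \o b).
  have [H _] := @integrable_mkcond _ (measurableTypeR R) R leb I01 (EFin \o b) (@mI01 R).
  move: (H i1).
  congr (_.-integrable _ _); apply/funext => s /=; rewrite patchE.
  have [//|sI] := boolP (s \in _); rewrite bd// => /andP[ds s1].
  by move: sI; rewrite notin_setE/= in_itv/= (lt_trans d0 ds)/=; apply; lra.
have iall (y : R) : leb.-integrable `]-oo, y] (EFin \o b) by apply: integrableS iT.
pose G (x : R) := \int[leb]_(t in `]-oo, x]) b t.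
have dG (x : R) : is_derive x 1 G (b x).
  have x1 : x < x + 1 by rewrite ltrDl.
  have [dx ex] := @continuous_FTC1 R b -oo%O x (x + 1) x1 (iall (x + 1)) (ltNyr x) (cb x).
  by rewrite -ex derive1E; exact: derivableP.
have GE (s t : R) : s <= t -> \int[leb]_(x in `[s, t]) b x = G t - G s.
  by move=> st; exact: FTC2R st cb dG.
exists G; split => //.
- move=> s sd; rewrite /G /Rintegral (@eq_integral _ _ _ _ _ (cst 0%E)) ?integral0// => t /set_mem /=.
  rewrite in_itv/= => ts; rewrite bd//; lra.
- have z (u v : R) : 1 - d < u -> u <= v -> G v = G u.
    move=> du uv; apply/eqP; rewrite -subr_eq0 -GE//; apply/eqP.
    rewrite /Rintegral (@eq_integral _ _ _ _ _ (cst 0%E)) ?integral0// => t /set_mem /=.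
    rewrite in_itv/= => /andP[ut _]; rewrite bd//; lra.
  move=> s ds; have [s1|s1] := leP s 1; first by apply/esym/z.
  by apply: z => //; [lra|exact: ltW].
move=> s t st; split; last exact: GE.
by apply: integrableS iT.
Qed.

Lemma nice_antiderivative b : nice b -> exists P : R -> R,
  [/\ forall s : R, is_derive s 1 P (b s), exists2 r, r < 1 & forall s, r < s -> P s = 0 &
   forall s, 0 < s < 1 -> prim b s = P s].
Proof.
move=> nb; have [Cb [M bM] [d d01 bd]] := nb.
have [G [dG _ G0 GE]] := supported_antiderivative (Ck1_continuous (Cb 0%N)) bM d01 bd.
exists (fun s => G s - G 1); split.
- move=> s; apply: (is_derive_eq (is_derive_add (dG s) (is_derive_const (- G 1) s 1))).
  by rewrite addr0.
- by exists (1 - d); [move: d01 => /andP[]; lra|move=> s /G0 ->; rewrite subrr].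
move=> s /[dup] s01 /andP[s0 s1]; rewrite /prim s01 -opprB; congr (- _).
have [i <-] := GE _ _ (ltW s1).
rewrite Rintegral_itv_obnd_cbnd; last first.
  exact: (tail_integrable (nice_measurable nb) (nice_sq nb) s0).
by rewrite Rintegral_itv_bndo_bndc.
Qed.

(** Approximate f by smooth b_n supported inside []0, 1[]; their primitives composed with |x|^2 are
    test functions. *)
Lemma radial_H10g f : measurable_fun setT f -> sqI (wgt f) ->
  H10g (prim f \o @sq R) (psi1 f) (psi2 f).
Proof.
move=> mf sf; have [_ _ df] := dense_all mf sf.
have r0 n : 0 < (n.+1%:R^-1 : R) by rewrite invr_gt0.
have /choice[b bP] : forall n : nat, exists b, nice b /\ wdist f b < n.+1%:R^-1.
  by move=> n; have [b] := df _ (r0 n); exists b.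
have nb n := (bP n).1.
have /choice[P PP] := fun n => nice_antiderivative (nb n).
have dP n : forall s : R, is_derive s 1 (P n) (b n s) by case: (PP n).
have CP n k : Ck1 k (P n).
  have [Cb _ _] := nb n.
  by apply: Ck1W; exists (b n) => //; exact: dP.
have mb n := nice_measurable (nb n); have sb n := nice_sq (nb n).
have mfb n : measurable_fun setT (fun s => f s - b n s) by exact: measurable_funB.
have sfb n := wgt_sqB sf (sb n).
have mp n : measurable_fun setT (P n).
  by apply: continuous_measurable_fun; exact: Ck1_continuous (CP n 0%N).
have D1 n : 'D_(e1 R) (P n \o @sq R) = psi1 (b n).
  by apply/funext => x; case: (psi_derive1 (dP n) x).
have D2 n : 'D_(e2 R) (P n \o @sq R) = psi2 (b n).
  by apply/funext => x; case: (psi_derive2 (dP n) x).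
(* This one sequence bounds all three distances: the two gradient terms by the energy identity, the
   functions by the radial Poincare inequality. *)
have c0 : (fun n => (4 * kappa R) * wdist f (b n)) @ \oo --> (0 : R).
  rewrite -[X in _ --> X](mulr0 (4 * kappa R)); apply: cvgM; first exact: cvg_cst.
  apply: (@squeeze0 _ _ (fun n => n.+1%:R^-1)); last exact: cvg_harmonic.
  by move=> n; rewrite ger0_norm ?ip_ge0// ltW// (bP n).2.
have k0 := @kappa_gt0 R.
have En n : ipB (psi1 (fun s => f s - b n s)) (psi1 (fun s => f s - b n s)) +
    ipB (psi2 (fun s => f s - b n s)) (psi2 (fun s => f s - b n s)) = 4 * kappa R * wdist f (b n).
  exact: radial_energy.
split.
- exact: L2_radial (measurable_prim mf) (prim_sqI mf sf).
- exact: L2_psi1.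
- exact: L2_psi2.
exists (fun n => P n \o @sq R); split.
- move=> n; have [_ [r r1 rP] _] := PP n; exact: test_radial r1 (CP n) rP.
- apply: squeeze0 c0 => n; rewrite ger0_norm ?dist2_ge0//.
  have sp := prim_sqI (mfb n) (sfb n).
  have mpf : measurable_fun setT (fun s => prim f s - P n s).
    by apply: measurable_funB => //; exact: measurable_prim.
  have E s : I01 s -> prim f s - P n s = prim (fun t => f t - b n t) s.
    by move=> Is; have [_ _ <-//] := PP n; rewrite primB.
  have sfp : sqI (fun s => prim f s - P n s).
    apply: (sqint_le (@mI01 R) _ sp); first exact: measurable_funTS.
    by move=> s Is; rewrite E.
  rewrite /dist2 -[leLHS]/(ipB ((fun s => prim f s - P n s) \o @sq R) ((fun s => prim f s - P n s) \o @sq R)).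
  rewrite ip_radial//.
  have -> : ipI (fun s => prim f s - P n s) (fun s => prim f s - P n s) =
     ipI (prim (fun t => f t - b n t)) (prim (fun t => f t - b n t)).
    by apply: eq_Rintegral => s /set_mem Is; rewrite E.
  rewrite (mulrC 4) -mulrA ler_wpM2l ?(ltW k0)//. exact: (prim_ip_le (mfb n) (sfb n)).
- apply: squeeze0 c0 => n; rewrite ger0_norm ?dist2_ge0// -En D1.
  rewrite (_ : dist2 _ _ = ipB (psi1 (fun s => f s - b n s)) (psi1 (fun s => f s - b n s))).
    by rewrite lerDl ip_ge0.
  by congr ip; apply/funext => x; rewrite /psi1 mulrBl.
- apply: squeeze0 c0 => n; rewrite ger0_norm ?dist2_ge0// -En D2.
  rewrite (_ : dist2 _ _ = ipB (psi2 (fun s => f s - b n s)) (psi2 (fun s => f s - b n s))).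
    by rewrite lerDr ip_ge0.
  by congr ip; apply/funext => x; rewrite /psi2 mulrBl.
Qed.

End radial.

(** * Profiles of radial Sobolev functions *)

Section radial_integrals.
Variable R : realType.
Notation leb := (@lebesgue_measure R).
Notation I01 := (`]0, 1[%classic : set R).
Notation sqI := (@sqint _ (measurableTypeR R) R leb I01).
Notation ipI := (@ip _ (measurableTypeR R) R leb I01).
Notation B := (disk R).
Notation mu := (mu2 R).
Notation ipB := (ip mu B).

Lemma mu_radial (A : set R) : measurable A ->
  mu (B `&` (@sq R) @^-1` A) = ((kappa R)%:E * leb (I01 `&` A))%E.
Proof.
move=> mA; have := @polar R \1_A (measurable_indic mA) (fun s => ltac:(by rewrite indicE)).
have mA' : measurable ((@sq R) @^-1` A).
  by rewrite -[X in measurable X]setTI; exact: measurable_sq.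
have -> : (\int[leb]_(s in I01) (\1_A s)%:E = leb (I01 `&` A))%E.
  by rewrite integral_indic// setIC.
by move=> <-; have := @integral_indic _ _ R mu B (@mdisk R) _ mA'; rewrite setIC => <-.
Qed.

Lemma ae_radial (P : R -> Prop) : {ae leb, forall s, I01 s -> P s} ->
  {ae mu, forall x, B x -> P (sq x)}.
Proof.
case=> N [mN N0 NP]; pose N' := N `|` ~` I01.
have mN' : measurable N' by apply: measurableU => //; apply: measurableC; exact: mI01.
exists (B `&` (@sq R) @^-1` N'); split.
- apply: measurableI; first exact: mdisk.
  by rewrite -[X in measurable X]setTI; exact: measurable_sq.
- rewrite mu_radial// (_ : leb _ = 0%E) ?mule0//.
  apply/eqP; rewrite eq_le measure_ge0 andbT -N0.
  by apply: le_measure; rewrite ?inE//; [apply: measurableI => //; exact: mI01|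
    move=> x [Ix []]].
move=> x /= nP; have Bx : B x by apply: contrapT => nB; apply: nP => /nB.
split => //=; have [|] := pselect (I01 (sq x)); last by right.
by move=> Ix; left; apply: NP => /= H; apply: nP => _; exact: H.
Qed.

Lemma polar_integrable_conv (h : R -> R) : measurable_fun setT h ->
  mu.-integrable B (EFin \o (h \o @sq R)) -> leb.-integrable I01 (EFin \o h).
Proof.
move=> mh /integrableP[_ ih]; apply/integrableP; split.
  by apply/measurable_EFinP; exact: measurable_funTS.
have k0 := @kappa_gt0 R.
have mn : measurable_fun setT (fun s => `|h s|) by apply: measurableT_comp.
have := @polar R (fun s => `|h s|) mn (fun s => normr_ge0 _).
move=> E; move: ih; rewrite /= E => H.
rewrite -(@lte_pmul2l _ (kappa R)%:E) ?lte_fin//.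
by rewrite mulry gtr0_sg// mul1e.
Qed.

(** Reduced to the nonnegative case by h = (h + |h|) - |h|. *)
Lemma polar_signed (h : R -> R) : measurable_fun setT h -> leb.-integrable I01 (EFin \o h) ->
  mu.-integrable B (EFin \o (h \o @sq R)) /\
  \int[mu]_(x in B) h (sq x) = kappa R * \int[leb]_(s in I01) h s.
Proof.
move=> mh ih.
have mn : measurable_fun setT (fun s => `|h s|) by apply: measurableT_comp.
pose h1 s := h s + `|h s|.
have mh1 : measurable_fun setT h1 by exact: measurable_funD.
have h10 s : 0 <= h1 s by rewrite /h1 -lerBlDl sub0r -normrN ler_norm.
have i2 : leb.-integrable I01 (EFin \o (fun s => `|h s|)) by exact: (integrable_norm ih).
have i1 : leb.-integrable I01 (EFin \o h1) by exact: (integrableDR (@mI01 R) ih i2).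
have j1 := polar_integrable mh1 h10 i1.
have j2 := polar_integrable mn (fun s => normr_ge0 (h s)) i2.
have hE : h = fun s => h1 s - `|h s| by apply/funext => s; rewrite /h1 addrK.
have j : mu.-integrable B (EFin \o (fun x : R * R => h1 (sq x) - `|h (sq x)|)).
  exact: (@integrableBR _ _ R mu B (@mdisk R) _ _ j1 j2).
split; first by move: j; congr (_.-integrable _ _); apply/funext => x /=; rewrite /h1 addrK.
transitivity (\int[mu]_(x in B) (h1 (sq x) - `|h (sq x)|)).
  by apply: eq_Rintegral => x _; rewrite /h1 addrK.
rewrite (@RintegralB _ _ R mu B _ _ (@mdisk R))//.
have := polarR mh1 h10 i1 => /= ->.
have := polarR mn (fun s => normr_ge0 (h s)) i2 => /= ->.
rewrite -mulrBr -(@RintegralB _ (measurableTypeR R) R leb I01 _ _ (@mI01 R))//.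
by congr (_ * _); apply: eq_Rintegral => s _; rewrite /h1 addrK.
Qed.

(** Plays the role of integrating G over circles. The image under |x|^2 of the signed measure G dx
    is absolutely continuous, since preimages of null sets are null, and p is its Radon-Nikodym
    density. *)
Lemma radial_density (G : R * R -> R) : mu.-integrable B (EFin \o G) ->
  exists p : R -> R, leb.-integrable setT (EFin \o p) /\
  forall A, measurable A ->
    (\int[mu]_(x in B `&` (@sq R) @^-1` A) (G x)%:E = \int[leb]_(s in A) (p s)%:E)%E.
Proof.
move=> iG.
have iT : mu.-integrable setT ((EFin \o G) \_ B).
  by have [H _] := @integrable_mkcond _ _ R mu B (EFin \o G) (@mdisk R); exact: H.
have msq : @measurable_fun _ _ _ (measurableTypeR R) setT (@sq R) := @measurable_sq R.
pose nu : {charge set (measurableTypeR R) -> \bar R} :=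
  measure_function_pushforward__canonical__charge_Charge (induced_charge iT) msq.
have mB := @mdisk R.
have nuE A : measurable A -> nu A = (\int[mu]_(x in B `&` (@sq R) @^-1` A) (G x)%:E)%E.
  move=> mA; rewrite setIC integral_mkcondr//.
have dom : nu `<< leb.
  apply/null_content_dominatesP => A mA A0; rewrite nuE//.
  have mBA : measurable (B `&` (@sq R) @^-1` A).
    by apply: measurableI => //; rewrite -[X in measurable X]setTI; exact: measurable_sq.
  apply: (@null_set_integral _ _ R mu) => //.
    by apply/measurable_EFinP; apply: (measurable_funS mB _ (integrable_mfun iG)) => x [].
  apply: (eq_trans (mu_radial mA)); rewrite (_ : leb _ = 0%E) ?mule0//.
  apply/eqP; rewrite eq_le measure_ge0 andbT -A0.
  by apply: le_measure; rewrite ?inE//; apply: measurableI => //; exact: mI01.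
exists (fine \o Radon_Nikodym nu leb); split.
  have := Radon_Nikodym_integrable dom; congr (_.-integrable _ _); apply/funext => s.
  by rewrite /= fineK// Radon_Nikodym_fin_num.
move=> A mA; rewrite -nuE// (Radon_Nikodym_integral dom mA).
by apply: eq_integral => s _; rewrite /= fineK// Radon_Nikodym_fin_num.
Qed.

End radial_integrals.

(** * Radial vector fields *)

Section field.
Variable R : realType.
Notation leb := (@lebesgue_measure R).
Notation I01 := (`]0, 1[%classic : set R).
Notation sqI := (@sqint _ (measurableTypeR R) R leb I01).
Notation ipI := (@ip _ (measurableTypeR R) R leb I01).
Notation B := (disk R).
Notation mu := (mu2 R).
Notation ipB := (ip mu B).

Let cfst : continuous (fun x : R * R => x.1). Proof. by move=> x; exact: cvg_fst. Qed.
Let csnd : continuous (fun x : R * R => x.2). Proof. by move=> x; exact: cvg_snd. Qed.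
Let cM (f g : R * R -> R) : continuous f -> continuous g -> continuous (fun x => f x * g x).
Proof. by move=> cf cg x; apply: cvgM; [exact: cf|exact: cg]. Qed.
Let cD (f g : R * R -> R) : continuous f -> continuous g -> continuous (fun x => f x + g x).
Proof. by move=> cf cg x; apply: cvgD; [exact: cf|exact: cg]. Qed.
Let cC (c : R) : continuous (fun _ : R * R => c). Proof. by move=> x; exact: cvg_cst. Qed.
Let csq (F : R -> R) : continuous F -> continuous (fun x : R * R => F (sq x)).
Proof. by move=> cF x; apply: continuous_comp; [exact: continuous_sq|exact: cF]. Qed.

(* The divergence of [k(|x|^2) x] is [2 (k + s k')] at [s = |x|^2]. *)
Lemma radial_field (k k' : R -> R) (u g1 g2 : R * R -> R) :
  (forall s : R, is_derive s 1 k (k' s)) -> continuous k' -> H10g u g1 g2 ->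
  ipB u (fun x => 2 * (k (sq x) + sq x * k' (sq x))) =
  - (ipB g1 (fun x => x.1 * k (sq x)) + ipB g2 (fun x => x.2 * k (sq x))).
Proof.
move=> dk ck' [su s1 s2 [phi [tp cu c1 c2]]].
have ck : continuous k by move=> s; exact: is_derive_cont (dk s).
pose D (x : R * R) := 2 * (k (sq x) + sq x * k' (sq x)).
pose X1 (x : R * R) := x.1 * k (sq x); pose X2 (x : R * R) := x.2 * k (sq x).
pose D1 (x : R * R) := x.1 * (k' (sq x) * (2 * x.1)) + k (sq x).
pose D2 (x : R * R) := x.2 * (k' (sq x) * (2 * x.2)) + k (sq x).
have cX1 : continuous X1 := cM cfst (csq ck).
have cX2 : continuous X2 := cM csnd (csq ck).
have cD1 : continuous D1 := cD (cM cfst (cM (csq ck') (cM (@cC 2) cfst))) (csq ck).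
have cD2 : continuous D2 := cD (cM csnd (cM (csq ck') (cM (@cC 2) csnd))) (csq ck).
have DE x : D1 x + D2 x = D x by rewrite /D1 /D2 /D /sq; ring.
have dX1 x : is_derive x (e1 R) X1 (D1 x).
  apply: (is_derive_eq (is_derive_mul (is_derive_fst1 x) (is_derive_compR (dk (sq x)) (is_derive_sq1 x)))).
  by rewrite /D1 /=; ring.
have dX2 x : is_derive x (e2 R) X2 (D2 x).
  apply: (is_derive_eq (is_derive_mul (is_derive_snd2 x) (is_derive_compR (dk (sq x)) (is_derive_sq2 x)))).
  by rewrite /D2 /=; ring.
have sD1 : L2 D1 by exact: continuous_L2.
have sD2 : L2 D2 by exact: continuous_L2.
have sX1 : L2 X1 by exact: continuous_L2.
have sX2 : L2 X2 by exact: continuous_L2.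
have E n : ipB (phi n) D = - (ipB ('D_(e1 R) (phi n)) X1 + ipB ('D_(e2 R) (phi n)) X2).
  have tn := tp n; have [r r1 vr] := test_vanish tn; have cn := test_continuous tn.
  have d1 x := test_derive1 x tn; have d2 x := test_derive2 x tn.
  have v1 (X : R * R -> R) : vanish r (fun x => phi n x * X x).
    by move=> x rx; rewrite vr// mul0r.
  have i1 : \int[mu]_(x in B) (phi n x * D1 x + 'D_(e1 R) (phi n) x * X1 x) = 0.
    apply: (int_deriv1 r1 (v1 X1)).
      exact: cD (cM cn cD1) (cM (test_continuous1 tn) cX1).
    move=> x; apply: (is_derive_eq (is_derive_mul (d1 x) (dX1 x))); ring.
  have i2 : \int[mu]_(x in B) (phi n x * D2 x + 'D_(e2 R) (phi n) x * X2 x) = 0.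
    apply: (int_deriv2 r1 (v1 X2)).
      exact: cD (cM cn cD2) (cM (test_continuous2 tn) cX2).
    move=> x; apply: (is_derive_eq (is_derive_mul (d2 x) (dX2 x))); ring.
  have sn := test_L2 tn; have sn1 := test_L21 tn; have sn2 := test_L22 tn.
  rewrite (diskI_D (L2_mul sn sD1) (L2_mul sn1 sX1)) in i1.
  rewrite (diskI_D (L2_mul sn sD2) (L2_mul sn2 sX2)) in i2.
  have -> : ipB (phi n) D = ipB (phi n) D1 + ipB (phi n) D2.
    rewrite -(@ipDr _ _ R mu B (@mdisk R) D1 D2 (phi n) sD1 sD2 sn).
    by congr ip; apply/funext => x; rewrite DE.
  by move: i1 i2; rewrite /ip; lra.
have sD : L2 D.
  have -> : D = fun x => D1 x + D2 x by apply/funext => x; rewrite DE.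
  exact: L2_add.
have a := @ip_cvgl _ _ R mu B (@mdisk R) u D phi su sD (fun n => test_L2 (tp n)) cu.
have a1 := @ip_cvgl _ _ R mu B (@mdisk R) g1 X1 (fun n => 'D_(e1 R) (phi n)) s1 sX1
  (fun n => test_L21 (tp n)) c1.
have a2 := @ip_cvgl _ _ R mu B (@mdisk R) g2 X2 (fun n => 'D_(e2 R) (phi n)) s2 sX2
  (fun n => test_L22 (tp n)) c2.
have b := cvgN (cvgD a1 a2).
apply: (cvg_unique _ a) => /=; first exact: Rhausdorff.
by under eq_fun do rewrite E; exact: b.
Qed.

(** The equation reads (s k)' = b, solved by k = G / s with G the antiderivative of b that vanishes
    below d; division by s is therefore harmless at 0. *)
Lemma quotient_field (b : R -> R) (d M : R) : continuous b ->
  (forall s, `|b s| <= M) -> 0 < d < 1 -> (forall s, ~ (d < s < 1 - d) -> b s = 0) ->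
  exists k k' : R -> R, [/\ forall s : R, is_derive s 1 k (k' s), continuous k', k 0 = 0 &
    forall s, k s + s * k' s = b s].
Proof.
move=> cb bM d01 bd; have [G [dG G0 _ _]] := supported_antiderivative cb bM d01 bd.
have /andP[d0 d1] := d01.
have cG : continuous G by move=> s; exact: is_derive_cont (dG s).
pose k' s := (b s * s - G s) * (s^-1 * s^-1).
have near0 (s : R) : s < d -> \forall t \near s, t < d.
  by move=> sd; exact: (lt_nbhsl sd).
exists (fun s => G s * s^-1), k'; split.
- move=> s; have [sd|ds] := ltP s d.
    have -> : k' s = 0 by rewrite /k' G0// bd ?mul0r ?subr0 ?mul0r//; lra.
    apply: (near_eq_is_derive _ (is_derive_const 0 s 1)).
    by near do rewrite G0 ?mul0r//; exact: near0.
  have s0 : s != 0 by rewrite gt_eqF// (lt_le_trans d0).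
  have dV : is_derive s 1 (fun t : R => t^-1) (- s ^- 2).
    by have := is_deriveV s0 (is_derive_id s 1); rewrite [_ *: _]mulr1.
  apply: (is_derive_eq (is_derive_mul (dG s) dV)).
  by rewrite /k'; field.
- move=> s; have [sd|ds] := ltP s d.
    apply: (@cvg_trans _ ((fun=> k' s) @ nbhs s)); last exact: cvg_cst.
    apply: near_eq_cvg; near=> t.
    have td : t < d by near: t; exact: near0.
    by rewrite /k' !G0// !bd ?mul0r ?subr0 ?mul0r//; lra.
  have s0 : s != 0 by rewrite gt_eqF// (lt_le_trans d0).
  have cV : (fun t : R => t^-1) @ s --> s^-1 by exact: inv_continuous.
  apply: cvgM; last exact: cvgM.
  by apply: cvgB; [apply: cvgM; [exact: cb|exact: cvg_id]|exact: cG].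
- by rewrite G0// mul0r.
move=> s; have [->|s0] := eqVneq s 0.
  by rewrite G0// !mul0r addr0 bd//; lra.
by rewrite /k'; field.
Unshelve. all: by end_near.
Qed.

End field.

(** * Recovering the derivative of the profile and its energy *)

Section represent.
Variable R : realType.
Notation leb := (@lebesgue_measure R).
Notation I01 := (`]0, 1[%classic : set R).
Notation sqI := (@sqint _ (measurableTypeR R) R leb I01).
Notation ipI := (@ip _ (measurableTypeR R) R leb I01).
Notation B := (disk R).
Notation mu := (mu2 R).
Notation ipB := (ip mu B).

Lemma bounded_mul_integrable d (T : measurableType d) (m : {measure set T -> \bar R}) (D : set T)
    (f h : T -> R) M : measurable D -> m.-integrable D (EFin \o f) -> measurable_fun D h ->
  (forall x, D x -> `|h x| <= M) -> m.-integrable D (EFin \o (fun x => f x * h x)).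
Proof.
move=> mD iF mh hM; apply: (@le_integrableR _ _ _ _ _ mD _ (fun x => M * `|f x|)).
- by apply: measurable_funM => //; exact: integrable_mfun iF.
- by apply: integrableZR => //; exact: (integrable_norm iF).
by move=> x Dx; rewrite normrM mulrC ler_wpM2r// hM.
Qed.

Section density.
Variables (G : R * R -> R) (p : R -> R).
Hypotheses (iG : mu.-integrable B (EFin \o G)) (ip_ : leb.-integrable setT (EFin \o p)).
Hypothesis Gp : forall A, measurable A ->
  (\int[mu]_(x in B `&` (@sq R) @^-1` A) (G x)%:E = \int[leb]_(s in A) (p s)%:E)%E.

Lemma radial_density_fun (h : R -> R) (M : R) : measurable_fun setT h ->
  (forall s, `|h s| <= M) ->
  \int[mu]_(x in B) (G x * h (sq x)) = \int[leb]_(s in setT) (p s * h s).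
Proof.
move=> mh hM.
have mB := @mdisk R.
have iGh (g : R -> R) (N : R) : measurable_fun setT g -> (forall s, `|g s| <= N) ->
    mu.-integrable B (EFin \o (fun x => G x * g (sq x))).
  move=> mg gN; apply: (@bounded_mul_integrable _ _ mu B G (g \o @sq R) N mB iG).
    by apply: measurable_funTS; exact: measurable_radial.
  by move=> x _; exact: gN.
have iph (g : R -> R) (N : R) : measurable_fun setT g -> (forall s, `|g s| <= N) ->
    leb.-integrable setT (EFin \o (fun s => p s * g s)).
  by move=> mg gN; apply: (@bounded_mul_integrable _ (measurableTypeR R) leb setT p g N).
pose P (g : R -> R) := [/\ measurable_fun setT g, exists N, forall s, `|g s| <= N &
  \int[mu]_(x in B) (G x * g (sq x)) = \int[leb]_(s in setT) (p s * g s)].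
suff [] : P h by [].
apply: (@measurable_fun_induction R P h mh).
- move=> A mA; split; first exact: measurable_indic.
    by exists 1 => s; rewrite indicE ger0_norm//; case: (_ \in _).
  have := congr1 fine (Gp mA).
  rewrite integral_mkcondr.
  rewrite [X in _ = fine X -> _]integral_mkcond => E.
  transitivity (fine (\int[mu]_(x in B) ((fun x => (G x)%:E) \_ ((@sq R) @^-1` A)) x)).
    congr fine; apply: eq_integral => x _; rewrite patchE indicE.
    rewrite (_ : (x \in _) = (sq x \in A)); first by case: ifP; rewrite ?mulr1 ?mulr0.
    by apply/idP/idP; rewrite !inE.
  rewrite E; congr fine; apply: eq_integral => s _; rewrite patchE indicE.
  by case: ifP; rewrite ?mulr1 ?mulr0.
- move=> g1 g2 [m1 [N1 b1] E1] [m2 [N2 b2] E2]; split; first exact: measurable_funD.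
    by exists (N1 + N2) => s; rewrite (le_trans (ler_normD _ _))// lerD.
  under eq_Rintegral do rewrite mulrDr.
  rewrite diskI_D; [|exact: iGh m1 b1|exact: iGh m2 b2].
  under [in RHS]eq_Rintegral do rewrite mulrDr.
  rewrite (@RintegralD _ (measurableTypeR R) R leb setT)// ?E1 ?E2//;
    [exact: iph m1 b1|exact: iph m2 b2].
- move=> c g [m1 [N1 b1] E1]; split; first exact: measurable_funM.
    by exists (`|c| * N1) => s; rewrite normrM ler_wpM2l.
  under eq_Rintegral do rewrite mulrCA.
  rewrite diskI_Z; last exact: iGh m1 b1.
  under [in RHS]eq_Rintegral do rewrite mulrCA.
  by rewrite (@RintegralZl _ (measurableTypeR R) R leb setT)// ?E1//; exact: iph m1 b1.
move=> g_ g mg gh Pg cg gg; split => //; first by exists M => s; rewrite (le_trans (gh s)).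
have gM n s : `|g_ n s| <= M by rewrite (le_trans (gg n s))// (le_trans (gh s)).
have mg_ n : measurable_fun setT (g_ n) by case: (Pg n).
have E n : \int[mu]_(x in B) (G x * g_ n (sq x)) = \int[leb]_(s in setT) (p s * g_ n s).
  by case: (Pg n).
have [||||_ c1] := @dominatedR _ _ R mu B (fun n x => G x * g_ n (sq x)) (fun x => G x * g (sq x))
  (fun x => M * `|G x|) mB.
- move=> n; apply: measurable_funM; first exact: (integrable_mfun iG).
  by apply: measurable_funTS; exact: measurable_radial.
- by move=> x _; apply: cvgM; [exact: cvg_cst|exact: cg].
- by apply: (@integrableZR _ _ R mu B mB); exact: (integrable_norm iG).
- by move=> n x _; rewrite normrM mulrC ler_wpM2r.
have mp : measurable_fun setT p by exact: (integrable_mfun ip_).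
have [||||_ c2] := @dominatedR _ (measurableTypeR R) R leb setT (fun n s => p s * g_ n s)
  (fun s => p s * g s) (fun s => M * `|p s|) measurableT.
- by move=> n; exact: (measurable_funM mp (mg_ n)).
- by move=> x _; apply: cvgM; [exact: cvg_cst|exact: cg].
- by apply: (@integrableZR _ (measurableTypeR R)) => //; exact: (integrable_norm ip_).
- by move=> n x _; rewrite normrM mulrC ler_wpM2r.
have EE : (fun n => \int[mu]_(x in B) (G x * g_ n (sq x))) =
  (fun n => \int[leb]_(s in setT) (p s * g_ n s)) by apply/funext.
by move: c1; rewrite EE => c1; exact: (cvg_unique (@Rhausdorff R) c1 c2).
Qed.

End density.

(** The weighted density theorem is applied to f = s^(-1/2) W, for which [wgt f] is W, so that W is
    approximated in plain L^2 by functions orthogonal to it. *)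
Lemma weak_zero (W : R -> R) : measurable_fun setT W -> sqI W ->
  (forall (b : R -> R) (d M : R), continuous b -> (forall s, `|b s| <= M) -> 0 < d < 1 ->
    (forall s, ~ (d < s < 1 - d) -> b s = 0) -> ipI W b = 0) ->
  {ae leb, forall s, I01 s -> W s = 0}.
Proof.
move=> mW sW H.
pose f s := s `^ (- 2^-1) * W s.
have mf : measurable_fun setT f by apply: measurable_funM => //; exact: measurable_powR.
have fE s : I01 s -> wgt f s = W s.
  rewrite /= in_itv/= => /andP[s0 _].
  rewrite /wgt /f -powR12_sqrt ?ltW// mulrA -powRD; last by apply/implyP => _; rewrite gt_eqF.
  by rewrite subrr powRr0 mul1r.
have sf : sqI (wgt f).
  apply: (sqint_le (@mI01 R) _ sW); first by apply: measurable_funTS; exact: measurable_wgt.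
  by move=> s Is; rewrite fE.
have [_ _ df] := dense_all mf sf.
suff W0 : ipI W W = 0 by exact: (ip_eq0 (@mI01 R) sW W0).
apply/eqP; rewrite eq_le ip_ge0 andbT; apply/ler_addgt0Pr => e e0; rewrite add0r.
have [b nb fb] := df _ e0; have [Cb [M bM] [d d01 bd]] := nb.
have sb := nice_sq nb.
have Wb : ipI W (wgt b) = 0.
  apply: (H _ d M) => //.
  - move=> s; apply: cvgM; [exact: sqrt_continuous|exact: (Ck1_continuous (Cb 0%N))].
  - move=> s; rewrite /wgt normrM; have [s1|s1] := leP s 1.
      have : `|Num.sqrt s| <= 1 by rewrite ger0_norm ?sqrtr_ge0// -sqrtr1 ler_wsqrtr.
      by have := bM s; have := normr_ge0 (b s); have := normr_ge0 (Num.sqrt s); nra.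
    rewrite bd ?normr0 ?mulr0 ?(le_trans _ (bM 0))// => /andP[? ?].
    by move/andP: d01 => []; lra.
  - by move=> s h; rewrite /wgt bd ?mulr0.
have sfb := wgt_sqB sf sb.
have WE : ipI W W = ipI W (wgt (fun s => f s - b s)).
  transitivity (ipI W W - ipI W (wgt b)); first by rewrite Wb subr0.
  rewrite -(ipBr (@mI01 R) sW sb sW).
  by apply: eq_Rintegral => s /set_mem Is; rewrite -(fE _ Is); congr (_ * _); rewrite /wgt -mulrBr.
(* Since |W|^2 = <W, W - wgt b>, this gives |W|^2 <= |W - wgt b|^2 < e. *)
have := ip_CauchySchwarz (@mI01 R) sW sfb.
rewrite -WE -/(wdist f b); have := ip_ge0 leb I01 W; move: fb.
by move: (ipI W W) (wdist f b) => x y; nra.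
Qed.

Section energy.
Variables (g1 g2 : R * R -> R) (p : R -> R) (E : R).
Hypotheses (s1 : L2 g1) (s2 : L2 g2) (ip_ : leb.-integrable setT (EFin \o p)).
Hypothesis EE : ipB g1 g1 + ipB g2 g2 <= E.
Hypothesis iG : mu.-integrable B (EFin \o (fun x => x.1 * g1 x + x.2 * g2 x)).
Hypothesis Gp : forall A, measurable A ->
  (\int[mu]_(x in B `&` (@sq R) @^-1` A) (x.1 * g1 x + x.2 * g2 x)%:E = \int[leb]_(s in A) (p s)%:E)%E.

Let mp : measurable_fun setT p. Proof. exact: (integrable_mfun ip_). Qed.

(** The region where p/s is bounded by N (N + 1). Truncating to it makes p/s an admissible bounded
    multiplier before its square integrability is known. *)
Let S N := [set s | N.+1%:R^-1 < s < 1] `&` [set s | `|p s| < N%:R].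
Let h N s := p s * s `^ (-1) * \1_(S N) s.

Let mS N : measurable (S N).
Proof.
apply: measurableI.
  have -> : [set s : R | N.+1%:R^-1 < s < 1] = `]N.+1%:R^-1, 1[%classic.
    by apply/seteqP; split => s /=; rewrite in_itv.
  exact: measurable_itv.
by apply: measurable_ltset; [apply: measurableT_comp|exact: measurable_cst].
Qed.

Let mh N : measurable_fun setT (h N).
Proof.
apply: measurable_funM; last exact: measurable_indic.
by apply: measurable_funM => //; exact: measurable_powR.
Qed.

Let hM N s : `|h N s| <= N%:R * N.+1%:R.
Proof.
rewrite /h indicE; have [/set_mem[/= /andP[sN s1'] pN]|_] := boolP (s \in S N); last first.
  by rewrite mulr0 normr0 mulr_ge0.
have N0 : (0 : R) < N.+1%:R^-1 by rewrite invr_gt0.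
have s0 := lt_trans N0 sN.
rewrite mulr1 normrM (powR_inv1 (ltW s0)); apply: ler_pM => //; first exact: ltW.
rewrite normfV (ger0_norm (ltW s0)) -(invrK N.+1%:R) lef_pV2 ?posrE//; exact: ltW.
Qed.

Let X N := \int[leb]_(s in setT) (p s * h N s).

Let ph_ge0 N s : 0 <= p s * h N s.
Proof.
rewrite /h !mulrA -expr2; apply: mulr_ge0; last by rewrite indicE.
by rewrite mulr_ge0 ?sqr_ge0 ?powR_ge0.
Qed.

Let iph N : leb.-integrable setT (EFin \o (fun s => p s * h N s)).
Proof. exact: (@bounded_mul_integrable _ (measurableTypeR R) leb setT p (h N) _ measurableT ip_ (mh N) (fun s _ => hM N s)). Qed.

Let X_I N : X N = \int[leb]_(s in I01) (p s * h N s).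
Proof.
rewrite /X /Rintegral [in RHS]integral_mkcond; congr fine; apply: eq_integral => s _.
rewrite patchE; case: ifPn => //; rewrite notin_setE/= in_itv/= => sI.
rewrite /h indicE; have [/set_mem[/= /andP[sN s1'] pN]|_] := boolP (s \in S N); last by rewrite !mulr0.
by exfalso; apply: sI; rewrite s1' andbT (lt_trans _ sN)// invr_gt0.
Qed.

(* Young's inequality, with the weight for which the second term is half of the left-hand side *)
Let X_le N : X N <= kappa R * E.
Proof.
have k0 := @kappa_gt0 R.
have mB := @mdisk R.
have XG := @radial_density_fun _ p iG ip_ Gp (h N) _ (mh N) (hM N).
have mhs : measurable_fun setT (fun s : R => s * h N s ^+ 2).
  by apply: measurable_funM => //; exact: measurable_funX.
have hh (s : R) : I01 s -> s * h N s ^+ 2 = p s * h N s.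
  rewrite /= in_itv/= => /andP[s0 _]; rewrite /h powR_inv1 ?ltW// indicE.
  case: (s \in _) => /=; last by rewrite !mulr0 expr0n/= !mulr0.
  by field; rewrite gt_eqF.
have iI : leb.-integrable I01 (EFin \o (fun s => p s * h N s)).
  by apply: integrableS (iph N) => //; exact: mI01.
have ihs : leb.-integrable I01 (EFin \o (fun s => s * h N s ^+ 2)).
  apply: (@le_integrableR _ _ _ _ _ (@mI01 R) _ _ _ iI); first exact: measurable_funTS.
  by move=> s Is; rewrite hh// ger0_norm// ph_ge0.
have [j Ej] := polar_signed mhs ihs.
have Xj : \int[mu]_(x in B) (sq x * h N (sq x) ^+ 2) = kappa R * X N.
  rewrite Ej X_I; congr (_ * _); apply: eq_Rintegral => s /set_mem; exact: hh.
have iGh : mu.-integrable B (EFin \o (fun x => (x.1 * g1 x + x.2 * g2 x) * h N (sq x))).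
  apply: (@bounded_mul_integrable _ _ mu B _ (h N \o @sq R) _ mB iG); last by move=> x _; exact: hM.
  by apply: measurable_funTS; exact: measurable_radial.
have i11 : mu.-integrable B (EFin \o (fun x => g1 x * g1 x)) := L2_mul s1 s1.
have i22 : mu.-integrable B (EFin \o (fun x => g2 x * g2 x)) := L2_mul s2 s2.
have i12 := @integrableDR _ _ R mu B mB _ _ i11 i22.
have i3 := @integrableZR _ _ R mu B mB (kappa R / 2) _ i12.
have i4 := @integrableZR _ _ R mu B mB (2 * kappa R)^-1 _ j.
have H : X N <= kappa R / 2 * E + (2 * kappa R)^-1 * (kappa R * X N).
  rewrite {1}/X -XG -Xj.
  apply: (@le_trans _ _ (kappa R / 2 * (ipB g1 g1 + ipB g2 g2) +
     (2 * kappa R)^-1 * \int[mu]_(x in B) (sq x * h N (sq x) ^+ 2))); last first.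
    by rewrite lerD2r ler_wpM2l// divr_ge0// ltW.
  rewrite /ip -(diskI_D i11 i22) -(diskI_Z _ i12) -(diskI_Z _ j) -(diskI_D i3 i4).
  apply: (diskI_le iGh); first exact: (@integrableDR _ _ R mu B mB _ _ i3 i4).
  move=> x _ /=; rewrite -subr_ge0 /sq; move: (h N _) (g1 x) (g2 x) (kappa R) k0 => t a b k k0.
  rewrite [leRHS](_ : _ = (2 * k)^-1 * ((k * a - x.1 * t) ^+ 2 + (k * b - x.2 * t) ^+ 2)); last first.
    by field; rewrite gt_eqF.
  by rewrite mulr_ge0 ?addr_ge0 ?sqr_ge0// invr_ge0 mulr_ge0// ltW.
have E2 : (2 * kappa R)^-1 * (kappa R * X N) = X N / 2 by field; rewrite gt_eqF.
by move: H; rewrite E2; lra.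
Qed.

(** For u = F(|x|^2) with F' = f one has x . grad u = 2 s f, whose image density is p = 2 kappa s f;
    this dictates f. Its energy is a multiple of the integral of p^2 / s, bounded uniformly over the
    truncations by [X_le], and Fatou's lemma removes the truncation. *)
Lemma density_energy : sqI (wgt (fun s => (2 * kappa R)^-1 * (p s * s `^ (-1)))).
Proof.
have k0 := @kappa_gt0 R.
have mI := @mI01 R.
pose f (s : R) := (2 * kappa R)^-1 * (p s * s `^ (-1)); change (sqI (wgt f)).
have mf : measurable_fun setT f.
  by apply: measurable_funM => //; apply: measurable_funM => //; exact: measurable_powR.
split; first by apply: measurable_funTS; exact: measurable_wgt.
pose q (s : R) := p s * (p s * s `^ (-1)).
have mq : measurable_fun setT q.
  by apply: measurable_funM => //; apply: measurable_funM => //; exact: measurable_powR.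
have q0 s : 0 <= q s by rewrite /q mulrA -expr2 mulr_ge0 ?sqr_ge0 ?powR_ge0.
have wq (s : R) : I01 s -> wgt f s ^+ 2 = (2 * kappa R)^-1 ^+ 2 * q s.
  rewrite /= in_itv/= => /andP[s0 _].
  rewrite /wgt exprMn sqr_sqrtr ?ltW// /f /q powR_inv1 ?ltW//.
  by field; rewrite !gt_eqF.
suff iq : leb.-integrable I01 (EFin \o q).
  apply: (@le_integrableR _ _ _ _ _ mI _ _ _ (integrableZR mI ((2 * kappa R)^-1 ^+ 2) iq)).
    by apply: measurable_funTS; apply: measurable_funX; exact: measurable_wgt.
  by move=> s Is; rewrite wq// ger0_norm// mulr_ge0 ?sqr_ge0.
apply/integrableP; split; first by apply/measurable_EFinP; exact: measurable_funTS.
under eq_integral do rewrite gee0_abs ?lee_fin ?q0//.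
pose g N (s : R) := (p s * h N s)%:E.
have cg (s : R) : I01 s -> g n s @[n --> \oo] --> (q s)%:E.
  rewrite /= in_itv/= => /andP[s0 s1'].
  apply: cvg_EFin; first exact: nearW.
  have -> : q s = p s * (p s * s `^ (-1) * \1_(setT : set R) s) by rewrite indicT mulr1.
  apply: cvgM; first exact: cvg_cst.
  apply: cvgM; first exact: cvg_cst.
  pose K := (Num.truncn (Num.max s^-1 `|p s|)).+1.
  apply: (@cvg_indic_eventually _ _ _ _ _ K) => n Kn; split => // _.
  have h' : Num.max s^-1 `|p s| < n%:R.
    by apply: (lt_le_trans (Num.Theory.truncnS_gt _)); rewrite ler_nat.
  move: h'; rewrite gt_max => /andP[h1 h2]; split => //=.
  rewrite s1' andbT invf_plt ?posrE// (lt_trans h1)// ltr_nat.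
  exact: ltnSn.
have mg n : measurable_fun I01 (g n).
  by apply/measurable_EFinP; apply: measurable_funTS; exact: measurable_funM.
have g0 n x : I01 x -> (0 <= g n x)%E by move=> _; rewrite lee_fin ph_ge0.
have := @fatou _ (measurableTypeR R) R leb I01 mI g mg g0.
have -> : (\int[leb]_(x in I01) limn_einf (g ^~ x) = \int[leb]_(x in I01) (q x)%:E)%E.
  by apply: eq_integral => s /set_mem Is; exact: (cvg_limn_einf_sup (cg s Is)).1.
move=> H; apply: (le_lt_trans H); apply: (@le_lt_trans _ _ (kappa R * E)%:E); last exact: ltry.
rewrite limn_einf_lim; apply: lime_le; first exact: is_cvg_einfs.
apply: nearW => n; apply: (@le_trans _ _ (\int[leb]_(x in I01) g n x)%E).
  by apply: ereal_inf_lbound; exists n => /=.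
have -> : (\int[leb]_(x in I01) g n x)%E = (X n)%:E.
  rewrite X_I /Rintegral fineK//; apply: (integrable_fin_num mI).
  by apply: integrableS (iph n).
by rewrite lee_fin.
Qed.

End energy.

End represent.

Section represent.
Variable R : realType.
Notation leb := (@lebesgue_measure R).
Notation I01 := (`]0, 1[%classic : set R).
Notation sqI := (@sqint _ (measurableTypeR R) R leb I01).
Notation ipI := (@ip _ (measurableTypeR R) R leb I01).
Notation B := (disk R).
Notation mu := (mu2 R).
Notation ipB := (ip mu B).

Lemma profile_measurable (v : R -> R) : measurable_fun (`[0, 1[%classic : set R) v ->
  measurable_fun setT (fun s : R => if 0 <= s < 1 then v (Num.sqrt s) else 0).
Proof.
move=> mv.
have mI : measurable (`[0, 1[%classic : set (measurableTypeR R)) := measurable_itv _.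
have ms : measurable_fun (`[0, 1[%classic : set R) (v \o @Num.sqrt R).
  apply: (measurable_comp mI _ mv); last by apply: measurable_funTS; exact: measurable_sqrt.
  move=> _ [s /= + <-]; rewrite !in_itv/= => /andP[s0 s1]; rewrite sqrtr_ge0/=.
  by rewrite -[ltRHS]sqrtr1 ltr_sqrt.
have := (measurable_restrictT (v \o @Num.sqrt R) mI).1 ms.
congr measurable_fun; apply/funext => s; rewrite patchE.
by rewrite (_ : (s \in _) = (0 <= s < 1))//; apply/idP/idP; rewrite inE/= in_itv.
Qed.

Lemma radial_represent u g1 g2 v : H10g u g1 g2 -> is_profile u v ->
  exists f : R -> R, [/\ measurable_fun setT f, sqI (wgt f),
    {ae leb, forall s, I01 s -> v (Num.sqrt s) = prim f s} &
    {ae mu, forall x, B x -> u x = prim f (sq x)}].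
Proof.
move=> Hu [mv uv]; have [su s1 s2 _] := Hu.
have k0 := @kappa_gt0 R; have mB := @mdisk R; have mI := @mI01 R.
have sfst : L2 (fun x : R * R => x.1) by apply: continuous_L2 => x; exact: cvg_fst.
have ssnd : L2 (fun x : R * R => x.2) by apply: continuous_L2 => x; exact: cvg_snd.
have iG : mu.-integrable B (EFin \o (fun x => x.1 * g1 x + x.2 * g2 x)).
  exact: (@integrableDR _ _ R mu B mB _ _ (L2_mul sfst s1) (L2_mul ssnd s2)).
have [p [ip_ Gp]] := radial_density iG.
have mp : measurable_fun setT p := integrable_mfun ip_.
pose f (s : R) := (2 * kappa R)^-1 * (p s * s `^ (-1)).
have mf : measurable_fun setT f.
  by apply: measurable_funM => //; apply: measurable_funM => //; exact: measurable_powR.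
have sf : sqI (wgt f) := density_energy s1 s2 ip_ (lexx _) iG Gp.
pose V (s : R) := if 0 <= s < 1 then v (Num.sqrt s) else 0.
have mV : measurable_fun setT V := profile_measurable mv.
have uV : {ae mu, forall x, B x -> u x = V (sq x)}.
  apply: ae_imp uv => x ux Bx; rewrite (ux Bx) /V sq_ge0/=.
  by move/diskE: (Bx) => ->.
have mVs : measurable_fun B (V \o @sq R) by apply: measurable_funTS; exact: measurable_radial.
have Vu : {ae mu, forall x, B x -> (V \o @sq R) x = u x}.
  by apply: ae_imp uV => x h Bx; rewrite h.
have sVs : L2 (V \o @sq R) := @ae_sqint _ _ R mu B mB u _ su mVs Vu.
have sV : sqI V.
  split; first exact: measurable_funTS.
  apply: (@polar_integrable_conv _ (fun s => V s ^+ 2)); first exact: measurable_funX.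
  exact: sVs.2.
have sP := prim_sqI mf sf; have mP := measurable_prim mf.
have sW : sqI (fun s => V s - prim f s) := sqintB mI sV sP.
have mW : measurable_fun setT (fun s => V s - prim f s) by exact: measurable_funB.
suff W0 : {ae leb, forall s, I01 s -> V s - prim f s = 0}.
  have VP : {ae leb, forall s, I01 s -> V s = prim f s}.
    by apply: ae_imp W0 => s h /h /eqP; rewrite subr_eq0 => /eqP.
  exists f; split => //.
    apply: ae_imp VP => s h Is; rewrite -h// /V.
    by move: Is; rewrite /= in_itv/= => /andP[/ltW -> ->].
  by apply: ae_imp2 uV (ae_radial VP) => x h1 h2 Bx; rewrite h1// h2.
apply: (weak_zero mW sW) => b d M cb bM d01 bd.
have [k [k' [dk ck' k00 kb]]] := quotient_field cb bM d01 bd.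
have ck : continuous k by move=> s; exact: is_derive_cont (dk s).
have cks : continuous (fun x : R * R => k (sq x)).
  by move=> x; apply: continuous_comp; [exact: continuous_sq|exact: ck].
have [N kN] := continuous_bounded_disk cks.
(* The density formula wants a function bounded on the whole line, while k is bounded only over the
   disk. The cut changes nothing at the origin because k vanishes there. *)
pose kI s := k s * \1_I01 s.
have kIE x : B x -> k (sq x) = kI (sq x).
  move=> /diskE x1; rewrite /kI indicE.
  have := sq_ge0 x; rewrite le_eqVlt => /predU1P[<-|x0]; first by rewrite k00 mul0r.
  by rewrite mem_set ?mulr1//= in_itv/= x0 x1.
have kIN s : `|kI s| <= N.
  rewrite /kI indicE; have [/set_mem|_] := boolP (s \in I01); last first.
    rewrite mulr0 normr0 (le_trans _ (kN (0, 0) _))//; apply/diskE.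
    by rewrite /sq/= expr0n/= addr0.
  rewrite /= in_itv/= mulr1 => /andP[s0 s1'].
  have E : sq (Num.sqrt s, 0) = s by rewrite /sq/= expr0n/= addr0 sqr_sqrtr// ltW.
  by rewrite -{1}E; apply: kN; apply/diskE; rewrite E.
have mk : measurable_fun setT kI.
  apply: measurable_funM; first exact: continuous_measurable_fun.
  by apply: measurable_indic; exact: mI.
have cX1 : continuous (fun x : R * R => x.1 * k (sq x)).
  by move=> x; apply: cvgM; [exact: cvg_fst|exact: cks].
have cX2 : continuous (fun x : R * R => x.2 * k (sq x)).
  by move=> x; apply: cvgM; [exact: cvg_snd|exact: cks].
have sX1 : L2 (fun x : R * R => x.1 * k (sq x)) by exact: continuous_L2.
have sX2 : L2 (fun x : R * R => x.2 * k (sq x)) by exact: continuous_L2.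
have E1 : ipB g1 (fun x => x.1 * k (sq x)) + ipB g2 (fun x => x.2 * k (sq x)) =
    \int[leb]_(s in setT) (p s * kI s).
  rewrite -(radial_density_fun iG ip_ Gp mk kIN) /ip -(diskI_D (L2_mul s1 sX1) (L2_mul s2 sX2)).
  by apply: eq_Rintegral => x /set_mem/kIE <-; ring.
(* The integrand is 2 s f(s) k(s) = p(s) k(s) / kappa, and polar integration restores the factor
   kappa. *)
have E2 : ipB (psi1 f) (fun x => x.1 * k (sq x)) + ipB (psi2 f) (fun x => x.2 * k (sq x)) =
    \int[leb]_(s in setT) (p s * kI s).
  have sp1 := L2_psi1 mf sf; have sp2 := L2_psi2 mf sf.
  rewrite /ip -(diskI_D (L2_mul sp1 sX1) (L2_mul sp2 sX2)).
  pose H (s : R) := (kappa R)^-1 * (p s * kI s).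
  have mH : measurable_fun setT H by apply: measurable_funM => //; exact: measurable_funM.
  have ipk : leb.-integrable setT (EFin \o (fun s => p s * kI s)).
    exact: (@bounded_mul_integrable R _ (measurableTypeR R) leb setT p kI N measurableT ip_ mk (fun s _ => kIN s)).
  have ipkI : leb.-integrable I01 (EFin \o (fun s => p s * kI s)) by apply: integrableS ipk.
  have [_ EH] := polar_signed mH (integrableZR mI (kappa R)^-1 ipkI).
  transitivity (\int[mu]_(x in B) H (sq x)).
    apply: eq_Rintegral => x /set_mem Bx; rewrite kIE// /H /psi1 /psi2.
    have := sq_ge0 x; rewrite le_eqVlt => /predU1P[<-|x0].
      have -> : kI 0 = 0 by rewrite /kI k00 mul0r.
      by rewrite !mulr0 addr0.
    rewrite /f powR_inv1 ?(ltW x0)//.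
    transitivity ((2 * kappa R)^-1 * (p (sq x) * (sq x)^-1) * 2 * kI (sq x) * sq x).
      by move: ((2 * kappa R)^-1 * _) (kI _) => a c; rewrite /sq; ring.
    by field; rewrite !gt_eqF.
  rewrite EH (@RintegralZl _ (measurableTypeR R) R leb I01 _ _ mI)// mulVKf ?gt_eqF//.
  rewrite /Rintegral integral_mkcond; congr fine; apply: eq_integral => s _.
  rewrite patchE; case: ifPn => // sI; rewrite /kI indicE (negbTE sI) !mulr0//.
have R1 := radial_field dk ck' Hu; have R2 := radial_field dk ck' (radial_H10g mf sf).
rewrite E1 in R1; rewrite E2 in R2.
have DE : (fun x : R * R => 2 * (k (sq x) + sq x * k' (sq x))) = fun x => 2 * b (sq x).
  by apply/funext => x; rewrite kb.
rewrite DE in R1 R2.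
have cbs : continuous (fun x : R * R => 2 * b (sq x)).
  move=> x; apply: cvgM; first exact: cvg_cst.
  by apply: continuous_comp; [exact: continuous_sq|exact: cb].
have sD : L2 (fun x : R * R => 2 * b (sq x)) by exact: continuous_L2.
have R3 : ipB (V \o @sq R) (fun x => 2 * b (sq x)) = ipB (prim f \o @sq R) (fun x => 2 * b (sq x)).
  rewrite R2 -R1; apply: (@ae_ip _ _ R mu B mB) => //; exact: aeW.
have mb : measurable_fun setT b by exact: continuous_measurable_fun.
have sb : sqI b.
  split; first exact: measurable_funTS.
  apply: measurable_bounded_integrable => //; first exact: leb_I01.
    by apply: measurable_funTS; exact: measurable_funX.
  exists (M ^+ 2); split; first exact: num_real.
  move=> K MK s _ /=; rewrite normrX (le_trans _ (ltW MK))// lerXn2r ?nnegrE//.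
  by rewrite (le_trans _ (bM s)).
have iWb := sqint_mul mI sW sb.
have [_ EW] := polar_signed (measurable_funM mW mb) iWb.
have : ipB (fun x => V (sq x) - prim f (sq x)) (fun x => 2 * b (sq x)) = 0.
  have sPs := L2_radial mP sP.
  by rewrite (@ipBl _ _ R mu B mB _ _ _ sVs sPs sD) R3 subrr.
have -> : ipB (fun x => V (sq x) - prim f (sq x)) (fun x => 2 * b (sq x)) =
   2 * (kappa R * ipI (fun s => V s - prim f s) b).
  have [iWs _] := polar_signed (measurable_funM mW mb) iWb.
  rewrite -EW -(diskI_Z 2 iWs); apply: eq_Rintegral => x _ /=; ring.
by move/eqP; rewrite !mulf_eq0 pnatr_eq0/= gt_eqF//= => /eqP.
Qed.

End represent.

(** * Rescaling and the limit *)

Section rescale.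
Variable R : realType.
Notation leb := (@lebesgue_measure R).
Notation I01 := (`]0, 1[%classic : set R).
Notation sqI := (@sqint _ (measurableTypeR R) R leb I01).
Notation ipI := (@ip _ (measurableTypeR R) R leb I01).
Notation B := (disk R).
Notation mu := (mu2 R).
Notation ipB := (ip mu B).

Lemma measurable_pow (b : R) : measurable_fun setT (fun s : R => s `^ b).
Proof. exact: measurable_powR. Qed.

Lemma measurable_comp_pow (b : R) (h : R -> R) : measurable_fun setT h ->
  measurable_fun setT (fun s => h (s `^ b)).
Proof. by move=> mh; apply: measurableT_comp => //; exact: measurable_pow. Qed.

Lemma measurable_jac (b : R) (h : R -> R) : measurable_fun setT h ->
  measurable_fun setT (fun s => h (s `^ b) * (b * s `^ (b - 1))).
Proof.
move=> mh; apply: measurable_funM; first exact: measurable_comp_pow.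
by apply: measurable_funM => //; exact: measurable_pow.
Qed.

Section pow.
Variables (b : R) (b0 : 0 < b).

Let jac_ge0 (s : R) : 0 <= b * s `^ (b - 1).
Proof. by rewrite mulr_ge0 ?powR_ge0// ltW. Qed.

Lemma pow_I01 (s : R) : I01 s -> I01 (s `^ b).
Proof.
rewrite /= !in_itv/= => /andP[s0 s1]; rewrite powR_gt0//=.
by have := @gt0_ltr_powR R b b0 s 1; rewrite !nnegrE (ltW s0) ler01 powR1 => /(_ isT isT s1).
Qed.

Lemma pow_signed (h : R -> R) : measurable_fun setT h -> leb.-integrable I01 (EFin \o h) ->
  leb.-integrable I01 (EFin \o (fun s => h (s `^ b) * (b * s `^ (b - 1)))) /\
  \int[leb]_(s in I01) (h (s `^ b) * (b * s `^ (b - 1))) = \int[leb]_(s in I01) h s.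
Proof.
move=> mh ih; have mI := @mI01 R.
have pos (g : R -> R) : measurable_fun setT g -> (forall s, 0 <= g s) ->
    leb.-integrable I01 (EFin \o g) ->
    leb.-integrable I01 (EFin \o (fun s => g (s `^ b) * (b * s `^ (b - 1)))) /\
    \int[leb]_(s in I01) (g (s `^ b) * (b * s `^ (b - 1))) = \int[leb]_(s in I01) g s.
  move=> mg g0 /integrableP[_ ig]; have E := pow_subst b0 mg g0.
  split; last by rewrite /Rintegral E.
  apply/integrableP; split.
    by apply/measurable_EFinP; apply: measurable_funTS; exact: measurable_jac.
  under eq_integral do rewrite gee0_abs ?lee_fin ?(mulr_ge0 (g0 _) (jac_ge0 _))//.
  rewrite E; apply: le_lt_trans ig; apply: ge0_le_integral => //.
  - by move=> s _; rewrite lee_fin.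
  - by apply/measurable_EFinP; exact: measurable_funTS.
  - by apply: measurableT_comp => //; apply/measurable_EFinP; exact: measurable_funTS.
  by move=> s _; rewrite gee0_abs ?lee_fin.
have mn : measurable_fun setT (fun s => `|h s|) by apply: measurableT_comp.
pose h1 s := h s + `|h s|.
have mh1 : measurable_fun setT h1 by exact: measurable_funD.
have h10 s : 0 <= h1 s by rewrite /h1 -lerBlDl sub0r -normrN ler_norm.
have i2 : leb.-integrable I01 (EFin \o (fun s => `|h s|)) by exact: (integrable_norm ih).
have i1 : leb.-integrable I01 (EFin \o h1) := integrableDR mI ih i2.
have [j1 E1] := pos _ mh1 h10 i1.
have [j2 E2] := pos _ mn (fun s => normr_ge0 _) i2.
have j := integrableBR mI j1 j2.
have hE (s : R) : h (s `^ b) * (b * s `^ (b - 1)) =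
    h1 (s `^ b) * (b * s `^ (b - 1)) - `|h (s `^ b)| * (b * s `^ (b - 1)).
  by rewrite -mulrBl /h1 addrK.
split.
  by move: j; congr (_.-integrable _ _); apply/funext => s /=; rewrite -hE.
under eq_Rintegral do rewrite hE.
rewrite (@RintegralB _ (measurableTypeR R) R leb I01 _ _ mI)// E1 E2.
rewrite -(@RintegralB _ (measurableTypeR R) R leb I01 _ _ mI)//.
by apply: eq_Rintegral => s _; rewrite /h1 addrK.
Qed.

(** The substitution formula for the indicator of a null set, combined with positivity of the
    Jacobian on []0, 1[]. *)
Lemma ae_pow (P : R -> Prop) : {ae leb, forall s, I01 s -> P s} ->
  {ae leb, forall s, I01 s -> P (s `^ b)}.
Proof.
case=> N [mN N0 NP]; have mI := @mI01 R.
have m1 : measurable_fun setT (\1_N : R -> R) by exact: measurable_indic.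
have n0 (s : R) : 0 <= (\1_N s : R) by rewrite indicE.
have E0 : (\int[leb]_(s in I01) (\1_N s)%:E = 0)%E.
  rewrite integral_indic//; apply/eqP; rewrite eq_le measure_ge0 andbT -N0.
  by apply: le_measure; rewrite ?inE//; exact: measurableI.
have E := pow_subst b0 m1 n0; rewrite E0 in E.
have mj : measurable_fun I01 (EFin \o (fun s => \1_N (s `^ b) * (b * s `^ (b - 1)))).
  by apply/measurable_EFinP; apply: measurable_funTS; exact: measurable_jac.
have : (\int[leb]_(s in I01) `|(\1_N (s `^ b) * (b * s `^ (b - 1)))%:E| = 0)%E.
  by rewrite -[RHS]E; apply: eq_integral => s _; rewrite gee0_abs// lee_fin (mulr_ge0 (n0 _) (jac_ge0 _)).
move/(@ae_eq_integral_abs _ _ _ leb _ mI _ mj).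
apply: ae_imp => s H Is; apply: contrapT => nP; have := H Is.
have Ns : N (s `^ b) by apply: NP => /= H'; apply: nP; apply: H'; exact: pow_I01.
rewrite /= indicE mem_set//= mul1r => -[/eqP]; rewrite mulf_eq0 gt_eqF//=.
move: Is; rewrite /= in_itv/= => /andP[s0 _].
by rewrite gt_eqF// powR_gt0.
Qed.

Variables (f : R -> R) (mf : measurable_fun setT f) (sf : sqI (wgt f)).

(** The derivative of b^(-1/2) F(s^b) when F' = f. *)
Definition resc (s : R) := Num.sqrt b * s `^ (b - 1) * f (s `^ b).

Lemma measurable_resc : measurable_fun setT resc.
Proof.
apply: measurable_funM; last exact: measurable_comp_pow.
by apply: measurable_funM => //; exact: measurable_pow.
Qed.

Let wgt_resc (s : R) : I01 s -> wgt resc s ^+ 2 = wgt f (s `^ b) ^+ 2 * (b * s `^ (b - 1)).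
Proof.
rewrite /= in_itv/= => /andP[s0 _].
rewrite /wgt /resc !exprMn !sqr_sqrtr ?powR_ge0//; [|exact: ltW..].
have -> : s `^ b = s * s `^ (b - 1).
  rewrite -{2}(powRr1 (ltW s0)) -powRD; last by apply/implyP => _; rewrite gt_eqF.
  by congr (_ `^ _); ring.
by ring.
Qed.

(** The weight s is the one for which s times the square of [resc] is the transformed density times
    exactly the Jacobian b s^(b-1). *)
Lemma resc_energy : sqI (wgt resc) /\ ipI (wgt resc) (wgt resc) = ipI (wgt f) (wgt f).
Proof.
have mI := @mI01 R; have [_ i2] := sf.
have mw2 : measurable_fun setT (fun s => wgt f s ^+ 2).
  by apply: measurable_funX; exact: measurable_wgt.
have [j E] := pow_signed mw2 i2.
have mr : measurable_fun I01 (wgt resc).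
  by apply: measurable_funTS; apply: measurable_wgt; exact: measurable_resc.
split; [split => //|].
  apply: (@le_integrableR _ _ _ _ _ mI _ _ _ j); first exact: measurable_funX.
  by move=> s Is; rewrite wgt_resc// ger0_norm// (mulr_ge0 (sqr_ge0 _) (jac_ge0 _)).
rewrite /ip; under eq_Rintegral do rewrite -expr2.
under [RHS]eq_Rintegral do rewrite -expr2.
by rewrite -E; apply: eq_Rintegral => s /set_mem; exact: wgt_resc.
Qed.

Lemma prim_resc (s : R) : I01 s -> prim resc s = (Num.sqrt b)^-1 * prim f (s `^ b).
Proof.
move=> /[dup] Is; rewrite /= in_itv/= => /andP[s0 s1].
have := pow_I01 Is; rewrite /= in_itv/= => /andP[t0 t1].
have mI := @mI01 R.
rewrite /prim s0 s1 t0 t1/= mulrN; congr (- _).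
set t := s `^ b.
(* Cutting f off below t lets the substitution on the whole of []0, 1[] act on the tail integral. *)
pose h (x : R) := f x * \1_(`]t, 1[%classic) x.
have mi (x : R) : measurable (`]x, 1[%classic : set (measurableTypeR R)) by exact: measurable_itv.
have mh : measurable_fun setT h by apply: measurable_funM => //; apply: measurable_indic; exact: mi.
have patchI (x : R) (g : R -> R) : 0 <= x ->
    \int[leb]_(y in `]x, 1[) g y = \int[leb]_(y in I01) (g y * \1_(`]x, 1[%classic) y).
  move=> x0; rewrite /Rintegral -[in LHS](setIidr (sub_I01 x0)) integral_mkcondr.
  congr fine; apply: eq_integral => y' _; rewrite patchE indicE.
  by case: ifP; rewrite ?mulr1 ?mulr0.
have ih : leb.-integrable I01 (EFin \o h).
  have [_ H] := @integrable_mkcond _ (measurableTypeR R) R leb I01 (EFin \o h) mI; apply: H.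
  have [H _] := @integrable_mkcond _ (measurableTypeR R) R leb `]t, 1[%classic (EFin \o f) (mi t).
  move: (H (tail_integrable mf sf t0)); congr (_.-integrable _ _); apply/funext => x.
  rewrite !patchE /h/= indicE; have [xt|xt] := boolP (x \in `]t, 1[%classic).
    rewrite mem_set ?mulr1//; apply: (sub_I01 (ltW t0)); exact: set_mem.
  by rewrite mulr0; case: ifP.
have [_ E] := pow_signed mh ih.
rewrite (patchI s resc (ltW s0)) (patchI t f (ltW t0)) -E.
rewrite -(@RintegralZl _ (measurableTypeR R) R leb I01 _ _ mI); last exact: (pow_signed mh ih).1.
apply: eq_Rintegral => x /set_mem; rewrite /= in_itv/= => /andP[x0 x1].
have sb0 : Num.sqrt b != 0 by rewrite gt_eqF// sqrtr_gt0.
have sE : (Num.sqrt b)^-1 * b = Num.sqrt b.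
  by rewrite -[X in _ * X = _](sqr_sqrtr (ltW b0)) expr2 mulKf.
rewrite /resc /h.
have -> : \1_(`]t, 1[%classic) (x `^ b) = \1_(`]s, 1[%classic) x :> R.
  rewrite !indicE; congr (nat_of_bool _)%:R; apply/idP/idP => /set_mem/=; rewrite in_itv/= => /andP[h1 h2];
    apply: mem_set; rewrite /= in_itv/=.
    rewrite x1 andbT ltNge; apply/negP => xs; move: h1; rewrite ltNge => /negP; apply.
    by apply: ge0_ler_powR; rewrite ?nnegrE ?(ltW b0) ?(ltW x0) ?(ltW s0).
  apply/andP; split; first by apply: gt0_ltr_powR; rewrite ?nnegrE ?(ltW x0) ?(ltW s0).
  by have := pow_I01 (_ : I01 x); rewrite /= !in_itv/= x0 x1 => /(_ isT)/andP[].
rewrite -{1}sE; ring.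
Qed.

End pow.

Lemma sqrt_pow (s b : R) : 0 <= s -> Num.sqrt s `^ b = Num.sqrt (s `^ b).
Proof.
move=> s0; rewrite -(powR12_sqrt s0) -(powR12_sqrt (powR_ge0 s b)).
by rewrite -[LHS]powRrM -[RHS]powRrM; congr (_ `^ _); rewrite mulrC.
Qed.

(** The exponent is the same in |x| and in s = |x|^2, since the square of |x|^b is s^b. *)
Lemma rescaled_H10g (alpha : R) (v f : R -> R) : 0 < alpha ->
  measurable_fun (`[0, 1[%classic : set R) v ->
  measurable_fun setT f -> sqI (wgt f) ->
  {ae leb, forall s, I01 s -> v (Num.sqrt s) = prim f s} ->
  {ae mu, forall x, B x -> rescaled alpha v x = prim (resc (2 / (alpha + 2)) f) (sq x)} /\
  H10g (rescaled alpha v) (psi1 (resc (2 / (alpha + 2)) f)) (psi2 (resc (2 / (alpha + 2)) f)).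
Proof.
move=> a0 mv mf sf vf; set b := 2 / (alpha + 2).
have a2 : 0 < alpha + 2 by rewrite addr_gt0.
have b0 : 0 < b by rewrite divr_gt0.
have [sr _] := resc_energy b0 mf sf; have mr := measurable_resc b mf.
have rE x : B x -> rescaled alpha v x = (Num.sqrt b)^-1 * v (Num.sqrt (sq x `^ b)).
  move=> Bx; rewrite /rescaled enormE -/b sqrt_pow ?sq_ge0//; congr (_ * _).
  by rewrite -sqrtrV ?ltW// /b invf_div.
have ae1 : {ae mu, forall x, B x -> rescaled alpha v x = prim (resc b f) (sq x)}.
  have H : {ae leb, forall s, I01 s -> I01 s /\ v (Num.sqrt (s `^ b)) = prim f (s `^ b)}.
    by apply: ae_imp (ae_pow b0 vf) => s h Is; split => //; exact: h.
  apply: ae_imp (ae_radial H) => x h Bx; have [Ix vx] := h Bx.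
  by rewrite rE// vx prim_resc.
split => //; apply: ae_H10g (radial_H10g mr sr) _ ae1.
have mV := profile_measurable mv.
apply: (@eq_measurable_fun _ _ _ _ _ (fun x => (Num.sqrt b)^-1 *
  ((fun s : R => if 0 <= s < 1 then v (Num.sqrt s) else 0) \o (fun s => s `^ b)) (sq x))).
  move=> x /set_mem Bx; rewrite rE//=; congr (_ * _).
  have /diskE x1 := Bx; rewrite powR_ge0/=.
  by have := @gt0_ltr_powR R b b0 (sq x) 1; rewrite !nnegrE sq_ge0 ler01 powR1 => /(_ isT isT x1) ->.
apply: measurable_funM => //; apply: measurable_funTS.
apply: (@measurable_radial _ (_ \o _)); apply: measurableT_comp => //; exact: measurable_pow.
Qed.

End rescale.

Lemma Rintegral_norm_eq0 d (T : measurableType d) (R : realType) (m : {measure set T -> \bar R})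
    (D : set T) (f : T -> R) : measurable D -> m.-integrable D (EFin \o f) ->
  \int[m]_(x in D) `|f x| = 0 -> {ae m, forall x, D x -> f x = 0}.
Proof.
move=> mD iF f0.
have : (\int[m]_(x in D) `|(f x)%:E| = 0)%E.
  have /fineK E := integrable_fin_num mD (integrable_norm iF).
  by rewrite -[LHS]E; congr EFin.
move/(@ae_eq_integral_abs _ _ _ m _ mD _ (measurable_int m iF)).
by apply: ae_imp => x H /H [].
Qed.

(** * The functional in the rescaled variable *)

Section functional.
Variable R : realType.
Notation leb := (@lebesgue_measure R).
Notation I01 := (`]0, 1[%classic : set R).
Notation sqI := (@sqint _ (measurableTypeR R) R leb I01).
Notation ipI := (@ip _ (measurableTypeR R) R leb I01).
Notation B := (disk R).
Notation mu := (mu2 R).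
Notation ipB := (ip mu B).

Lemma expR_sub1_ge0 (g t : R) : 0 <= g -> 0 <= expR (g * t ^+ 2) - 1.
Proof. by move=> g0; rewrite subr_ge0 -expR0 ler_expR mulr_ge0// sqr_ge0. Qed.

Lemma henon_moser_radial (alpha g : R) (u : R * R -> R) (f : R -> R) : 0 < alpha -> 0 <= g ->
  measurable_fun B u -> measurable_fun setT f ->
  {ae mu, forall x, B x -> u x = prim f (sq x)} ->
  (henon_moser alpha g u = (kappa R * (2 / (alpha + 2)))%:E *
   \int[leb]_(s in I01) (expR (g * prim f (s `^ (2 / (alpha + 2))) ^+ 2) - 1)%:E)%E.
Proof.
move=> a0 g0 mu_ mf uf; set b := 2 / (alpha + 2).
have a2 : 0 < alpha + 2 by rewrite addr_gt0.
have b0 : 0 < b by rewrite divr_gt0.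
have mp := measurable_prim mf; have mI := @mI01 R.
have mE d (T : measurableType d) (D : set T) (h : T -> R) : measurable_fun D h ->
    measurable_fun D (fun x => expR (g * h x ^+ 2) - 1).
  move=> mh; apply: measurable_funB => //; apply: measurableT_comp => //.
  by apply: measurable_funM => //; exact: measurable_funX.
pose h (s : R) := (expR (g * prim f s ^+ 2) - 1) * s `^ (2^-1 * alpha).
have mh : measurable_fun setT h by apply: measurable_funM; [exact: mE|exact: measurable_pow].
have h0 s : 0 <= h s by rewrite mulr_ge0 ?powR_ge0// expR_sub1_ge0.
have En (x : R * R) : enorm x `^ alpha = sq x `^ (2^-1 * alpha).
  by rewrite enormE -(powR12_sqrt (sq_ge0 x)) -powRrM.
transitivity (\int[mu]_(x in B) (h (sq x))%:E)%E.
  apply: ae_eq_integral => //.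
  - exact: mdisk.
  - apply/measurable_EFinP; apply: measurable_funM; first exact: mE.
    rewrite (_ : (fun x => _) = (fun x => sq x `^ (2^-1 * alpha))); last exact/funext.
    apply: measurable_funTS; exact: (measurable_radial (measurable_pow (2^-1 * alpha))).
  - apply/measurable_EFinP; apply: measurable_funTS; exact: measurable_radial.
  - by apply: ae_imp uf => x ux Bx; rewrite ux// En.
rewrite (polar mh h0) -(pow_subst b0 mh h0) EFinM -muleA; congr (_ * _)%E.
rewrite -ge0_integralZl//; last 3 first.
- apply/measurable_EFinP; apply: measurable_funTS; apply: (mE _ _ _ (fun s => prim f (s `^ b))).
  exact: measurable_comp_pow.
- by move=> s _; rewrite lee_fin expR_sub1_ge0.
- by rewrite lee_fin ltW.
apply: eq_integral => s /set_mem; rewrite /= in_itv/= => /andP[s0 _].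
rewrite -EFinM; congr EFin; rewrite /h -powRrM.
(* The exponent b = 2/(alpha + 2) is the one for which the weight |x|^alpha = s^(alpha/2) cancels
   the power in the Jacobian. *)
have J : s `^ (b * (2^-1 * alpha)) * s `^ (b - 1) = 1.
  rewrite -powRD; last by apply/implyP => _; rewrite gt_eqF.
  rewrite (_ : _ + _ = 0) ?powRr0// /b; field; rewrite gt_eqF//.
by rewrite mulrACA J mulr1 mulrC.
Qed.

End functional.

Section maximizer.
Variable R : realType.
Notation leb := (@lebesgue_measure R).
Notation I01 := (`]0, 1[%classic : set R).
Notation sqI := (@sqint _ (measurableTypeR R) R leb I01).
Notation ipI := (@ip _ (measurableTypeR R) R leb I01).
Notation B := (disk R).
Notation mu := (mu2 R).
Notation ipB := (ip mu B).

Lemma ae_radial_ge0 (h : R -> R) : measurable_fun setT h ->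
  {ae mu, forall x, B x -> 0 <= h (sq x)} -> {ae leb, forall s, I01 s -> 0 <= h s}.
Proof.
move=> mh [N [mN N0 NP]]; have mI := @mI01 R.
pose A := [set s : R | h s < 0].
have mA : measurable A by apply: measurable_ltset => //; exact: measurable_cst.
exists (I01 `&` A); split; first exact: measurableI.
  have k0 := @kappa_gt0 R.
  have : ((kappa R)%:E * leb (I01 `&` A) = 0)%E.
    rewrite -mu_radial//; apply/eqP; rewrite eq_le measure_ge0 andbT -N0.
    apply: le_measure; rewrite ?inE//.
      apply: measurableI; first exact: mdisk.
      by rewrite -[X in measurable X]setTI; exact: measurable_sq.
    move=> x [Bx /= hx]; apply: NP => /= /(_ Bx).
    by rewrite leNgt hx.
  by move/eqP; rewrite mule_eq0 eqe gt_eqF//= => /eqP.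
move=> s /= ns; have Is : I01 s by apply: contrapT => nI; apply: ns => /nI.
split => //; rewrite /A/= ltNge; apply/negP => hs; exact: ns.
Qed.

Lemma H10g_normalized_energy u g1 g2 : H10g u g1 g2 ->
  dirichlet_norm u = 1 -> ipB g1 g1 + ipB g2 g2 = 1.
Proof.
move=> H; rewrite /dirichlet_norm (H10g_form H H) => E.
have e0 : 0 <= ipB g1 g1 + ipB g2 g2 by rewrite addr_ge0// ip_ge0.
by rewrite -[LHS](sqr_sqrtr e0) E expr1n.
Qed.

Lemma maximizer_profile (alpha g : R) u v : is_nonneg_maximizer alpha g u -> is_profile u v ->
  exists f : R -> R, [/\ measurable_fun setT f /\ sqI (wgt f),
    4 * kappa R * ipI (wgt f) (wgt f) = 1,
    {ae leb, forall s, I01 s -> v (Num.sqrt s) = prim f s},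
    {ae mu, forall x, B x -> u x = prim f (sq x)} &
    {ae leb, forall s, I01 s -> 0 <= prim f s}].
Proof.
move=> [[Hu _] u0 u1 _] uv; have [g1 [g2 G]] := H10_H10g Hu.
have [f [mf sf vf uf]] := radial_represent G uv.
have [su _ _ _] := G.
have Gf := ae_H10g (radial_H10g mf sf) su.1 uf.
exists f; split => //.
  by rewrite -(radial_energy mf sf); exact: H10g_normalized_energy Gf u1.
apply: (ae_radial_ge0 (measurable_prim mf)).
by apply: ae_imp2 u0 uf => x h1 h2 Bx; rewrite -h2// h1.
Qed.

(** The inequality exp y - 1 <= y exp y, used twice. *)
Lemma expR_quadratic (y : R) : 0 <= y -> expR y - 1 <= y + y ^+ 2 * expR y.
Proof.
move=> y0; have h1 : expR y - 1 <= y * expR y.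
  have := expR_ge1Dx (- y); rewrite -(ler_pM2r (expR_gt0 y)) expRN mulVf ?gt_eqF ?expR_gt0//.
  by lra.
by have := ler_wpM2l y0 h1; lra.
Qed.

(* [128 = 64 * 2] comes from [- ln s <= 8 s^(-1/8)] and [int_0^1 s^(-1/2) = 2]. *)
Lemma moser_upper (W : R -> R) (e t : R) : sqI W -> 0 <= t ->
  (forall s, I01 s -> W s ^+ 2 <= - ln s * e) -> t * e <= 4^-1 -> 0 <= e ->
  (\int[leb]_(s in I01) (expR (t * W s ^+ 2) - 1)%:E <=
   (t * ipI W W + 128 * (t * e) ^+ 2)%:E)%E.
Proof.
move=> sW t0 We te e0; have mI := @mI01 R; have [mW iW] := sW.
have h2 : 0 < (2^-1 : R) < 1 by apply/andP; split; lra.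
have iN := integrable_powN h2.
have iR : leb.-integrable I01 (EFin \o (fun s => t * W s ^+ 2 + 64 * (t * e) ^+ 2 * s `^ (- 2^-1))).
  by apply: (integrableDR mI); exact: (integrableZR mI).
have key s : I01 s -> expR (t * W s ^+ 2) - 1 <= t * W s ^+ 2 + 64 * (t * e) ^+ 2 * s `^ (- 2^-1).
  move=> Is; have := We s Is; move: (Is); rewrite /= in_itv/= => /andP[s0 s1] Ws.
  set y := t * W s ^+ 2.
  have y0 : 0 <= y by rewrite mulr_ge0// sqr_ge0.
  have L0 : 0 <= - ln s by rewrite oppr_ge0 ln_le0// ltW.
  have yL : y <= (- ln s) * (t * e) by have := ler_wpM2l t0 Ws; rewrite /y; lra.
  have c8 : (0 : R) < 8^-1 by rewrite invr_gt0.
  have L8 := neg_ln_le c8 s0; rewrite invrK in L8.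
  have te0 : 0 <= t * e by rewrite mulr_ge0.
  set p := s `^ (- 8^-1) in L8.
  have p0 : 0 < p by exact: powR_gt0.
  have yp : y <= 8 * p * (t * e) by apply: (le_trans yL); rewrite ler_wpM2r.
  have y2 : y ^+ 2 <= 64 * (t * e) ^+ 2 * (p * p).
    have -> : 64 * (t * e) ^+ 2 * (p * p) = (8 * p * (t * e)) ^+ 2 by ring.
    by rewrite ler_sqr ?nnegrE// (le_trans y0).
  (* The smallness t e <= 1/4 enters here. With the two factors s^(-1/8) from the bound on y^2 this
     leaves the integrable power s^(-1/2). *)
  have ey : expR y <= s `^ (- 4^-1).
    rewrite /powR gt_eqF// ler_expR; apply: (le_trans yL).
    by have := ler_wpM2l L0 te; lra.
  have pw : p * p * s `^ (- 4^-1) = s `^ (- 2^-1).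
    rewrite /p -!powRD; [|by apply/implyP => _; rewrite gt_eqF..].
    by congr (_ `^ _); field.
  apply: (le_trans (expR_quadratic y0)); rewrite lerD2l -pw mulrA.
  by apply: ler_pM => //; rewrite ?sqr_ge0 ?expR_ge0.
have mE : measurable_fun I01 (fun s => expR (t * W s ^+ 2) - 1).
  apply: measurable_funB => //; apply: measurableT_comp => //.
  by apply: measurable_funM => //; exact: measurable_funX.
apply: (@le_trans _ _ (\int[leb]_(s in I01) (t * W s ^+ 2 + 64 * (t * e) ^+ 2 * s `^ (- 2^-1))%:E)%E).
  apply: ge0_le_integral => //.
  - by move=> s _; rewrite lee_fin expR_sub1_ge0.
  - exact/measurable_EFinP.
  - exact: (measurable_int leb iR).
have /fineK <- := integrable_fin_num mI iR; rewrite lee_fin.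
rewrite -/(Rintegral leb I01 (fun s => t * W s ^+ 2 + 64 * (t * e) ^+ 2 * s `^ (- 2^-1))).
rewrite (@RintegralD _ (measurableTypeR R) R leb I01 _ _ mI); last 2 first.
- exact: (integrableZR mI).
- exact: (integrableZR mI).
rewrite !(@RintegralZl _ (measurableTypeR R) R leb I01 _ _ mI)//.
have -> : \int[leb]_(s in I01) s `^ (- 2^-1) = 2.
  by rewrite /Rintegral int_powN//=; field.
have -> : ipI W W = \int[leb]_(s in I01) (W s ^+ 2).
  by apply: eq_Rintegral => s _; rewrite expr2.
by lra.
Qed.

End maximizer.

(** * Comparison of maximizers with the ground state *)

Section ground_state.
Variable R : realType.
Notation leb := (@lebesgue_measure R).
Notation I01 := (`]0, 1[%classic : set R).
Notation sqI := (@sqint _ (measurableTypeR R) R leb I01).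
Notation ipI := (@ip _ (measurableTypeR R) R leb I01).
Notation B := (disk R).
Notation mu := (mu2 R).
Notation ipB := (ip mu B).
Variables (F F1 F2 : R -> R) (l : R).
Hypotheses (dF : forall s : R, is_derive s 1 F (F1 s))
  (dF1 : forall s : R, is_derive s 1 F1 (F2 s)) (cF2 : continuous F2).
Hypotheses (l0 : 0 < l) (FE : forall s, s * F2 s + F1 s = - l * F s).
Hypotheses (F_0 : F 0 = 1) (F_1 : F 1 = 0) (F_gt0 : forall s, 0 <= s < 1 -> 0 < F s)
  (F_nincr : forall a b, 0 <= a -> a <= b -> b <= 1 -> F b <= F a).

Let cF1 : continuous F1. Proof. by move=> s; exact: is_derive_cont (dF1 s). Qed.
Let cF : continuous F. Proof. by move=> s; exact: is_derive_cont (dF s). Qed.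
Let mF1 : measurable_fun setT F1. Proof. exact: continuous_measurable_fun. Qed.
Let mF : measurable_fun setT F. Proof. exact: continuous_measurable_fun. Qed.
Let m := 4 * l.
Let m0 : 0 < m. Proof. by rewrite mulr_gt0. Qed.

Lemma sqI_F1 : sqI (wgt F1).
Proof.
have [N FN] := continuous_bounded_disk (psi_continuous dF1).
apply: (@wgt_bounded _ _ N mF1) => s; rewrite /= in_itv/= => /andP[s0 s1].
have E : sq (Num.sqrt s, 0) = s by rewrite /sq/= expr0n/= addr0 sqr_sqrtr// ltW.
by rewrite -{1}E; apply: FN; apply/diskE; rewrite E.
Qed.

Lemma prim_F1 s : I01 s -> prim F1 s = F s.
Proof.
rewrite /= in_itv/= => s01; have /andP[s0 s1] := s01.
have iI := tail_integrable mF1 sqI_F1 s0.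
have E := FTC2R (ltW s1) cF1 dF.
have ic : leb.-integrable `[s, 1[%classic (EFin \o F1).
  have : leb.-integrable `[s, 1]%classic (EFin \o F1).
    apply: continuous_compact_integrable; first exact: segment_compact.
    exact: continuous_subspaceT.
  by apply: integrableS => // x /=; rewrite !in_itv/= => /andP[-> /ltW].
rewrite /prim s01 Rintegral_itv_obnd_cbnd// Rintegral_itv_bndo_bndc// E F_1; ring.
Qed.

Lemma psi_ae : {ae mu, forall x, B x -> psi F x = prim F1 (sq x)}.
Proof. by apply: (@ae_radial _ (fun s => F s = prim F1 s)); apply: aeW => s /prim_F1. Qed.

Let cpsi : continuous (psi F) := psi_continuous dF.
Let sp : L2 (psi F) := continuous_L2 cpsi.
Let sp1 : L2 (psi1 F1) := L2_psi1 mF1 sqI_F1.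
Let sp2 : L2 (psi2 F1) := L2_psi2 mF1 sqI_F1.

Lemma psi_H10g : H10g (psi F) (psi1 F1) (psi2 F1).
Proof. by apply: ae_H10g (radial_H10g mF1 sqI_F1) sp.1 psi_ae. Qed.

Let eig w a1 a2 : H10g w a1 a2 -> ipB a1 (psi1 F1) + ipB a2 (psi2 F1) = m * ipB w (psi F).
Proof. by move=> H; apply: psi_eigen H. Qed.

Let gp w a1 a2 : H10g w a1 a2 -> ipB w w * ipB (psi F) (psi F) - ipB w (psi F) ^+ 2 <=
  8 * kappa R * (ipB a1 a1 + ipB a2 a2 - m * ipB w w).
Proof. by move=> H; apply: gap H. Qed.

Lemma disk_not_negligible : ~ {ae mu, forall x, B x -> False}.
Proof.
case=> N [mN N0 NB]; have := @kappa_gt0 R; rewrite -lte_fin -kappaE.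
suff -> : mu B = 0%E by rewrite ltxx.
apply/eqP; rewrite eq_le measure_ge0 andbT -N0; apply: le_measure; rewrite ?inE//.
  exact: mdisk.
by move=> x Bx; apply: NB => /= /(_ Bx).
Qed.

Lemma ip_psi_abs w : L2 w -> {ae mu, forall x, B x -> 0 <= w x} ->
  ipB w (psi F) = \int[mu]_(x in B) `|w x * psi F x|.
Proof.
move=> sw w0; have mwp := measurable_funM sw.1 sp.1.
apply: (@ae_Rintegral _ _ R mu B (@mdisk R)) => //; first exact: measurableT_comp.
apply: ae_imp w0 => x wx Bx; rewrite ger0_norm// mulr_ge0 ?wx//.
by rewrite ltW// psi_gt0.
Qed.

Lemma ip_psi_ge0 w : L2 w -> {ae mu, forall x, B x -> 0 <= w x} -> 0 <= ipB w (psi F).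
Proof. by move=> sw w0; rewrite ip_psi_abs//; apply: Rintegral_ge0. Qed.

Lemma ip_psi_gt0 w : L2 w -> {ae mu, forall x, B x -> 0 < w x} -> 0 < ipB w (psi F).
Proof.
move=> sw w0.
have w0' : {ae mu, forall x, B x -> 0 <= w x} by apply: ae_imp w0 => x h /h /ltW.
rewrite lt_neqAle ip_psi_ge0// andbT eq_sym; apply/negP => /eqP q0.
have z : {ae mu, forall x, B x -> w x * psi F x = 0}.
  apply: (@Rintegral_norm_eq0 _ _ R mu B _ (@mdisk R) (L2_mul sw sp)).
  by rewrite -q0 ip_psi_abs.
apply: disk_not_negligible; apply: ae_imp2 w0 z => x wx zx Bx.
have /eqP := zx Bx; rewrite mulf_eq0 !gt_eqF ?wx//.
exact: psi_gt0.
Qed.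

Let n0 := ipB (psi F) (psi F).

Lemma psi_norm_gt0 : 0 < n0.
Proof. by apply: ip_psi_gt0 => //; apply: aeW => x Bx; exact: psi_gt0. Qed.

Lemma psi_dirichlet : ipB (psi1 F1) (psi1 F1) + ipB (psi2 F1) (psi2 F1) = m * n0.
Proof. exact: eig psi_H10g. Qed.

(** The inverse of the Dirichlet norm of psi, by [psi_dirichlet]. *)
Definition ground_const := (Num.sqrt (m * n0))^-1.
Let c := ground_const.

Let c2 : c ^+ 2 * (m * n0) = 1.
Proof.
have h : 0 < m * n0 by rewrite mulr_gt0// psi_norm_gt0.
by rewrite /c /ground_const exprVn sqr_sqrtr ?mulVf ?gt_eqF// ltW.
Qed.

Let c0 : 0 < c.
Proof. by rewrite invr_gt0 sqrtr_gt0 mulr_gt0// psi_norm_gt0. Qed.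

Let dist2E a p : L2 a -> L2 p ->
  dist2 a (fun x => c * p x) = ipB a a - 2 * c * ipB a p + c ^+ 2 * ipB p p.
Proof.
move=> sa s; have mB := @mdisk R; have sc := L2_scal c s; have sac := L2_sub sa sc.
rewrite /dist2 (@ipBl _ _ R mu B mB _ _ _ sa sc sac).
rewrite (@ipBr _ _ R mu B mB _ _ _ sa sc sa) (@ipBr _ _ R mu B mB _ _ _ sa sc sc).
rewrite (@ipZr _ _ R mu B mB c _ _ s sa) (@ipZl _ _ R mu B mB c _ _ s sa).
rewrite (@ipZr _ _ R mu B mB c _ _ s sc) (@ipZl _ _ R mu B mB c _ _ s s) (ipC mu B p a).
ring.
Qed.

(* The gap inequality turns an almost optimal [L^2] norm into closeness in the Dirichlet norm. *)
Lemma close_ground_state w a1 a2 d : H10g w a1 a2 -> ipB a1 a1 + ipB a2 a2 = 1 ->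
  m^-1 - d <= ipB w w -> 0 <= ipB w (psi F) -> 0 <= d ->
  dist2 a1 (fun x => c * psi1 F1 x) + dist2 a2 (fun x => c * psi2 F1 x) <=
  2 * (m / n0 * (n0 + 8 * kappa R * m)) * d.
Proof.
move=> H e1' wd q0 d0; have [sw s1 s2 _] := H; have N0 := psi_norm_gt0.
rewrite (dist2E s1 sp1) (dist2E s2 sp2).
have E := eig H; have D := psi_dirichlet; have G := gp H.
set q := ipB w (psi F) in q0 E G *; set S := ipB w w in wd G.
have -> : ipB a1 a1 - 2 * c * ipB a1 (psi1 F1) + c ^+ 2 * ipB (psi1 F1) (psi1 F1) +
  (ipB a2 a2 - 2 * c * ipB a2 (psi2 F1) + c ^+ 2 * ipB (psi2 F1) (psi2 F1)) =
  2 - 2 * (c * m * q).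
  transitivity ((ipB a1 a1 + ipB a2 a2) - 2 * c * (ipB a1 (psi1 F1) + ipB a2 (psi2 F1)) +
    c ^+ 2 * (ipB (psi1 F1) (psi1 F1) + ipB (psi2 F1) (psi2 F1))); first by ring.
  by rewrite e1' E D c2; ring.
rewrite e1' -/n0 in G; have k0 := @kappa_gt0 R.
(* By the eigenvalue equation, t is the Dirichlet inner product of the unit vectors w and c psi, so
   the squared distance is 2 - 2 t. The gap inequality controls 1 - t^2, and t >= 0 allows the
   passage to 1 - t. *)
set t := c * m * q.
have t0 : 0 <= t by rewrite !mulr_ge0// ltW.
have t2 : n0 * t ^+ 2 = m * q ^+ 2.
  transitivity (c ^+ 2 * (m * n0) * (m * q ^+ 2)); first by rewrite /t; ring.
  by rewrite c2 mul1r.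
have mm : m * m^-1 = 1 by rewrite divff// gt_eqF.
have h1 : 1 - m * S <= m * d by have := ler_wpM2l (ltW m0) wd; rewrite mulrBr mm; lra.
have h2 : 8 * kappa R * (1 - m * S) <= 8 * kappa R * (m * d).
  by rewrite ler_wpM2l// mulr_ge0// ltW.
have h3 : S * n0 - 8 * kappa R * (m * d) <= q ^+ 2 by lra.
have h4 : m * (S * n0 - 8 * kappa R * (m * d)) <= n0 * t ^+ 2.
  by rewrite t2 ler_wpM2l// ltW.
have h5 : n0 * (1 - m * S) <= n0 * (m * d) by rewrite ler_wpM2l// ltW.
have h6 : n0 * (1 - t ^+ 2) <= m * (n0 + 8 * kappa R * m) * d by lra.
have h7 : 1 - t ^+ 2 <= m / n0 * (n0 + 8 * kappa R * m) * d.
  by rewrite -(ler_pM2l N0) (le_trans h6)// le_eqVlt; apply/orP; left; apply/eqP; field; rewrite gt_eqF.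
set K := m / n0 * (n0 + 8 * kappa R * m) in h7 *.
have K0 : 0 <= K * d.
  rewrite mulr_ge0// mulr_ge0//; first by rewrite divr_ge0// ltW.
  by rewrite addr_ge0 ?mulr_ge0// ltW.
have [t1|t1] := leP t 1; last by nra.
have : 1 - t <= 1 - t ^+ 2 by nra.
by nra.
Qed.

Let f1 (s : R) := c * F1 s.
Let mf1 : measurable_fun setT f1. Proof. exact: measurable_funM. Qed.
Let wf1 : wgt f1 = (fun s => c * wgt F1 s).
Proof. by apply/funext => s; rewrite /wgt /f1 mulrCA. Qed.
Let sf1 : sqI (wgt f1).
Proof. by rewrite wf1; apply: (sqintZ (@mI01 R)); exact: sqI_F1. Qed.

Let f1_energy : 4 * kappa R * ipI (wgt f1) (wgt f1) = 1.
Proof.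
have s1 := sqI_F1; have mI := @mI01 R; have sc := sqintZ mI c s1.
have E := radial_energy mF1 s1; rewrite psi_dirichlet in E.
rewrite wf1 (ipZl mI c s1 sc) (ipZr mI c s1 s1) -[RHS]c2 E; ring.
Qed.

Let prim_f1 s : I01 s -> prim f1 s = c * F s.
Proof.
move=> Is; rewrite -prim_F1//; move: Is; rewrite /prim /= in_itv/= => s01; rewrite s01.
have /andP[s0 _] := s01.
rewrite (@RintegralZl _ (measurableTypeR R) R leb `]s, 1[%classic) ?mulrN//.
exact: (tail_integrable mF1 sqI_F1 s0).
Qed.

(** The competitor is c psi rescaled with the inverse exponent 1/b, so that its own rescaling is c
    psi; then exp y - 1 >= y. *)
Lemma Srad_ge (alpha g : R) : 0 < alpha -> 0 < g ->
  (((2 / (alpha + 2)) ^+ 2 * g / m)%:E <= Srad alpha g)%E.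
Proof.
move=> a0 g0; set b := 2 / (alpha + 2); have mI := @mI01 R.
have b0 : 0 < b by rewrite divr_gt0// addr_gt0.
have bi0 : 0 < b^-1 by rewrite invr_gt0.
pose f0 := resc b^-1 f1.
have mf0 : measurable_fun setT f0 := measurable_resc _ mf1.
have [sf0 ef0] := resc_energy bi0 mf1 sf1.
have H0 := radial_H10g mf0 sf0.
have mp0 := measurable_prim mf0.
pose u0 := prim f0 \o @sq R.
have n1 : dirichlet_norm u0 = 1.
  by rewrite /dirichlet_norm (H10g_form H0 H0) (radial_energy mf0 sf0) ef0 f1_energy sqrtr1.
have rad0 : H10rad u0.
  split; first exact: H10g_H10 H0.
  exists (fun r => prim f0 (r ^+ 2)); split.
    by apply: measurable_funTS; apply: measurableT_comp => //; exact: measurable_funX.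
  by apply: aeW => x Bx; rewrite enormE sqr_sqrtr ?sq_ge0.
apply: (@le_trans _ _ (henon_moser alpha g u0)); last first.
  by apply: ereal_sup_ubound; exists u0.
have mu0 : measurable_fun B u0 by apply: measurable_funTS; exact: measurable_radial.
rewrite (henon_moser_radial a0 (ltW g0) mu0 mf0); last by apply: aeW.
rewrite -/b.
have pE s : I01 s -> prim f0 (s `^ b) = Num.sqrt b * (c * F s).
  move=> Is; rewrite prim_resc//; last exact: pow_I01.
  rewrite sqrtrV ?invrK ?ltW//; congr (_ * _); rewrite -prim_f1//; congr (prim _ _).
  move: Is; rewrite /= in_itv/= => /andP[s0 _].
  by rewrite -powRrM divff ?gt_eqF// powRr1// ltW.
have sF : sqI F.
  have sP := prim_sqI mF1 sqI_F1.
  by apply: (sqint_le mI _ sP); [exact: measurable_funTS|move=> s /prim_F1 ->].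
have iF := integrableZR mI (g * b * c ^+ 2) sF.2.
have k0 := @kappa_gt0 R.
have E : kappa R * b * (g * b * c ^+ 2 * \int[leb]_(s in I01) (F s ^+ 2)) = b ^+ 2 * g / m.
  have nE : n0 = kappa R * \int[leb]_(s in I01) (F s ^+ 2).
    by rewrite /n0 -[psi F]/(F \o @sq R) ip_radial//; congr (_ * _).
  transitivity (b ^+ 2 * g * (c ^+ 2 * n0)); first by rewrite nE; ring.
  congr (_ * _); apply: (mulfI (lt0r_neq0 m0)); rewrite mulfV ?gt_eqF// -[RHS]c2; ring.
rewrite -E (EFinM (kappa R * b) (_ * _)); apply: lee_wpmul2l; first by rewrite lee_fin mulr_ge0// ltW.
rewrite -(@RintegralZl _ (measurableTypeR R) R leb I01 _ _ mI); last exact: sF.2.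
rewrite /Rintegral fineK; last exact: (integrable_fin_num mI iF).
apply: ge0_le_integral => //.
- by move=> s _; rewrite lee_fin mulr_ge0 ?sqr_ge0// mulr_ge0 ?sqr_ge0// mulr_ge0// ltW.
- exact: (measurable_int leb iF).
- apply/measurable_EFinP; apply: measurable_funTS; apply: measurable_funB => //.
  apply: measurableT_comp => //; apply: measurable_funM => //; apply: measurable_funX.
  exact: (measurable_comp_pow b mp0).
move=> s Is; rewrite lee_fin pE//.
have -> : g * (Num.sqrt b * (c * F s)) ^+ 2 = g * b * c ^+ 2 * F s ^+ 2.
  by rewrite !exprMn (sqr_sqrtr (ltW b0)); ring.
by rewrite lerBrDl expR_ge1Dx.
Qed.

Lemma maximizer_close (alpha g : R) u v : 0 < alpha -> 0 < g ->
  g * (2 / (alpha + 2)) <= kappa R ->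
  is_nonneg_maximizer alpha g u -> is_profile u v ->
  exists a1 a2, H10g (rescaled alpha v) a1 a2 /\
  dist2 a1 (fun x => c * psi1 F1 x) + dist2 a2 (fun x => c * psi2 F1 x) <=
  2 * (m / n0 * (n0 + 8 * kappa R * m)) * (8 * g / kappa R * (2 / (alpha + 2))).
Proof.
move=> a0 g0; set b := 2 / (alpha + 2) => gb Mu uv; have mI := @mI01 R.
have b0 : 0 < b by rewrite divr_gt0// addr_gt0.
have [f [[mf sf] ef vf uf f0]] := maximizer_profile Mu uv.
have [wE Hw] := rescaled_H10g a0 uv.1 mf sf vf; rewrite -/b in wE Hw.
have [sr er] := resc_energy b0 mf sf; have mr := measurable_resc b mf.
exists (psi1 (resc b f)), (psi2 (resc b f)); split => //.
have k0 := @kappa_gt0 R; have mp := measurable_prim mr; have sP := prim_sqI mr sr.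
have [sw _ _ _] := Hw.
have sPs := L2_radial mp sP.
have wP : {ae mu, forall x, B x -> rescaled alpha v x = (prim (resc b f) \o @sq R) x} by [].
have Eww : ipB (rescaled alpha v) (rescaled alpha v) =
    kappa R * ipI (prim (resc b f)) (prim (resc b f)).
  by rewrite -ip_radial//; apply: (@ae_ip _ _ R mu B (@mdisk R)).
apply: close_ground_state Hw _ _ _ _.
- by rewrite (radial_energy mr sr) er.
- rewrite Eww.
  have [[Hu _] _ _ hm] := Mu; have [g1 [g2 Gu]] := H10_H10g Hu; have [su _ _ _] := Gu.
  have := Srad_ge a0 g0; rewrite -hm (henon_moser_radial a0 (ltW g0) su.1 mf uf) -/b.
  (* The value of the integral of s f^2 when the Dirichlet norm is 1; the hypothesis g b <= kappa
     amounts to g b e <= 1/4. *)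
  set e := (4 * kappa R)^-1.
  have eE : e = ipI (wgt (resc b f)) (wgt (resc b f)).
    by rewrite er; apply: (mulfI (_ : 4 * kappa R != 0)); rewrite ?ef ?divff// mulf_neq0// gt_eqF.
  have We s : I01 s -> prim (resc b f) s ^+ 2 <= - ln s * e.
    by rewrite /= in_itv/= => s01; rewrite eE; exact: prim_sq_le.
  have e0 : 0 <= e by rewrite invr_ge0 mulr_ge0// ltW.
  have gb0 : 0 <= g * b by rewrite mulr_ge0// ltW.
  have gbe : g * b * e <= 4^-1.
    by rewrite /e ler_pdivrMr ?mulr_gt0//; lra.
  have U := moser_upper sP gb0 We gbe e0.
  have -> : (\int[leb]_(s in I01) (expR (g * prim f (s `^ b) ^+ 2) - 1)%:E =
      \int[leb]_(s in I01) (expR (g * b * prim (resc b f) s ^+ 2) - 1)%:E)%E.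
    apply: eq_integral => s /set_mem Is; rewrite prim_resc// exprMn exprVn sqr_sqrtr ?ltW//.
    by congr (expR _ - 1)%:E; field; rewrite gt_eqF.
  move=> L; have kb0 : (0 <= (kappa R * b)%:E)%E by rewrite lee_fin mulr_ge0// ltW.
  have := le_trans L (lee_wpmul2l kb0 U); rewrite -EFinM lee_fin.
  set S := ipI _ _ => H.
  have b2g : 0 < b ^+ 2 * g by rewrite mulr_gt0// exprn_gt0.
  (* Upper and lower bounds share the factor b^2 g; dividing it out leaves the error 128 e^2 kappa g
     b = 8 g b / kappa. *)
  rewrite lerBlDr -(ler_pM2l b2g) (le_trans H)// le_eqVlt; apply/orP; left; apply/eqP.
  by rewrite /e; field; rewrite gt_eqF.
- apply: ip_psi_ge0 => //.
  have W0 : {ae leb, forall s, I01 s -> 0 <= prim (resc b f) s}.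
    apply: ae_imp (ae_pow b0 f0) => s h Is.
    by rewrite prim_resc// mulr_ge0 ?invr_ge0 ?sqrtr_ge0// h.
  by apply: ae_imp2 wE (ae_radial W0) => x h1 h2 Bx; rewrite h1// h2.
by rewrite mulr_ge0 ?(ltW b0)// divr_ge0 ?(ltW k0)// mulr_ge0// ltW.
Qed.

End ground_state.

(** * Convergence to the first eigenfunction *)

Section limit.
Variable R : realType.
Notation B := (disk R).
Notation mu := (mu2 R).
Notation ipB := (ip mu B).

Lemma dist2_tri (g h k : R * R -> R) : L2 g -> L2 h -> L2 k ->
  dist2 g h <= 2 * dist2 g k + 2 * dist2 h k.
Proof.
move=> sg sh sk.
have := @ip_sum2 _ _ R mu B (@mdisk R) _ _ (L2_sub sg sk) (L2_sub sk sh).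
have -> : ipB (fun x => k x - h x) (fun x => k x - h x) = dist2 h k.
  by rewrite /dist2; apply: eq_Rintegral => x _; rewrite -mulrNN !opprB.
congr (_ <= _); rewrite /dist2; congr ip; apply/funext => x; ring.
Qed.

(** Both the rescaled maximizer and phi1 are compared with the explicit function c psi, the latter
    at distance 0. *)
Lemma maximizer_dist (g lambda1 : R) (phi1 : R * R -> R) : 0 < g ->
  is_first_eigenfunction lambda1 phi1 ->
  exists K : R, forall alpha u v, 0 < alpha -> g * (2 / (alpha + 2)) <= kappa R ->
    is_nonneg_maximizer alpha g u -> is_profile u v ->
    dirichlet_norm (fun x => rescaled alpha v x - phi1 x) ^+ 2 <= K * (2 / (alpha + 2)).
Proof.
move=> g0 [_ [Hphi _ eigphi] phi0 phi_n].
have [F [F1 [F2 [l [[dF dF1 cF2 l0 FE] [F_0 F_1 F_gt0 F_nincr]]]]]] := first_profile R.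
have [h1 [h2 Hh]] := H10_H10g Hphi; have [sphi s1 s2 _] := Hh.
have Hpsi := psi_H10g dF dF1 F_1.
have e1' := H10g_normalized_energy Hh phi_n.
have k0 := @kappa_gt0 R.
set m := 4 * l; have m0 : 0 < m by rewrite mulr_gt0.
have q0 := ip_psi_gt0 dF F_gt0 sphi phi0.
(* Testing the equation of phi1 with psi and that of psi with phi1 gives the same form; the product
   <phi1, psi> cancels because both functions are positive. *)
have lm : lambda1 = m.
  have := eigphi _ (H10g_H10 Hpsi); rewrite (H10g_form Hh Hpsi).
  rewrite (psi_eigen dF dF1 cF2 FE Hh).
  by move/(mulIf (lt0r_neq0 q0)).
have S1 : m^-1 - 0 <= ipB phi1 phi1.
  have := eigphi _ Hphi; rewrite (H10g_form Hh Hh) e1' lm => E.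
  by rewrite subr0 -(ler_pM2l m0) mulfV ?gt_eqF// E.
(* The squared L^2 norm of phi1 is exactly 1/m, so the defect d is 0 and phi1 has the gradient of c
   psi. *)
have C1 := close_ground_state dF dF1 cF2 l0 FE F_0 F_1 F_gt0 F_nincr Hh e1' S1 (ltW q0) (lexx 0).
rewrite mulr0 in C1.
set c := ground_const F l in C1.
set K0 := 2 * (m / ipB (psi F) (psi F) * (ipB (psi F) (psi F) + 8 * kappa R * m)) * (8 * g / kappa R).
exists (2 * K0) => alpha u v a0 gb Mu uv.
have [a1 [a2 [Hw Cw]]] := maximizer_close dF dF1 cF2 l0 FE F_0 F_1 F_gt0 F_nincr a0 g0 gb Mu uv.
have [w1 w2] := H10g_wd Hw; have [v1 v2] := H10g_wd Hh.
have [sw t1 t2 _] := Hw; have [_ p1 p2 _] := Hpsi.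
rewrite /dirichlet_norm (form_sub sw sphi w1 w2 v1 v2) sqr_sqrtr; last by rewrite addr_ge0// dist2_ge0.
have T1 := dist2_tri t1 s1 (L2_scal c p1); have T2 := dist2_tri t2 s2 (L2_scal c p2).
have CwE : dist2 a1 (fun x => c * psi1 F1 x) + dist2 a2 (fun x => c * psi2 F1 x) <= K0 * (2 / (alpha + 2)).
  by move: Cw; rewrite /K0 /c -!mulrA.
move: Cw => _; lra.
Qed.

End limit.

Theorem theorem2 (R : realType) (gamma : R)
    (gamma_gt0 : 0 < gamma) (gamma_le4pi : gamma <= 4 * pi)
    (lambda1 : R) (phi1 : R * R -> R)
    (hphi1 : is_first_eigenfunction lambda1 phi1)
    (u : R -> R * R -> R) (v : R -> R -> R)
    (hu : forall alpha : R, 0 < alpha -> is_nonneg_maximizer alpha gamma (u alpha))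
    (hv : forall alpha : R, 0 < alpha -> is_profile (u alpha) (v alpha)) :
  (forall alpha : R, 0 < alpha -> H10 (rescaled alpha (v alpha))) /\
  dirichlet_norm (fun x => rescaled alpha (v alpha) x - phi1 x)
    @[alpha --> +oo] --> 0.
Proof.
split=> [alpha a0|].
  have [f [[mf sf] _ vf _ _]] := maximizer_profile (hu _ a0) (hv _ a0).
  have [_ Hw] := rescaled_H10g a0 (hv _ a0).1 mf sf vf.
  exact: H10g_H10 Hw.
have [K KP] := maximizer_dist gamma_gt0 hphi1.
have k0 := @kappa_gt0 R.
apply/cvgrPdist_lt => e e0.
near=> alpha.
have a0 : 0 < alpha by near: alpha; apply: nbhs_pinfty_gt; exact: num_real.
have a2 : 0 < alpha + 2 by rewrite addr_gt0.
(* This threshold gives gamma b <= kappa for b = 2/(alpha + 2); the next one makes K b smaller than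
   e^2. *)
have ak : 2 * gamma / kappa R < alpha by near: alpha; apply: nbhs_pinfty_gt; exact: num_real.
have ae : 2 * `|K| / e ^+ 2 < alpha by near: alpha; apply: nbhs_pinfty_gt; exact: num_real.
have gb : gamma * (2 / (alpha + 2)) <= kappa R.
  rewrite mulrA ler_pdivrMr//; move: ak; rewrite ltr_pdivrMr//; lra.
have H := KP _ _ _ a0 gb (hu _ a0) (hv _ a0).
rewrite sub0r normrN ger0_norm ?sqrtr_ge0//.
rewrite -(@ltr_pXn2r _ 2)// ?nnegrE ?sqrtr_ge0 ?(ltW e0)//.
apply: (le_lt_trans H); rewrite mulrA ltr_pdivrMr//.
have e2 : 0 < e ^+ 2 by rewrite exprn_gt0.
move: ae; rewrite ltr_pdivrMr// => ae.
by have := ler_norm K; lra.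
Unshelve. all: by end_near.
Qed.
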